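(* Locally standard torus actions are classified by the characteristic bundle and the Euler class of the orbit map up to equivariant homeomorphism. That is: for $i=1,2$ let $X_i$ be a $2n$-dimensional manifold equipped with a locally standard $T^n$-action. Then $X_1$ and $X_2$ are $T^n$-equivariantly homeomorphic if and only if there exists a stratification preserving homeomorphism $f_B\colon B_{X_1}\to B_{X_2}$ such that the bundle isomorphism $f_P:=f_B\times\mathrm{id}\colon B_{X_1}\times\mathrm{Aut}(T^n)\to B_{X_2}\times\mathrm{Aut}(T^n)$ sends $\mathcal L_{X_1}$ isomorphically to $\mathcal L_{X_2}$ and $f_P^*e(X_2)=e(X_1)$. Moreover, for any compact $n$-dimensional $C^0$ manifold $B$ with corners, any characteristic pair $(P,\mathcal L)$ on $B$ with $P=B\times\mathrm{Aut}(T^n)$, and any $e\in H^1(B;\mathfrak S_{(P,\mathcal L)})$, there exists a $2n$-dimensional $C^0$ manifold with a locally standard $T^n$-action whose orbit space, characteristic bundle and Euler class of the orbit map are $B$, $\mathcal L$ and $e$.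
   Context: $T^n=(S^1)^n$ acts on $\mathbb C^n$ by the standard representation $u\cdot z=(u_1z_1,\dots,u_nz_n)$. All manifolds and actions are $C^0$, and $X$ is compact. A $T^n$-action on a $2n$-dimensional manifold $X$ is locally standard if every point has a $T^n$-invariant open neighborhood $U$ with an automorphism $\rho$ of $T^n$ and a homeomorphism $\varphi$ from $U$ onto a $T^n$-invariant open subset of $\mathbb C^n$ with $\varphi(u\cdot x)=\rho(u)\cdot\varphi(x)$. $\mathbb R^n_{\ge0}=\{\xi\in\mathbb R^n:\xi_i\ge0\}$ is stratified by the sets $\mathcal S^{(k)}\mathbb R^n_{\ge0}$ of points with exactly $k$ nonzero coordinates. An $n$-dimensional $C^0$ manifold $B$ with corners is a Hausdorff space with charts onto open subsets of $\mathbb R^n_{\ge0}$ whose overlap maps are stratification preserving homeomorphisms; $\mathcal S^{(k)}B$ denotes the $k$-dimensional stratum. The orbit space $B_X=X/T^n$ is such a manifold (charts induced by $z\mapsto(|z_1|^2,\dots,|z_n|^2)$), and $\mu_X\colon X\to B_X$ is the orbit map. $\Lambda$ is the lattice of integral elements (kernel of $\exp$) in the Lie algebra of $T^n$; $\mathrm{Aut}(T^n)\cong\mathrm{GL}(\Lambda)$. A characteristic pair on $B$ with $P=B\times\mathrm{Aut}(T^n)$ is given by a rank one subbundle $\mathcal L\to\mathcal S^{(n-1)}B$ of $\mathcal S^{(n-1)}B\times\Lambda$ (the characteristic bundle) that is unimodular: for each $b\in\mathcal S^{(k)}B$ and small neighborhood $U$ of $b$ such that $U\cap\mathcal S^{(n-1)}B$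 has exactly $n-k$ components, over which $\mathcal L$ has constant fibers $L_1,\dots,L_{n-k}\subset\Lambda$, the lattice $L_1+\cdots+L_{n-k}$ is a rank $n-k$ direct summand of $\Lambda$ ($\mathcal L$ is empty if $\mathcal S^{(n-1)}B=\emptyset$). For a locally standard $T^n$-action on $X$, $P_X=B_X\times\mathrm{Aut}(T^n)$ and $\mathcal L_X=\coprod_aF_a\times L_a$, where $F_a$ are the connected components of $\mathcal S^{(n-1)}B_X$ and $L_a$ is the rank one sublattice of $\Lambda$ spanned by the integral element generating the circle subgroup of $T^n$ fixing $\mu_X^{-1}(F_a)$. Canonical model: for $b\in\mathcal S^{(k)}B$ let $Z_b\subset T^n$ be the $(n-k)$-dimensional subtorus generated by $L_1,\dots,L_{n-k}$. $X_{(P,\mathcal L)}=B\times T^n/\sim$ with $(b,u)\sim(b,u')$ iff $u'u^{-1}\in Z_b$; its projection to $B$ has abelian groups as fibers, and $\mathfrak S_{(P,\mathcal L)}$ is the sheaf of $C^0$ sections of this projection. The fibers of $X_{(P_X,\mathcal L_X)}$ act simply transitively on the fibers of $\mu_X$ by $[b,u]\cdot x=u\cdot x$. Choosing an open cover $\{U_\alpha\}$ of $B_X$ and $T^n$-equivariant homeomorphisms $h_\alpha$ from $\mu_X^{-1}(U_\alpha)$ to the part of $X_{(P_X,\mathcal L_X)}$ over $U_\alpha$ covering the identity, the equations $h_\alpha\circ h_\beta^{-1}(x)=\theta_{\alpha\beta}(b)x$ define a Čech cocycle of sections whose class $e(X)\in H^1(B_X;\mathfrak S_{(P_X,\mathcal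 L_X)})$ is the Euler class of the orbit map. If $f_P=f_B\times\mathrm{id}$ sends $\mathcal L_{X_1}$ to $\mathcal L_{X_2}$, the map $[b,u]\mapsto[f_B(b),u]$ between canonical models is a fiberwise group isomorphism and induces, by pulling back sections, $f_P^*\colon H^1(B_{X_2};\mathfrak S_{(P_{X_2},\mathcal L_{X_2})})\to H^1(B_{X_1};\mathfrak S_{(P_{X_1},\mathcal L_{X_1})})$. *)

(* Defs.v *)
From HB Require Import structures.
From mathcomp Require Import all_boot all_order all_algebra.
From mathcomp Require Import all_classical all_reals all_analysis.
From mathcomp Require Import complex.
Set Implicit Arguments.
Unset Strict Implicit.
Unset Printing Implicit Defensive.
Import Order.TTheory GRing.Theory Num.Theory numFieldNormedType.Exports.
Local Open Scope classical_set_scope.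
Local Open Scope quotient_scope.
Local Open Scope ring_scope.

(* The metric topology of the complex numbers. *)
HB.instance Definition _ (R : realType) :=
  PseudoPointedMetric.copy R[i] (R[i] : numClosedFieldType)^o.

Definition homeo_on (S T : topologicalType) (A : set S) (B : set T)
    (f : S -> T) : Prop :=
  [/\ set_bij A B f, {within A, continuous f} &
    exists2 g : T -> S, {within B, continuous g} & {in A, cancel f g}].

Definition homeo (S T : topologicalType) (f : S -> T) : Prop :=
  continuous f /\
  exists g : T -> S, [/\ continuous g, cancel f g & cancel g f].

(* Second countability is automatic, by compactness. *)
Definition compact_manifold (R : realType) (m : nat) (X : topologicalType)
    : Prop :=
  [/\ hausdorff_space X, compact [set: X] &
    forall x : X, exists (U : set X) (phi : X -> 'rV[R]_m),
      [/\ open U, U x, open (phi @` U) & homeo_on U (phi @` U) phi]].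

Section Torus.
Context (R : realType) (n : nat).

Definition torus_set : set 'rV[R[i]]_n := [set u | forall i, `|u ord0 i| = 1].

Definition torus : Type := set_type torus_set.
HB.instance Definition _ := Topological.copy torus (set_type torus_set).

Definition tcoord (u : torus) (i : 'I_n) : R[i] := \val u ord0 i.

Lemma tcoord_norm (u : torus) i : `|tcoord u i| = 1.
Proof. by have /set_mem := valP u; exact. Qed.

Definition torus_of (z : 'I_n -> R[i]) (hz : forall i, `|z i| = 1) : torus.
Proof.
by exists (\row_i z i); apply/mem_set => i; rewrite mxE.
Defined.

Lemma tcoord_of z hz i : tcoord (@torus_of z hz) i = z i.
Proof. by rewrite /tcoord /= mxE. Qed.

Lemma torus_ext (u v : torus) : tcoord u =1 tcoord v -> u = v.
Proof. by move=> uv; apply/val_inj/rowP. Qed.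

Lemma tone_norm (i : 'I_n) : `|1 : R[i]| = 1.
Proof. exact: normr1. Qed.

Lemma tmul_norm (u v : torus) i : `|tcoord u i * tcoord v i| = 1.
Proof. by rewrite normrM !tcoord_norm mulr1. Qed.

Lemma tinv_norm (u : torus) i : `|(tcoord u i)^-1| = 1.
Proof. by rewrite normfV tcoord_norm invr1. Qed.

Definition tone : torus := torus_of tone_norm.
Definition tmul (u v : torus) : torus := torus_of (tmul_norm u v).
Definition tinv (u : torus) : torus := torus_of (tinv_norm u).

Lemma tmulC : commutative tmul.
Proof. by move=> u v; apply: torus_ext => i; rewrite !tcoord_of mulrC. Qed.

Lemma tmulA : associative tmul.
Proof. by move=> u v w; apply: torus_ext => i; rewrite !tcoord_of mulrA. Qed.

Lemma tmul1 : left_id tone tmul.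
Proof. by move=> u; apply: torus_ext => i; rewrite !tcoord_of mul1r. Qed.

Lemma tmulV : left_inverse tone tinv tmul.
Proof.
move=> u; apply: torus_ext => i; rewrite !tcoord_of mulVf //.
by rewrite -normr_eq0 tcoord_norm oner_eq0.
Qed.

Lemma tmul1r : right_id tone tmul.
Proof. by move=> u; rewrite tmulC tmul1. Qed.

Lemma tmulVr : right_inverse tone tinv tmul.
Proof. by move=> u; rewrite tmulC tmulV. Qed.

HB.instance Definition _ :=
  isGroup.Build torus tmulA tmul1 tmul1r tmulV tmulVr.

Lemma texp_norm (t : 'rV[R]_n) i :
  `|(cos (2 * pi * t ord0 i) +i* sin (2 * pi * t ord0 i))%C| = 1.
Proof. by rewrite normc_def /= cos2Dsin2 sqrtr1. Qed.

(* The exponential map of T^n, on its Lie algebra R^n.  Its kernel is Z^n, so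
   that the lattice Lambda of integral elements is 'rV[int]_n. *)
Definition texp (t : 'rV[R]_n) : torus := torus_of (texp_norm t).

Definition one_param (v : 'rV[int]_n) (t : R) : torus :=
  texp (t *: map_mx intr v).

Definition subgroup (H : set torus) : Prop :=
  [/\ H 1%g, forall u v, H u -> H v -> H (u * v)%g & forall u, H u -> H u^-1%g].

Definition generated (G : set torus) : set torus :=
  [set u | forall H, subgroup H -> G `<=` H -> H u].

Lemma generated_subgroup (G : set torus) : subgroup (generated G).
Proof.
split=> [H [] //|u v hu hv H sH GH|u hu H sH GH].
- by have [_ hM _] := sH; apply: hM; [apply: hu|apply: hv].
- by have [_ _ hV] := sH; apply: hV; apply: hu.
Qed.

Definition torus_aut (rho : torus -> torus) : Prop :=
  {morph rho : u v / (u * v)%g} /\ homeo rho.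

Definition std_act (u : torus) (z : 'rV[R[i]]_n) : 'rV[R[i]]_n :=
  \row_i (tcoord u i * z ord0 i).

Definition invariant (X : Type) (a : torus -> X -> X) (U : set X) : Prop :=
  forall u x, U x -> U (a u x).

Record torus_action (X : topologicalType) := TorusAction {
  act :> torus -> X -> X;
  act1 : forall x, act 1%g x = x;
  actM : forall u v x, act (u * v)%g x = act u (act v x);
  act_continuous : continuous (fun p : torus * X => act p.1 p.2) }.

End Torus.

Section Corners.
Context (R : realType) (n : nat) (B : topologicalType).

(* The values of [coord] outside [dom] are irrelevant. *)
Record chart := Chart { dom : set B; coord : B -> 'rV[R]_n }.

Definition orthant : set 'rV[R]_n := [set xi | forall i, 0 <= xi ord0 i].

Definition nonzeros (xi : 'rV[R]_n) : nat := #|[pred i | xi ord0 i != 0]|.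

Definition corner_manifold (A : set chart) : Prop :=
  [/\ hausdorff_space B,
      forall b, exists2 c, A c & dom c b,
      forall c, A c ->
        [/\ open (dom c), homeo_on (dom c) (coord c @` dom c) (coord c) &
          exists2 O, open O & coord c @` dom c = orthant `&` O] &
      forall c d b, A c -> A d -> dom c b -> dom d b ->
        nonzeros (coord c b) = nonzeros (coord d b)].

Context (A : set chart).

Definition stratum (k : nat) : set B :=
  [set b | exists c, [/\ A c, dom c b & nonzeros (coord c b) = k]].

(* The stratum of dimension n - 1; it is empty if n = 0. *)
Definition facets : set B := [set b | exists2 k, k.+1 = n & stratum k b].

(* U is a neighborhood of b whose intersection with the (n-1)-dimensional
   stratum has exactly m components F_0, ..., F_{m-1}.  The requirement that all
   of them be adherent to b expresses that U is small: otherwise two facets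
   could be connected to each other in U away from b, and the count be
   completed by a component of U unrelated to b. *)
Definition local_facets (b : B) (U : set B) (m : nat) (F : 'I_m -> set B)
    : Prop :=
  [/\ open U, U b, injective F,
      range F = connected_component (U `&` facets) @` (U `&` facets) &
      forall i, closure (F i) b].

Local Notation Lambda := 'rV[int]_n.

Definition line (v : Lambda) : set Lambda := [set z *: v | z in [set: int]].

Definition lattice_sum (m : nat) (Ls : 'I_m -> set Lambda) : set Lambda :=
  [set \sum_i v i | v in [set v : 'I_m -> Lambda | forall i, Ls i (v i)]].

Definition has_rank (m : nat) (M : set Lambda) : Prop :=
  exists e : 'I_m -> Lambda,
    M = lattice_sum (fun i => line (e i)) /\
    forall z : 'I_m -> int, \sum_i z i *: e i = 0 -> forall i, z i = 0.

Definition direct_summand (M : set Lambda) : Prop :=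
  exists N : set Lambda,
    [/\ N 0, forall v w, N v -> N w -> N (v - w) &
      forall v, exists! p : Lambda * Lambda,
        [/\ M p.1, N p.2 & v = p.1 + p.2]].

(* A family of sublattices of Lambda is given by its total space
   L : set (B * Lambda). *)
Definition fiber (L : set (B * Lambda)) (b : B) : set Lambda :=
  [set v | L (b, v)].

Definition rank_one_subbundle (L : set (B * Lambda)) : Prop :=
  [/\ forall b v, L (b, v) -> facets b,
      forall b, facets b -> exists2 v, v != 0 & fiber L b = line v &
      forall b, facets b -> exists U,
        [/\ open U, U b &
          forall b', U b' -> facets b' -> fiber L b' = fiber L b]].

Definition unimodular (L : set (B * Lambda)) : Prop :=
  forall (k : nat) (b : B) (U : set B) (F : 'I_(n - k) -> set B)
      (Ls : 'I_(n - k) -> set Lambda),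
    stratum k b -> local_facets b U F ->
    (forall i x, F i x -> fiber L x = Ls i) ->
    has_rank (n - k) (lattice_sum Ls) /\ direct_summand (lattice_sum Ls).

(* The pair (P, L) where P is the trivial bundle B x Aut(T^n). *)
Definition characteristic_pair (L : set (B * Lambda)) : Prop :=
  rank_one_subbundle L /\ unimodular L.

Context (L : set (B * Lambda)).

(* The subtorus Z_b, generated by the circles exp(R L_i). *)
Definition Zsub (b : B) : set (torus R n) :=
  generated [set u | exists k U (F : 'I_(n - k) -> set B) i x v t,
    [/\ stratum k b, local_facets b U F, F i x, L (x, v) &
      u = one_param v t]].

Definition model_rel : rel (B * torus R n) :=
  fun p q => `[< p.1 = q.1 /\ Zsub p.1 (q.2 * p.2^-1)%g >].

Lemma model_rel_equiv : equiv_class_of model_rel.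
Proof.
have sZ b : subgroup (Zsub b) by exact: generated_subgroup.
split=> [[b u]|[b u] [c v]|[c v] [b u] [d w]] /=.
- by apply/asboolP; split=> //=; rewrite mulgV; have [] := sZ b.
- have sym b' u' c' v' : model_rel (b', u') (c', v') ->
      model_rel (c', v') (b', u').
    move=> /asboolP[/= <- h]; apply/asboolP; split=> //=.
    have [_ _ hV] := sZ b'.
    by have := hV _ h; rewrite invgM invgK.
  by apply/idP/idP; exact: sym.
- move=> /asboolP[/= <- h1] /asboolP[/= <- h2]; apply/asboolP; split=> //=.
  have [_ hM _] := sZ b.
  by have := hM _ _ h2 h1; rewrite mulgA mulgVK.
Qed.

Canonical model_equiv := EquivRelPack model_rel_equiv.

(* The canonical model X_(P,L), with the quotient topology. *)
Definition model : Type := quotient_topology {eq_quot model_equiv}.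
HB.instance Definition _ :=
  Topological.copy model (quotient_topology {eq_quot model_equiv}).
HB.instance Definition _ :=
  Quotient.copy model (quotient_topology {eq_quot model_equiv}).

Definition mclass (b : B) (u : torus R n) : model := \pi_model (b, u).
Definition mproj (q : model) : B := (repr q).1.
Definition mact (u : torus R n) (q : model) : model :=
  mclass (mproj q) (u * (repr q).2)%g.

(* The group law of the fibers; only meaningful if mproj p = mproj q. *)
Definition mmul (p q : model) : model := mact (repr p).2 q.

Definition is_section (U : set B) (s : B -> model) : Prop :=
  (forall b, U b -> mproj (s b) = b) /\ {within U, continuous s}.

(* An open cover together with a 1-cochain of the sheaf of sections; the values
   of [cech_val i j] outside the overlap of the i-th and j-th open sets are
   irrelevant. *)
Record cech := Cech {
  cech_idx : Type;
  cech_cover : cech_idx -> set B;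
  cech_val : cech_idx -> cech_idx -> B -> model }.

Arguments cech_cover : clear implicits.
Arguments cech_val : clear implicits.

Definition cocycle (c : cech) : Prop :=
  [/\ forall i, open (cech_cover c i),
      forall b, exists i, cech_cover c i b,
      forall i j,
        is_section (cech_cover c i `&` cech_cover c j) (cech_val c i j) &
      forall i j k b,
        cech_cover c i b -> cech_cover c j b -> cech_cover c k b ->
        mmul (cech_val c i j b) (cech_val c j k b) = cech_val c i k b].

(* The restrictions of c and d to a common refinement W of their covers differ
   by the coboundary of a 0-cochain. *)
Definition cohomologous (c d : cech) : Prop :=
  exists (K : Type) (W : K -> set B) (r : K -> cech_idx c)
      (s : K -> cech_idx d) (tau : K -> B -> model),
    [/\ forall k, open (W k),
        forall b, exists k, W k b,
        forall k, W k `<=` cech_cover c (r k) `&` cech_cover d (s k),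
        forall k, is_section (W k) (tau k) &
        forall k l b, W k b -> W l b ->
          mmul (cech_val c (r k) (r l) b) (tau l b) =
          mmul (tau k b) (cech_val d (s k) (s l) b)].

Definition cech_class (c : cech) : set cech :=
  [set d | cocycle d /\ cohomologous c d].

(* The first Cech cohomology set of B with values in the sheaf of sections:
   its elements are the cohomology classes of cocycles. *)
Definition H1 : set (set cech) := [set cech_class c | c in cocycle].

End Corners.

Arguments cech_cover {R n B A L} c _ _ : rename.
Arguments cech_val {R n B A L} c _ _ _ : rename.
Arguments H1 {R n B} A L _.

Definition stratified_homeo (R : realType) (n : nat) (B1 B2 : topologicalType)
    (A1 : set (chart R n B1)) (A2 : set (chart R n B2)) (f : B1 -> B2) : Prop :=
  homeo f /\ forall k, f @` stratum A1 k = stratum A2 k.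

(* The effect of f x id_Aut(T^n) on subsets of B1 x Lambda. *)
Definition bundle_image (n : nat) (B1 B2 : Type) (f : B1 -> B2)
    (L : set (B1 * 'rV[int]_n)) : set (B2 * 'rV[int]_n) :=
  (fun p => (f p.1, p.2)) @` L.

Section Pullback.
Context (R : realType) (n : nat) (B1 B2 : topologicalType).
Context (A1 : set (chart R n B1)) (L1 : set (B1 * 'rV[int]_n)).
Context (A2 : set (chart R n B2)) (L2 : set (B2 * 'rV[int]_n)).
Variable f : B1 -> B2.

(* The section of the model over B1 whose image under [b, u] |-> [f b, u] is s:
   if s (f b) = [f b, u] then its value at b is [b, u]. *)
Definition pull_section (s : B2 -> model A2 L2) : B1 -> model A1 L1 :=
  fun b => mclass A1 L1 b (repr (s (f b))).2.

Definition pull_cech (c : cech A2 L2) : cech A1 L1 :=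
  Cech (fun i => f @^-1` cech_cover c i)
       (fun i j => pull_section (cech_val c i j)).

Definition pull_class (E : set (cech A2 L2)) : set (cech A1 L1) :=
  \bigcup_(c in E) cech_class (pull_cech c).

End Pullback.

Section LocallyStandard.
Context (R : realType) (n : nat) (X : topologicalType).
Variable a : torus_action R n X.

Definition standard_chart (U : set X) (rho : torus R n -> torus R n)
    (phi : X -> 'rV[R[i]]_n) : Prop :=
  [/\ open U /\ invariant a U,
      open (phi @` U) /\ invariant (@std_act R n) (phi @` U),
      torus_aut rho,
      homeo_on U (phi @` U) phi &
      forall u x, U x -> phi (a u x) = std_act (rho u) (phi x)].

Definition locally_standard : Prop :=
  forall x, exists U rho phi, standard_chart U rho phi /\ U x.

Definition orbit_rel : rel X := fun x y => `[< exists u, y = a u x >].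

Lemma orbit_rel_equiv : equiv_class_of orbit_rel.
Proof.
have aV u x : a u^-1%g (a u x) = x by rewrite -actM mulVg act1.
split=> [x|x y|y x z].
- by apply/asboolP; exists 1%g; rewrite act1.
- by apply/asboolP/asboolP => -[u ->]; exists u^-1%g; rewrite aV.
- by move=> /asboolP[u ->] /asboolP[v ->]; apply/asboolP; exists (v * u)%g;
    rewrite actM.
Qed.

Canonical orbit_equiv := EquivRelPack orbit_rel_equiv.

Definition orbit_space : Type := quotient_topology {eq_quot orbit_equiv}.
HB.instance Definition _ :=
  Topological.copy orbit_space (quotient_topology {eq_quot orbit_equiv}).
HB.instance Definition _ :=
  Quotient.copy orbit_space (quotient_topology {eq_quot orbit_equiv}).

Definition orbit_map (x : X) : orbit_space := \pi_orbit_space x.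

Definition sqnorms (z : 'rV[R[i]]_n) : 'rV[R]_n :=
  \row_i (complex.Re (z ord0 i) ^+ 2 + complex.Im (z ord0 i) ^+ 2).

Definition orbit_atlas : set (chart R n orbit_space) :=
  [set c | exists U rho phi,
    [/\ standard_chart U rho phi, dom c = orbit_map @` U &
      forall x, U x -> coord c (orbit_map x) = sqnorms (phi x)]].

(* v is a generator of the lattice of integral elements of the circle subgroup
   formed by the elements of T^n that fix every point over F. *)
Definition circle_generator (F : set orbit_space) (v : 'rV[int]_n) : Prop :=
  [set u | forall x, F (orbit_map x) -> a u x = x] = range (@one_param R n v)
  /\ forall t : R, one_param v t = 1%g -> exists z : int, t = z%:~R.

Definition char_bundle : set (orbit_space * 'rV[int]_n) :=
  [set p | facets orbit_atlas p.1 /\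
    exists2 v, circle_generator
                 (connected_component (facets orbit_atlas) p.1) v
             & line v p.2].

Definition orbit_model : topologicalType := model orbit_atlas char_bundle.

Definition trivialization (U : set orbit_space) (h : X -> orbit_model)
    : Prop :=
  [/\ homeo_on (orbit_map @^-1` U) [set q | U (mproj q)] h,
      forall x, U (orbit_map x) -> mproj (h x) = orbit_map x &
      forall u x, U (orbit_map x) -> h (a u x) = mact u (h x)].

(* c is obtained from a choice of local trivializations h_i, that is,
   h_i (h_j^-1 q) = c_ij(b) q, where q = h_j x. *)
Definition euler_cocycle (c : cech orbit_atlas char_bundle) : Prop :=
  cocycle c /\
  exists h : cech_idx c -> X -> orbit_model,
    (forall i, trivialization (cech_cover c i) (h i)) /\
    forall i j x,
      cech_cover c i (orbit_map x) -> cech_cover c j (orbit_map x) ->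
      h i x = mmul (cech_val c i j (orbit_map x)) (h j x).

(* The common cohomology class of the cocycles obtained in this way. *)
Definition euler_class : set (cech orbit_atlas char_bundle) :=
  \bigcup_(c in euler_cocycle) cech_class c.

End LocallyStandard.

Arguments orbit_map {R n X} a x.
Arguments orbit_atlas {R n X} a _.
Arguments circle_generator {R n X} a F v.
Arguments char_bundle {R n X} a _.
Arguments trivialization {R n X} a U h.
Arguments euler_cocycle {R n X} a c.
Arguments euler_class {R n X} a _.

(* Main.v *)
From HB Require Import structures.
Require Import Defs.
From mathcomp Require Import all_boot all_order all_algebra.
From mathcomp Require Import all_classical all_reals all_analysis.
From mathcomp Require Import complex ring lra zify.
Require Import Defs.

(** The canonical model serves as a local normal form. Over a small open set U of
    the orbit space, an automorphism rho of the torus carries the subtori Z_b to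
    coordinate subtori ([nfchart]), and [b, u] |-> rho(u) . sqrt(xi(b)) identifies
    the part of the model over U with an open subset of C^n ([nfmap_homeo]). So a
    locally standard action and the model of its orbit space have the same local
    charts. Over small open sets there are therefore equivariant homeomorphisms
    h_i with the model; their quotients form a cocycle c, and this situation is
    called a realization of c ([realizes]).

    Two realizations of cohomologous cocycles are equivariantly homeomorphic: the
    cochain tau with coboundary c1/c2 corrects the local homeomorphisms
    h2_i^-1 o h1_i into one global map ([realizes_map]). Conversely any two
    cocycles realized by the same action are cohomologous
    ([realizes_cohomologous]). Hence the Euler class of an action is the class of
    any cocycle that it realizes, even over a space that is only isomorphic to
    the orbit space ([euler_pull]), and the classification follows
    ([classification]): a homeomorphism of orbit spaces that respects the
    characteristic bundles identifies the models, and the Euler classes decide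
    whether it lifts.

    That the orbit space carries the charts of a manifold with corners, with the
    stabilizers as subtori Z_b, rests on two facts about the torus. Its automorphisms send the
    coordinate circles to circles t |-> exp(t v) with v integral, because the
    continuous characters of the line are exponentials ([circle_char]). And the
    rank of a subtorus is intrinsic ([srank_uniq]), so that the stabilizers
    determine the strata.

    For the existence part, unimodularity and the Smith normal form provide the
    automorphism rho ([char_pair_good]), and a cocycle c is realized by gluing the
    parts of the model over the sets of its cover along the translations c_ij
    ([glued_realizes]). The local charts of the model make the glued space a
    compact manifold with a locally standard action ([realized_manifold]), and its
    stabilizers, which are the groups Z_b, give back the strata and the
    characteristic bundle ([realized_existence], [realized_char_bundle]). *)

Set Implicit Arguments.
Unset Strict Implicit.
Unset Printing Implicit Defensive.
Import Order.TTheory GRing.Theory Num.Theory numFieldNormedType.Exports.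
Local Open Scope classical_set_scope.
Local Open Scope quotient_scope.
Local Open Scope ring_scope.

(** * The complex plane and the characters of the real line *)

Lemma cvg_rV (T : topologicalType) (n : nat) (I : Type) (F : set_system I)
    (f : I -> 'rV[T]_n) (l : 'rV[T]_n) : Filter F ->
  (forall i, (fun x => f x ord0 i) @ F --> l ord0 i) -> f @ F --> l.
Proof.
move=> FF fl A [P Pl sPA]; rewrite /nbhs /=.
have : \forall x \near F, forall ij : 'I_1 * 'I_n, P ij.1 ij.2 (f x ij.1 ij.2).
  apply: (@filter_forall _ _ (fun ij x => P ij.1 ij.2 (f x ij.1 ij.2))) => -[i j] /=.
  by rewrite (ord1 i); apply: fl; have := Pl ord0 j.
by apply: filterS => x Px; apply: sPA => i j; exact: (Px (i, j)).
Qed.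

Lemma rV_coord_continuous (T : topologicalType) (n : nat) (i : 'I_n) :
  continuous (fun z : 'rV[T]_n => z ord0 i).
Proof.
move=> z A zA; exists (fun j k => if k == i then A else setT) => [j k|w /=].
  by case: eqP => [->|_]; [rewrite ord1|exact: filterT].
by move/(_ ord0 i); rewrite eqxx.
Qed.

Section Complex.
Context {R : realType}.
Local Notation C := R[i].

Lemma near_norm_lt (z e : C) : 0 < e -> \forall w \near z, `|z - w| < e.
Proof. by move=> e0; have := @nbhsx_ballx C C z e e0; exact: filterS. Qed.

Lemma Re_continuous : continuous (@complex.Re R : C -> R).
Proof.
move=> z; apply/(@cvgrPdist_lt _ _ _ _ (nbhs_filter z)) => e e0.
have e0' : 0 < (e%:C)%C by rewrite ltcR.
have := near_norm_lt z e0'.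
apply: filterS => w; rewrite -!ltcR; apply: le_lt_trans.
by have := normc_ge_Re (z - w); rewrite raddfB.
Qed.

Lemma Im_continuous : continuous (@complex.Im R : C -> R).
Proof.
have ImE z : complex.Im z = complex.Re (z * ((-1)*i)%C).
  by case: z => x y /=; rewrite !mulr0 mulrN mulr1 sub0r opprK.
have ni : `|((-1)*i)%C : C| = 1.
  by rewrite normc_def /= expr0n add0r sqrrN expr1n sqrtr1.
move=> z; apply/(@cvgrPdist_lt _ _ _ _ (nbhs_filter z)) => e e0.
have e0' : 0 < (e%:C)%C by rewrite ltcR.
have := near_norm_lt z e0'.
apply: filterS => w; rewrite -!ltcR; apply: le_lt_trans.
have := normc_ge_Re ((z - w) * ((-1)*i)%C).
by rewrite -ImE raddfB normrM ni mulr1.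
Qed.

Lemma normc_real (x : R) : `|(x%:C)%C : C| = (`|x|%:C)%C.
Proof. by rewrite normc_def /= expr0n addr0 sqrtr_sqr. Qed.

Lemma normc_le_sum (x y : R) : `|(x +i* y)%C : C| <= ((`|x| + `|y|)%:C)%C.
Proof.
have -> : ((x +i* y)%C : C) = (x%:C)%C + 'i%C * (y%:C)%C by rewrite [LHS]complexE.
have ni : `|'i%C : C| = 1 by rewrite normc_def /= expr0n add0r expr1n sqrtr1.
by apply: le_trans (ler_normD _ _) _; rewrite normrM ni mul1r !normc_real rmorphD.
Qed.

Lemma cvg_complex (I : Type) (F : set_system I) (f g : I -> R) (a b : R) :
  Filter F -> f @ F --> a -> g @ F --> b ->
  (fun x => (f x +i* g x)%C : C) @ F --> (a +i* b)%C.
Proof.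
move=> FF fa gb A /(@nbhs_ballP C C) [[e e'] /=].
rewrite ltcE /= => /andP[/eqP -> {e'} e0] eA.
have e2 : 0 < e / 2 by rewrite divr_gt0.
have h1 : \forall x \near F, ball a (e / 2) (f x) := fa _ (@nbhsx_ballx R R a _ e2).
have h2 : \forall x \near F, ball b (e / 2) (g x) := gb _ (@nbhsx_ballx R R b _ e2).
apply: filterS2 h1 h2 => x h1 h2; apply: eA.
apply: le_lt_trans (_ : ((`|a - f x| + `|b - g x|)%:C)%C < _).
  exact: (normc_le_sum (a - f x) (b - g x)).
by rewrite ltcR (splitr e) ltrD.
Qed.

Definition cis (t : R) : C := (cos t +i* sin t)%C.

Lemma cisD s t : cis (s + t) = cis s * cis t.
Proof. by rewrite /cis cosD sinD; simpc; congr (_ +i* _)%C; rewrite addrC. Qed.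

Lemma cis0 : cis 0 = 1.
Proof. by rewrite /cis cos0 sin0. Qed.

Lemma cisN t : cis (- t) = (cis t)^-1.
Proof.
apply: (@mulrI _ (cis t)); last first.
  rewrite -cisD subrr cis0 mulrV //; apply/unitrPr; exists (cis (-t)).
  by rewrite -cisD subrr cis0.
by apply/unitrPr; exists (cis (-t)); rewrite -cisD subrr cis0.
Qed.

Lemma norm_cis t : `|cis t| = 1.
Proof. by rewrite normc_def /= cos2Dsin2 sqrtr1. Qed.

Lemma cis_continuous : continuous cis.
Proof. by move=> t; apply: cvg_complex; [exact: continuous_cos|exact: continuous_sin]. Qed.

Lemma cis2pi_int (k : int) : cis (2 * pi * k%:~R) = 1.
Proof.
have H (m : nat) : cis (2 * pi * m%:R) = 1.
  elim: m => [|m IH]; first by rewrite mulr0 cis0.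
  rewrite -[m.+1%:R]natr1 mulrDr cisD IH mul1r mulr1 /cis.
  by rewrite mulr_natl cos2pi sin2pi.
by case: k => m; [exact: H|rewrite NegzE mulrNz mulrN cisN H invr1].
Qed.

Lemma cis_eq1 t : cis t = 1 -> exists k : int, t = 2 * pi * k%:~R.
Proof.
move=> t1; pose p : R := 2 * pi.
have p0 : 0 < p by rewrite mulr_gt0 ?pi_gt0.
pose k := Num.floor (t / p); exists k.
pose y := t - p * k%:~R.
have y1 : cis y = 1 by rewrite /y cisD t1 mul1r cisN cis2pi_int invr1.
have yb : 0 <= y < p.
  have /andP[k1 k2] := floor_itv (t / p).
  rewrite /y subr_ge0 ltrBlDr mulrC -ler_pdivlMr // k1 /=.
  by move: k2; rewrite ltr_pdivrMr // intrD1 mulrDl mul1r addrC [k%:~R * _]mulrC.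
suff /eqP : y = 0 by rewrite subr_eq0 => /eqP.
have c1 : cos y = 1 by case: y1.
have s0 : sin (y / 2) = 0.
  move: c1; rewrite {1}(splitr y) cosD -!expr2 => h.
  have h2 := cos2Dsin2 (y / 2); apply/eqP; rewrite -sqrf_eq0.
  by apply/eqP; lra.
apply/eqP; case: (ltP 0 y) => [y0|]; last first.
  by move=> y0; rewrite eq_le y0; case/andP: yb.
have : 0 < sin (y / 2).
  apply: sin_gt0_pi; rewrite divr_gt0 //= ltr_pdivrMr // mulrC.
  by case/andP: yb.
by rewrite s0 ltxx.
Qed.

Lemma cis_surj (z : C) : `|z| = 1 -> exists2 t, `|t| <= pi & z = cis t.
Proof.
case: z => a b; rewrite normc_def /= => -[h].
have h2 : a ^+ 2 + b ^+ 2 = 1.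
  by have := sqr_sqrtr (addr_ge0 (sqr_ge0 a) (sqr_ge0 b)); rewrite h expr1n.
have a1 : -1 <= a <= 1.
  by rewrite -ler_norml -(@ler_pXn2r _ 2) ?nnegrE // expr1n
    real_normK ?num_real // -h2 lerDl sqr_ge0.
have sb : sin (acos a) = `|b|.
  rewrite sin_acos // -h2 addrAC subrr add0r; exact: sqrtr_sqr.
have ap : `|acos a| <= pi by rewrite ger0_norm ?acos_ge0 ?acos_lepi.
case: (lerP 0 b) => b0.
  by exists (acos a) => //; rewrite /cis acosK ?in_itv //= sb ger0_norm.
exists (- acos a); rewrite ?normrN // /cis cosN sinN acosK ?in_itv //= sb.
by rewrite ltr0_norm // opprK.
Qed.

Lemma cvgCM (I : Type) (F : set_system I) (f g : I -> C) (a b : C) : Filter F ->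
  f @ F --> a -> g @ F --> b -> (fun x => f x * g x) @ F --> a * b.
Proof. by move=> FF; exact: (@cvgM C I F FF f g a b). Qed.

Lemma cvgCV (I : Type) (F : set_system I) (f : I -> C) (a : C) : Filter F ->
  a != 0 -> f @ F --> a -> (fun x => (f x)^-1) @ F --> a^-1.
Proof. by move=> FF; exact: (@cvgV C I F FF f a). Qed.

Lemma cis_right (z : C) : `|z| = 1 -> 0 < complex.Re z ->
  exists2 t, `|t| < pi / 2 & z = cis t.
Proof.
case: z => a b; rewrite normc_def /= => -[h] a0.
have h2 : a ^+ 2 + b ^+ 2 = 1.
  by have := sqr_sqrtr (addr_ge0 (sqr_ge0 a) (sqr_ge0 b)); rewrite h expr1n.
have b1 : -1 < b < 1.
  rewrite -ltr_norml -(@ltr_pXn2r _ 2) ?nnegrE // expr1n real_normK ?num_real //.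
  by rewrite -h2 ltrDr exprn_gt0.
have b1' : -1 <= b <= 1 by case/andP: b1 => /ltW -> /ltW ->.
exists (asin b).
  have /andP[l u] := b1.
  by rewrite ltr_norml asin_gtNpi2 ?asin_ltpi2 // ?l ?u ?(ltW l) ?(ltW u).
rewrite /cis asinK ?in_itv //= cos_asin // -h2 addrK sqrtr_sqr.
by rewrite gtr0_norm.
Qed.

Lemma small_dyadic (d r : R) : 0 < d -> 0 < r -> exists m : nat, d / 2 ^+ m < r.
Proof.
move=> d0 r0; exists (Num.bound (d / r)).
rewrite ltr_pdivrMr ?exprn_gt0 // -ltr_pdivrMl // mulrC.
have h : 0 <= d / r by rewrite divr_ge0 // ltW.
apply: lt_trans (archi_boundP h) _.
by rewrite -natrX ltr_nat ltn_expl.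
Qed.

(** The halving argument: near 0 a character is determined at [d / 2 ^ m.+1] by
    its value at [d / 2 ^ m], as the square root with positive real part. *)
Lemma circle_char (chi : R -> C) : continuous chi ->
  (forall s t, chi (s + t) = chi s * chi t) -> (forall t, `|chi t| = 1) ->
  exists a, forall t, chi t = cis (a * t).
Proof.
move=> chic chiD chi1.
have nz t : chi t != 0 by rewrite -normr_eq0 chi1 oner_eq0.
have chi0 : chi 0 = 1.
  by apply: (mulIf (nz 0)); rewrite -chiD addr0 mul1r.
have [e /= e0 epos] : exists2 e : R, 0 < e &
    forall t, `|t| < e -> 0 < complex.Re (chi t).
  have h : (fun t => complex.Re (chi t)) @ (0 : R) --> complex.Re (chi 0).
    exact: (cvg_comp chi (@complex.Re R) (chic 0) (@Re_continuous _)).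
  have h1 : 0 < complex.Re (chi 0) by rewrite chi0.
  have [e /= e0 H] := (@nbhs_ballP R R 0 _).1 (cvgr_gt _ h _ h1); exists e => // t te.
  by apply: H; rewrite /ball /= sub0r normrN.
pose d := e / 2; have d0 : 0 < d by rewrite divr_gt0.
have de : d < e by rewrite /d {2}(splitr e) ltrDl divr_gt0.
have pw m : (0 : R) < 2 ^+ m by rewrite exprn_gt0.
have dm m : `|d / 2 ^+ m| < e.
  rewrite ger0_norm ?divr_ge0 ?ltW // ltr_pdivrMr //; apply: lt_le_trans de _.
  by rewrite ler_peMr ?(ltW e0) // exprn_ege1 // ler1n.
have [th thb thE] : exists2 t, `|t| < pi / 2 & chi d = cis t.
  apply: cis_right => //; apply: epos; by have := dm 0%N; rewrite expr0 divr1.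
have half x m : x / 2 ^+ m.+1 + x / 2 ^+ m.+1 = x / 2 ^+ m :> R.
  by rewrite exprSr invfM mulrA -splitr.
have chim m : chi (d / 2 ^+ m) = cis (th / 2 ^+ m).
  elim: m => [|m IH]; first by rewrite expr0 !divr1.
  have : chi (d / 2 ^+ m.+1) ^+ 2 == cis (th / 2 ^+ m.+1) ^+ 2.
    by rewrite !expr2 -chiD -cisD !half IH.
  rewrite eqf_sqr => /orP[/eqP//|/eqP h].
  have := epos _ (dm m.+1); rewrite h /= oppr_gt0 ltNge => /negP[].
  apply: ltW; apply: cos_gt0_pihalf; rewrite -ltr_norml.
  apply: le_lt_trans thb; rewrite normrM ler_piMr // ger0_norm ?invr_ge0 ?(ltW (pw _)) //.
  by rewrite invf_le1 // exprn_ege1 // ler1n.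
pose a := th / d; exists a => t.
pose D t : C := chi t * cis (- (a * t)).
have DD s u : D (s + u) = D s * D u.
  by rewrite /D chiD mulrDr opprD cisD mulrACA.
have Dm m : D (d / 2 ^+ m) = 1.
  rewrite /D chim -cisD (_ : _ + _ = 0) ?cis0 //.
  by rewrite /a mulrA divfK ?lt0r_neq0 // subrr.
have D0 : D 0 = 1 by rewrite /D chi0 mulr0 oppr0 cis0 mulr1.
have Dk x (k : int) : D x = 1 -> D (x * k%:~R) = 1.
  have H (j : nat) : D x = 1 -> D (x * j%:R) = 1.
    move=> Dx; elim: j => [|j IH]; first by rewrite mulr0.
    by rewrite -[j.+1%:R]natr1 mulrDr mulr1 DD IH Dx mulr1.
  case: k => j Dx; first exact: H.
  apply: (@mulrI _ (D (x * j.+1%:R))); first by rewrite H // unitr1.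
  by rewrite -DD -mulrDr NegzE mulrNz subrr mulr0 D0 mulr1 H.
suff Dt : D t = 1.
  have cz : cis (a * t) != 0 by rewrite -normr_eq0 norm_cis oner_eq0.
  by move: Dt; rewrite /D cisN => /divr1_eq.
apply/eqP; rewrite -subr_eq0 -normr_eq0; apply/negPn/negP => ne.
have ne0 : 0 < `|D t - 1| by rewrite lt0r ne normr_ge0.
have Dc : {for 0, continuous D}.
  apply: cvgCM; first exact: chic.
  apply: (@cvg_comp _ _ _ (fun t => - (a * t)) cis); last exact: cis_continuous.
  by apply: cvgN; apply: cvgM; [exact: cvg_cst|exact: cvg_id].
have nD : \forall s \near (0 : R), `|D 0 - D s| < `|D t - 1|.
  exact: (Dc _ (near_norm_lt (D 0) ne0)).
have [r /= r0 rD] := (@nbhs_ballP R R 0 _).1 nD.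
have [m mr] := small_dyadic d0 r0.
pose q := d / 2 ^+ m; have q0 : 0 < q by rewrite divr_gt0.
have /andP[k1 k2] := floor_itv (t / q).
set k := Num.floor (t / q) in k1 k2.
have E : D t = D (t - q * k%:~R).
  by rewrite -[LHS](congr1 D (subrK (q * k%:~R) t)) (DD (t - q * k%:~R)) (Dk q _ (Dm m)) mulr1.
have : ball (0 : R) r (t - q * k%:~R).
  rewrite /ball /= sub0r normrN ger0_norm.
    apply: lt_trans mr; rewrite -/q ltrBlDr mulrC.
    by move: k2; rewrite ltr_pdivrMr // intrD1 mulrDl mul1r addrC.
  by rewrite subr_ge0 mulrC -ler_pdivlMr.
move=> /rD; rewrite /= D0 -E distrC.
by rewrite ltxx.
Qed.

Lemma circle_char_int (chi : R -> C) : continuous chi ->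
  (forall s t, chi (s + t) = chi s * chi t) -> (forall t, `|chi t| = 1) ->
  chi 1 = 1 -> exists k : int, forall t, chi t = cis (2 * pi * (t * k%:~R)).
Proof.
move=> c D n c1; have [a aE] := circle_char c D n.
have [k kE] : exists k : int, a = 2 * pi * k%:~R.
  by apply: cis_eq1; rewrite -c1 aE mulr1.
by exists k => t; rewrite aE kE -mulrA [k%:~R * t]mulrC.
Qed.
End Complex.

(** * The torus and the rank of its subgroups *)

Section TorusGroup.
Context {R : realType} {n : nat}.
Local Notation C := R[i].
Local Notation T := (torus R n).
Local Notation Lambda := 'rV[int]_n.

Lemma tcoordM (u v : T) i : tcoord (u * v)%g i = tcoord u i * tcoord v i.
Proof. exact: tcoord_of. Qed.

Lemma tcoordV (u : T) i : tcoord (u^-1)%g i = (tcoord u i)^-1.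
Proof. exact: tcoord_of. Qed.

Lemma tcoord1 i : tcoord (1%g : T) i = 1.
Proof. exact: tcoord_of. Qed.

Lemma tcoord_neq0 (u : T) i : tcoord u i != 0.
Proof. by rewrite -normr_eq0 tcoord_norm oner_eq0. Qed.

Lemma tgC (u v : T) : (u * v = v * u)%g.
Proof. exact: tmulC. Qed.

Lemma tcoord_continuous i : continuous (fun u : T => tcoord u i).
Proof.
move=> u; apply: (@cvg_comp _ _ _ val (fun z : 'rV[C]_n => z ord0 i)).
  exact: (@initial_continuous _ _ (val : T -> 'rV[C]_n)).
exact: rV_coord_continuous.
Qed.

Lemma cvg_torus (I : Type) (F : set_system I) (f : I -> T) (u : T) : Filter F ->
  (forall i, (fun x => tcoord (f x) i) @ F --> tcoord u i) -> f @ F --> u.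
Proof.
move=> FF fu A [B [[V oV <-] Vu] BA].
have fV : (fun x => val (f x)) @ F --> (val u : 'rV[C]_n).
  by apply: cvg_rV => i; exact: fu.
have nV : nbhs (val u : 'rV[C]_n) V by exact: open_nbhs_nbhs.
have h : \forall x \near F, V (val (f x)) := fV _ nV.
by apply: filterS h => x Vx; exact: BA.
Qed.

Lemma cvg_tcoord (I : Type) (F : set_system I) (f : I -> T) (u : T) i :
  Filter F -> f @ F --> u -> (fun x => tcoord (f x) i) @ F --> tcoord u i.
Proof. by move=> FF fu; exact: (cvg_comp _ _ fu (@tcoord_continuous i u)). Qed.

Lemma cvg_tmul (I : Type) (F : set_system I) (f g : I -> T) (u v : T) :
  Filter F -> f @ F --> u -> g @ F --> v ->
  (fun x => f x * g x)%g @ F --> (u * v)%g.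
Proof.
move=> FF fu gv; apply: cvg_torus => i; rewrite tcoordM.
under eq_fun do rewrite tcoordM.
by apply: cvgCM; exact: cvg_tcoord.
Qed.

Lemma cvg_tinv (I : Type) (F : set_system I) (f : I -> T) (u : T) :
  Filter F -> f @ F --> u -> (fun x => (f x)^-1)%g @ F --> (u^-1)%g.
Proof.
move=> FF fu; apply: cvg_torus => i; rewrite tcoordV.
under eq_fun do rewrite tcoordV.
by apply: cvgCV; [exact: tcoord_neq0|exact: cvg_tcoord].
Qed.

Lemma texp_coord (t : 'rV[R]_n) i : tcoord (texp t) i = cis (2 * pi * t ord0 i).
Proof. exact: tcoord_of. Qed.

Lemma texp_continuous : continuous (@texp R n).
Proof.
move=> t; apply: (cvg_torus (F := nbhs t)) => i; rewrite texp_coord.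
under eq_fun do rewrite texp_coord.
apply: (@cvg_comp _ _ _ (fun s : 'rV[R]_n => 2 * pi * s ord0 i) cis).
  by apply: cvgM; [exact: cvg_cst|exact: rV_coord_continuous].
exact: cis_continuous.
Qed.

Lemma texp_surj (u : T) : exists2 t : 'rV[R]_n,
  (forall i, `[-1, 1]%classic (t ord0 i)) & u = texp t.
Proof.
have H i : exists t : R, `[-1, 1]%classic t /\ tcoord u i = cis (2 * pi * t).
  have [t tb ->] := cis_surj (tcoord_norm u i); exists (t / (2 * pi)).
  have p0 : (0 : R) < pi by exact: pi_gt0.
  have p2 : (0 : R) < 2 * pi by rewrite mulr_gt0.
  split; last by rewrite mulrC divfK ?lt0r_neq0.
  rewrite /= in_itv /= -ler_norml normrM normfV (gtr0_norm p2) ler_pdivrMr // mul1r.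
  by apply: le_trans tb _; rewrite ler_peMl ?ltW // ltr1n.
have [t tP] := choice H; exists (\row_i t i) => [i|].
  by rewrite mxE; case: (tP i).
by apply: torus_ext => i; rewrite texp_coord mxE; case: (tP i).
Qed.

Lemma compact_torus : compact [set: T].
Proof.
have -> : [set: T] =
    @texp R n @` [set t : 'rV[R]_n | forall i, `[-1, 1]%classic (t ord0 i)].
  by apply/seteqP; split => // u _; have [t ? ->] := texp_surj u; exists t.
apply: continuous_compact; first exact/continuous_subspaceT/texp_continuous.
by apply: (@rV_compact R n (fun=> `[-1, 1]%classic)) => i; exact: segment_compact.
Qed.

Lemma texpD (s t : 'rV[R]_n) : texp (s + t) = (texp s * texp t)%g.
Proof. by apply: torus_ext => i; rewrite tcoordM !texp_coord mxE mulrDr cisD. Qed.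

Lemma one_param_coord (v : Lambda) (t : R) i :
  tcoord (one_param v t) i = cis (2 * pi * (t * (v ord0 i)%:~R)).
Proof. by rewrite texp_coord !mxE. Qed.

Lemma one_paramD (v : Lambda) (s t : R) :
  one_param v (s + t) = (one_param v s * one_param v t)%g.
Proof. by rewrite /one_param scalerDl texpD. Qed.

Lemma one_paramZ (v : Lambda) (z : int) (t : R) :
  one_param (z *: v) t = one_param v (t * z%:~R).
Proof.
by apply: torus_ext => i; rewrite !one_param_coord !mxE rmorphM /= !mulrA.
Qed.

Lemma one_param_int (v : Lambda) (z : int) : one_param v (z%:~R : R) = 1%g.
Proof.
by apply: torus_ext => i; rewrite one_param_coord tcoord1 -rmorphM /= cis2pi_int.
Qed.

(** The stabilizer in T^n of a point of C^n whose nonzero coordinates are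
    those in [S]. *)
Definition coord_torus (S : {set 'I_n}) : set T :=
  [set u | forall i, i \in S -> tcoord u i = 1].

Definition axis (i : 'I_n) : Lambda := delta_mx 0 i.

Lemma axis_coord i j (t : R) :
  tcoord (one_param (axis i) t) j = if j == i then cis (2 * pi * t) else 1.
Proof.
rewrite one_param_coord mxE eqxx /=.
by case: eqP => _; rewrite ?mulr1 // !mulr0 cis0.
Qed.

Lemma subgroup_coord_torus S : subgroup (coord_torus S).
Proof.
split=> [i _|u v hu hv i iS|u hu i iS]; first by rewrite tcoord1.
  by rewrite tcoordM hu // hv // mulr1.
by rewrite tcoordV hu // invr1.
Qed.

(** One coordinate at a time, a point of an axis circle corrects an element of
    [coord_torus S] until all its coordinates are 1. *)
Lemma coord_torus_gen (S : {set 'I_n}) (H : set T) : subgroup H ->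
  (forall i t, i \notin S -> H (one_param (axis i) t)) -> coord_torus S `<=` H.
Proof.
move=> [H1 HM HV] HS.
suff gen (s : seq 'I_n) u : (forall i, i \notin s -> tcoord u i = 1) ->
    coord_torus S u -> H u.
  by move=> u; apply: (gen (enum 'I_n)) => i; rewrite mem_enum.
elim: s u => [|i s IH] u us uS.
  by have -> : u = 1%g by apply: torus_ext => i; rewrite tcoord1 us.
have [iS|iS] := boolP (i \in S).
  apply: IH => // j js; have [->|ji] := eqVneq j i; first exact: uS.
  by apply: us; rewrite inE negb_or ji.
have [t _ tE] := texp_surj u.
pose w := one_param (axis i) (t ord0 i).
have ui : tcoord u i = tcoord w i by rewrite tE texp_coord axis_coord eqxx.
have wj j : j != i -> tcoord w j = 1 by rewrite axis_coord => /negbTE ->.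
have Hu : H (u * w^-1)%g.
  apply: IH => j jP; rewrite tcoordM tcoordV.
    have [->|ji] := eqVneq j i; first by rewrite ui divff // tcoord_neq0.
    by rewrite wj // invr1 mulr1 us // inE negb_or ji.
  have [ji|ji] := eqVneq j i; first by rewrite -ji jP in iS.
  by rewrite wj // invr1 mulr1 uS.
have -> : (u = (u * w^-1) * w)%g by rewrite mulgVK.
by apply: HM => //; exact: HS.
Qed.

Lemma torus_aut_inv (rho : T -> T) : torus_aut rho ->
  exists sigma, [/\ torus_aut sigma, cancel rho sigma & cancel sigma rho].
Proof.
move=> [rM [rc [s [sc rs sr]]]]; exists s; split=> //; split; last first.
  by split=> //; exists rho.
by move=> u v; rewrite -{1}(sr u) -{1}(sr v) -rM rs.
Qed.

Lemma torus_aut1 (rho : T -> T) : torus_aut rho -> rho 1%g = 1%g.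
Proof.
move=> [rM _]; have := rM 1%g 1%g; rewrite mulg1 => h.
by rewrite -[RHS](mulgV (rho 1%g)) {2}h mulgK.
Qed.

Lemma torus_autV (rho : T -> T) u : torus_aut rho -> rho (u^-1)%g = ((rho u)^-1)%g.
Proof.
move=> ra; have [rM _] := ra.
by rewrite -[LHS](mulgK (rho u)) -rM mulVg torus_aut1 // mul1g.
Qed.

Lemma subgroup_aut_preim (rho : T -> T) (H : set T) :
  torus_aut rho -> subgroup H -> subgroup (rho @^-1` H).
Proof.
move=> ra [H1 HM HV]; have [rM _] := ra; split=> /=.
- by rewrite torus_aut1.
- by move=> u v; rewrite /= rM; exact: HM.
- by move=> u; rewrite /= torus_autV //; exact: HV.
Qed.

(** Each coordinate of [rho] on the axis circle is a character of the line
    that is trivial at 1, hence an integral exponential. *)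
Lemma torus_aut_axis (rho : T -> T) i : torus_aut rho ->
  exists v : Lambda, forall t, rho (one_param (axis i) t) = one_param v t.
Proof.
move=> ra; have [rM [rc _]] := ra.
have H j : exists k : int, forall t,
    tcoord (rho (one_param (axis i) t)) j = cis (2 * pi * (t * k%:~R)).
  apply: circle_char_int => [t|s t|t|].
  - apply: cvg_tcoord; apply: (@cvg_comp _ _ _ (one_param (axis i)) rho _ _ _ _ (rc _)).
    apply: (@cvg_comp _ _ _ (fun t : R => t *: map_mx intr (axis i)) (@texp R n)
      _ _ _ _ (@texp_continuous _)).
    by apply: cvgZr_tmp; exact: cvg_id.
  - by rewrite one_paramD rM tcoordM.
  - exact: tcoord_norm.
  - by rewrite -[1]/(1%:~R) one_param_int torus_aut1 // tcoord1.
have [k kP] := choice H; exists (\row_j k j) => t.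
by apply: torus_ext => j; rewrite kP one_param_coord mxE.
Qed.

(** The number [k] counts the conditions that cut out [Z], that is, the
    codimension: stabilizers over the [k]-dimensional stratum have [srank]
    [k]. *)
Definition srank (Z : set T) (k : nat) : Prop :=
  exists rho (S : {set 'I_n}),
    [/\ torus_aut rho, Z = rho @^-1` coord_torus S & #|S| = k].

Definition sign_vec (A : {set 'I_n}) : T :=
  texp (\row_i if i \in A then 2^-1 else 0).

Lemma sign_vec_coord A i : tcoord (sign_vec A) i = if i \in A then -1 else 1.
Proof.
rewrite texp_coord mxE; case: ifP => _; last by rewrite mulr0 cis0.
rewrite mulrAC divff ?pnatr_eq0 // mul1r /cis cospi sinpi.
by apply/eqP; rewrite eq_complex /= oppr0 !eqxx.
Qed.

(** The rank is detected by the 2-torsion of the subgroup: [rho @^-1` coord_torus S]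
    has exactly [2 ^ #|~: S|] elements of order dividing 2. *)
Lemma srank_le (Z : set T) j k : srank Z j -> srank Z k -> (k <= j)%N.
Proof.
move=> [rho [S [ra -> <-]]] [rho' [S' [ra' ZE <-]]].
have [sig [sa rs sr]] := torus_aut_inv ra; have [[sM _] [rM' _]] := (sa, ra').
have [_ [_ [sig' [_ rs' sr']]]] := ra'.
have n11 : (1 : C) != -1.
  by rewrite -subr_eq0 opprK -mulr2n pnatr_eq0.
pose w A := rho' (sig (sign_vec A)).
pose f A : {set 'I_n} := finset (fun i => tcoord (w A) i == -1).
have wpm A i : (tcoord (w A) i == 1) || (tcoord (w A) i == -1).
  rewrite -sqrf_eq1 expr2 -tcoordM -rM' -sM.
  have -> : (sign_vec A * sign_vec A)%g = 1%g.
    apply: torus_ext => l; rewrite tcoordM tcoord1 sign_vec_coord.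
    by case: ifP => _; rewrite ?mulrNN mulr1.
  by rewrite !torus_aut1 // tcoord1.
have wE A : w A = sign_vec (f A).
  apply: torus_ext => i; rewrite sign_vec_coord inE.
  by have := wpm A i; case: (tcoord (w A) i =P -1) => // _; rewrite orbF => /eqP.
have fS A : A \in powerset (~: S) -> f A \in powerset (~: S').
  rewrite !inE => /fintype.subsetP AS; apply/fintype.subsetP => i; rewrite !inE => wi.
  apply/negP => iS'.
  have : (rho @^-1` coord_torus S) (sig (sign_vec A)).
    move=> l lS; rewrite sr sign_vec_coord; case: ifP => // /AS.
    by rewrite inE lS.
  by rewrite ZE => /(_ i iS'); rewrite -/(w A) (eqP wi) => /eqP; rewrite eq_sym (negbTE n11).
have finj : {in powerset (~: S) &, injective f}.
  move=> A B _ _ AB; have : w A = w B by rewrite !wE AB.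
  move/(can_inj rs')/(can_inj sr) => sAB.
  apply/setP => i; have := congr1 (fun u : T => tcoord u i) sAB.
  rewrite !sign_vec_coord.
  by case: (i \in A); case: (i \in B) => // /eqP; rewrite ?(negbTE n11) // eq_sym (negbTE n11).
have := subset_leq_card (_ : f @: powerset (~: S) \subset powerset (~: S')).
rewrite card_in_imset // !card_powerset => H.
have : (2 ^ #|~: S| <= 2 ^ #|~: S'|)%N.
  by apply: H; apply/fintype.subsetP => _ /imsetP[A AS ->]; exact: fS.
rewrite leq_exp2l // => h.
have e : (#|S| + #|~: S| = #|S'| + #|~: S'|)%N by rewrite !cardsC.
by move: h; rewrite -(leq_add2l #|S|) e leq_add2r.
Qed.

Lemma srank_uniq (Z : set T) j k : srank Z j -> srank Z k -> j = k.
Proof.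
by move=> hj hk; apply/eqP; rewrite eqn_leq (srank_le hj hk) (srank_le hk hj).
Qed.
End TorusGroup.

(** * Facets near a point of a manifold with corners *)

Lemma near_open (T : topologicalType) (A : set T) :
  (forall x, A x -> \forall y \near x, A y) -> open A.
Proof. by rewrite openE => h x /h. Qed.

Lemma withinP (S T : topologicalType) (A : set S) (f : S -> T) :
  {within A, continuous f} <->
  (forall x, A x -> forall N, nbhs (f x) N -> \forall y \near x, A y -> N (f y)).
Proof. by split=> [/subspace_continuousP h|h]; [exact: h|apply/subspace_continuousP]. Qed.

Lemma homeo_on_cvg (S T : topologicalType) (U : set S) (V : set T) (f : S -> T) :
  open U -> homeo_on U V f -> forall x, U x -> {for x, continuous f}.
Proof.
by move=> oU [_ fc _] x Ux; move: fc; rewrite continuous_open_subspace //; apply; rewrite inE.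
Qed.

(** The set where [f] takes the value [f x] and its complement in [C] are both
    relatively open. *)
Lemma connected_locally_constant (T : topologicalType) (Y : Type) (C : set T)
    (f : T -> Y) : connected C ->
  (forall x, C x -> \forall y \near x, C y -> f y = f x) ->
  forall x y, C x -> C y -> f x = f y.
Proof.
move=> Cc fl x y Cx Cy.
pose P z := f z = f x; pose O (Q : Prop -> Prop) := interior [set w | C w -> Q (P w)].
have oO Q : open (O Q) by exact: open_interior.
suff CP : C `&` [set z | P z] = C by have : C y by []; rewrite -CP => -[_ ->].
apply: Cc; first by exists x.
  exists (O id) => //; apply/seteqP; split => z [Cz].
    move=> Pz; split=> //; have := fl z Cz; apply: filterS => w h /h.
    by rewrite /P => ->.
  by move=> /interior_subset /(_ Cz) Pz.
exists (~` O not); first exact: open_closedC.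
apply/seteqP; split => z [Cz].
  by move=> Pz; split=> // /interior_subset /(_ Cz).
move=> nO; split=> //; apply: contrapT => nP; apply: nO.
have := fl z Cz; apply: filterS => w h /h.
by rewrite /P => ->.
Qed.

Lemma generated_min (R : realType) (n : nat) (G H : set (torus R n)) :
  subgroup H -> G `<=` H -> generated G `<=` H.
Proof. by move=> sH GH u; apply. Qed.

Lemma sub_generated (R : realType) (n : nat) (G : set (torus R n)) :
  G `<=` generated G.
Proof. by move=> u Gu H _; apply. Qed.

Lemma homeo_on_sub (R : realType) (n : nat) (B : topologicalType) (U U' : set B)
    (xi : B -> 'rV[R]_n) : open U -> homeo_on U (xi @` U) xi ->
  (exists2 Q, open Q & xi @` U = @orthant R n `&` Q) -> open U' -> U' `<=` U ->
  homeo_on U' (xi @` U') xi /\ exists2 Q, open Q & xi @` U' = @orthant R n `&` Q.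
Proof.
move=> oU hU [Q oQ xU] oU' U'U; have [[fB iB sB] xc [g gc xK]] := hU.
have xU'U : xi @` U' `<=` xi @` U by move=> _ [x Ux <-]; exists x => //; exact: U'U.
split.
- split; first split.
  + by move=> x Ux; exists x.
  + by move=> x y /set_mem/U'U/mem_set Ux /set_mem/U'U/mem_set Uy; exact: iB.
  + by [].
  + exact: continuous_subspaceW xc.
  + exists g; first exact: continuous_subspaceW gc.
    by move=> x /set_mem/U'U/mem_set; exact: xK.
- pose Q' := interior [set z | (xi @` U) z -> U' (g z)].
  exists (Q `&` Q'); first by apply: openI => //; exact: open_interior.
  rewrite setIA -xU; apply/seteqP; split => z.
    move=> [x U'x <-]; split; first by exists x => //; exact: U'U.
    have Ux := U'U _ U'x; move: gc => /withinP; apply; first by exists x.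
    by rewrite xK ?inE //; apply: open_nbhs_nbhs.
  move=> [[x Ux <-] /interior_subset h]; exists x => //.
  by have := h (ex_intro2 _ _ x Ux erefl); rewrite xK ?inE.
Qed.

Section Germs.
Context {R : realType} {n : nat} {B : topologicalType}.
Local Notation Lambda := 'rV[int]_n.

Definition zeros (xi : 'rV[R]_n) : {set 'I_n} :=
  finset (fun i => xi ord0 i == 0).

Lemma near_zeros_sub (X : topologicalType) (f : X -> 'rV[R]_n) (x : X) :
  {for x, continuous f} -> \forall y \near x, zeros (f y) \subset zeros (f x).
Proof.
move=> fc.
have : \forall y \near x, forall i, f x ord0 i != 0 -> f y ord0 i != 0.
  apply: (@filter_forall _ _ (fun i y => f x ord0 i != 0 -> f y ord0 i != 0)) => i.
  have [fi|fi] := eqVneq (f x ord0 i) 0; first by apply: nearW => y.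
  have ci : (fun y => f y ord0 i) @ x --> f x ord0 i.
    exact: (cvg_comp _ _ fc (@rV_coord_continuous R n i _)).
  exact: filterS (fun y h _ => h) (cvgr_neq0 _ ci fi).
apply: filterS => y h; apply/fintype.subsetP => i; rewrite !inE => yi.
by apply/negPn/negP => /h; rewrite yi.
Qed.

Lemma card_zeros (xi : 'rV[R]_n) : #|zeros xi| = (n - nonzeros xi)%N.
Proof.
have : (nonzeros xi + #|zeros xi| = n)%N.
  rewrite /nonzeros addnC -[RHS]card_ord -(cardC (mem (zeros xi))); congr (_ + _)%N.
  by apply: eq_card => i; rewrite !inE.
by move=> e; rewrite -[X in (X - _)%N]e addKn.
Qed.

Lemma card_nonzeros (xi : 'rV[R]_n) : nonzeros xi = #|~: zeros xi|.
Proof. by apply: eq_card => i; rewrite !inE. Qed.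

Lemma nonzeros_facet (xi : 'rV[R]_n) :
  (nonzeros xi).+1 = n <-> exists i, zeros xi = [set i]%SET.
Proof.
split=> [h|[i zi]].
  by apply/cards1P; rewrite card_zeros -{1}h subSn // subnn.
have := max_card (mem [pred i | xi ord0 i != 0]); rewrite card_ord -/(nonzeros xi).
have := card_zeros xi; rewrite zi cards1; lia.
Qed.

(** The charts of a manifold with corners without the separation axiom; for
    orbit spaces this can be established chart by chart. *)
Definition corner_charts (A : set (chart R n B)) : Prop :=
  [/\ forall b, exists2 c, A c & dom c b,
      forall c, A c ->
        [/\ open (dom c), homeo_on (dom c) (coord c @` dom c) (coord c) &
          exists2 O, open O & coord c @` dom c = @orthant R n `&` O] &
      forall c d b, A c -> A d -> dom c b -> dom d b ->
        nonzeros (coord c b) = nonzeros (coord d b)].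

Context (A : set (chart R n B)) (cA : corner_charts A).

Lemma stratumP c b k : A c -> dom c b ->
  stratum A k b <-> nonzeros (coord c b) = k.
Proof.
have [_ _ cA3] := cA => Ac cb; split=> [[d [Ad db <-]]|<-]; first exact: cA3.
by exists c.
Qed.

Lemma facetsP c b : A c -> dom c b ->
  facets A b <-> exists i, zeros (coord c b) = [set i]%SET.
Proof.
move=> Ac cb; rewrite -nonzeros_facet; split=> [[k kn /(stratumP _ Ac cb) ->]//|h].
by exists (nonzeros (coord c b)) => //; apply/(stratumP _ Ac cb).
Qed.

(** Unlike [Zsub], this does not mention components of facets; the two agree
    at [b] for suitable small [V], by [Zsub_germ]. *)
Definition Zgen (L : set (B * Lambda)) (V : set B) : set (torus R n) :=
  generated [set u | exists x v t, [/\ V x, L (x, v) & u = one_param v t]].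

Context (L : set (B * Lambda)) (rL : rank_one_subbundle A L).

Lemma fiber_constant (C : set B) x y : connected C -> C `<=` facets A ->
  C x -> C y -> fiber L x = fiber L y.
Proof.
have [_ _ loc] := rL => Cc CF; apply: connected_locally_constant => // z Cz.
have [U [oU Uz UL]] := loc z (CF _ Cz).
have : nbhs z U by exact: open_nbhs_nbhs.
by apply: filterS => w Uw Cw; apply: UL => //; exact: CF.
Qed.

Lemma fiber_circle x w : fiber L x = line w ->
  [set u | exists v t, L (x, v) /\ u = one_param v t] = range (@one_param R n w).
Proof.
move=> wE; apply/seteqP; split=> [u [v [t [Lv ->]]]|_ [t _ <-]].
  have : fiber L x v by [].
  by rewrite wE => -[z _ <-]; exists (t * z%:~R) => //; rewrite one_paramZ.
exists w, t; split=> //.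
have : fiber L x w by rewrite wE; exists 1; rewrite // scale1r.
exact.
Qed.

Lemma local_facets_component b U m (F : 'I_m -> set B) i x :
  local_facets A b U F -> F i x -> F i = connected_component (U `&` facets A) x.
Proof.
move=> [_ _ _ rF _] Fx; have : range F (F i) by exists i.
rewrite rF => -[y Uy e]; move: Fx; rewrite -e => Fx.
exact: same_connected_component.
Qed.

Lemma local_facets_sub b U m (F : 'I_m -> set B) i :
  local_facets A b U F -> F i `<=` U `&` facets A.
Proof.
move=> lf x Fx; have := local_facets_component lf Fx.
by move: Fx => /[swap] -> /connected_component_sub.
Qed.

Lemma local_facets_connected b U m (F : 'I_m -> set B) i :
  local_facets A b U F -> connected (F i).
Proof.
move=> lf; have [_ _ _ _ /(_ i)] := lf.
move=> /(_ setT filterT)[x [Fx _]].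
rewrite (local_facets_component lf Fx); exact: component_connected.
Qed.

(** A facet adherent to [b] meets every neighborhood of [b], and [L] is constant
    along it: so the circles that generate [Zsub A L b] are visible in any
    neighborhood of [b]. *)
Lemma Zsub_sub b V : open V -> V b -> Zsub A L b `<=` Zgen L V.
Proof.
move=> oV Vb; apply: generated_min; first exact: generated_subgroup.
move=> _ [k [U [F [i [x [v [t [sb lf Fx Lxv ->]]]]]]]].
apply: sub_generated; have [_ _ _ _ /(_ i)] := lf.
have nV : nbhs b V by exact: open_nbhs_nbhs.
move=> /(_ _ nV)[y [Fy Vy]]; exists y, v, t; split=> //.
have : fiber L y = fiber L x.
  apply: (@fiber_constant (F i)) => //; first exact: local_facets_connected lf.
  by move=> z /(local_facets_sub lf)[].
by move=> e; have : fiber L x v by []; rewrite -e.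
Qed.

Lemma Zgen_sub b k U (F : 'I_(n - k) -> set B) : stratum A k b ->
  local_facets A b U F -> Zgen L U `<=` Zsub A L b.
Proof.
move=> sb lf; apply: generated_min; first exact: generated_subgroup.
move=> _ [x [v [t [Ux Lxv ->]]]]; apply: sub_generated.
have [L1 _ _] := rL; have fx := L1 _ _ Lxv.
have [_ _ _ rF _] := lf.
have : range F (connected_component (U `&` facets A) x) by rewrite rF; exists x.
move=> [i _ Fi]; exists k, U, F, i, x, v, t; split=> //.
by rewrite Fi; exact: connected_component_refl.
Qed.

Lemma segment_connected (p q : 'rV[R]_n) :
  connected ((fun t : R => (1 - t) *: p + t *: q) @` `[0, 1]%classic).
Proof.
apply: connected_continuous_connected.
  by apply/connected_intervalP; exact: interval_is_interval.
apply: continuous_subspaceT => t; apply: cvg_rV => i.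
rewrite (_ : (fun _ => _) = fun t => (1 - t) * p ord0 i + t * q ord0 i); last first.
  by apply/funext => x; rewrite !mxE.
rewrite !mxE; apply: cvgD; apply: cvgM; try exact: cvg_cst; try exact: cvg_id.
by apply: cvgB; [exact: cvg_cst|exact: cvg_id].
Qed.

Lemma nbhs_rV_box (b : 'rV[R]_n) (N : set 'rV[R]_n) : nbhs b N ->
  exists2 e : R, 0 < e & forall x : 'rV[R]_n, (forall i, `|b ord0 i - x ord0 i| < e) -> N x.
Proof.
move=> /(@nbhs_ballP R)[e /= e0 eN]; exists e => // x bx; apply: eN.
by split=> // i j; rewrite (ord1 i); exact: bx.
Qed.

(** In the chart [c] a small box around [coord c b] meets the facets in its
    open faces, one for each zero coordinate of [b]. Each face is convex,
    hence connected, and adherent to [b]; on the union of the faces the zero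
    coordinate is locally constant, so that the faces are the components. *)
Lemma box_chart c b V : A c -> dom c b -> open V -> V b ->
  exists U (F : 'I_(n - nonzeros (coord c b)) -> set B) e,
    [/\ local_facets A b U F, U `<=` V `&` dom c,
        forall x, U x -> zeros (coord c x) \subset zeros (coord c b),
        forall l x, F l x <-> U x /\ zeros (coord c x) = [set e l]%SET &
        [/\ injective e, forall l, e l \in zeros (coord c b) &
            forall i, i \in zeros (coord c b) -> exists l, e l = i]].
Proof.
move=> Ac cb oV Vb; have [_ cA2 _] := cA.
have [od hc [Q Oop cO]] := cA2 _ Ac; have [_ _ [g gc cK]] := hc.
set be := coord c b; set S := zeros be.
have obe : (@orthant R n `&` Q) be by rewrite -cO; exists b.
have cc x : dom c x -> {for x, continuous (coord c)} by exact: (homeo_on_cvg od hc).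
have gin x : (@orthant R n `&` Q) x -> dom c (g x) /\ coord c (g x) = x.
  by rewrite -cO => -[y dy <-]; rewrite cK ?inE.
have gbox N : nbhs b N -> exists2 d : R, 0 < d &
    forall x : 'rV[R]_n, orthant x -> (forall i, `|be ord0 i - x ord0 i| < d) -> N (g x).
  move=> nN; have gb : g be = b by rewrite cK ?inE.
  have H' : \forall x \near be, (@orthant R n `&` Q) x -> N (g x).
    by rewrite -cO; apply: (withinP _ _).1 => //; [exists b|rewrite gb].
  have nO : nbhs be Q by apply: open_nbhs_nbhs; split=> //; case: obe.
  have [d d0 hd] := nbhs_rV_box (filterI H' nO); exists d => // x ox /hd[h Ox].
  exact: h.
have nV : nbhs b (V `&` dom c).
  by apply: filterI; exact: open_nbhs_nbhs.
have [e1 e10 he1] := gbox _ nV.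
have [e2 e20 he2] : exists2 d : R, 0 < d &
    forall x : 'rV[R]_n, (forall i, `|be ord0 i - x ord0 i| < d) -> Q x /\ zeros x \subset S.
  have nO : nbhs be Q by apply: open_nbhs_nbhs; split=> //; case: obe.
  have [d d0 hd] := nbhs_rV_box (filterI nO (near_zeros_sub (@cvg_id _ (nbhs be)))).
  by exists d.
pose ep := Num.min e1 e2; have ep0 : 0 < ep by rewrite lt_min e10.
have ep1 (r : R) : r < ep -> r < e1 by move=> h; rewrite (lt_le_trans h) // ge_min lexx.
have ep2 (r : R) : r < ep -> r < e2 by move=> h; rewrite (lt_le_trans h) // ge_min lexx orbT.
pose U := dom c `&` [set x | forall i, `|be ord0 i - coord c x ord0 i| < ep].
have oU : open U.
  apply: near_open => x [dx bx].
  have h1 : \forall y \near x, dom c y by apply: open_nbhs_nbhs.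
  have h2 : \forall y \near x, forall i, `|be ord0 i - coord c y ord0 i| < ep.
    apply: (@filter_forall _ _ (fun i y => `|be ord0 i - coord c y ord0 i| < ep)) => i.
    apply: (@cvgr_lt _ _ _ _ (fun y => `|be ord0 i - coord c y ord0 i|) _ _ _ (bx i)).
    apply: cvg_norm; apply: cvgB; first exact: cvg_cst.
    exact: (cvg_comp _ _ (cc x dx) (@rV_coord_continuous R n i _)).
  by apply: filterS2 h1 h2.
have Ub : U b by split=> // i; rewrite subrr normr0.
have UE x : U x -> [/\ orthant (coord c x), Q (coord c x) & g (coord c x) = x].
  move=> [dx _]; have : (@orthant R n `&` Q) (coord c x) by rewrite -cO; exists x.
  by move=> [? ?]; split=> //; rewrite cK ?inE.
have gU x : orthant x -> (forall i, `|be ord0 i - x ord0 i| < ep) -> U (g x) /\ coord c (g x) = x.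
  move=> ox bx; have [Ox _] := he2 _ (fun i => ep2 _ (bx i)).
  have [dg cg] := gin x (conj ox Ox); split=> //; split=> //=; by rewrite cg.
have UV : U `<=` V `&` dom c.
  move=> x Ux; have [ox _ gx] := UE x Ux; rewrite -gx; apply: he1 => // i.
  by apply: ep1; case: Ux.
have Uz x : U x -> zeros (coord c x) \subset S.
  by move=> [_ bx]; have [] := he2 _ (fun i => ep2 _ (bx i)).
pose face i := [set x | U x /\ zeros (coord c x) = [set i]%SET].
(* for i in S, the point p i d of the i-th open face tends to be as d tends to 0 *)
pose p i (d : R) : 'rV[R]_n := \row_j (if j == i then 0 else be ord0 j + d).
have be0 j : 0 <= be ord0 j by case: obe => /(_ j).
have pz i d : 0 < d -> zeros (p i d) = [set i]%SET.
  move=> d0; apply/setP => j; rewrite !inE mxE; have [_|_] := eqVneq j i; first by rewrite eqxx.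
  by apply/negbTE; rewrite gt_eqF // ltr_wpDl.
have po i d : 0 < d -> orthant (p i d).
  by move=> d0 j; rewrite mxE; case: ifP => // _; rewrite addr_ge0 // ltW.
have pb i d e : i \in S -> 0 < d -> d < e -> forall j, `|be ord0 j - p i d ord0 j| < e.
  rewrite inE => /eqP bi d0 de j; rewrite mxE; have [->|_] := eqVneq j i.
    by rewrite bi subrr normr0 (lt_trans d0).
  by rewrite opprD addrA subrr sub0r normrN gtr0_norm.
have faceE i x : face i x -> exists2 k, [/\ orthant k, zeros k = [set i]%SET &
    forall j, `|be ord0 j - k ord0 j| < ep] & x = g k.
  move=> [Ux zx]; have [ox _ gx] := UE x Ux.
  by exists (coord c x) => //; split=> //; case: Ux.
have gface i k : orthant k -> zeros k = [set i]%SET ->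
    (forall j, `|be ord0 j - k ord0 j| < ep) -> face i (g k).
  by move=> ok zk bk; have [Ug cg] := gU k ok bk; split=> //; rewrite cg.
have half_ep : ep / 2 < ep by rewrite ltr_pdivrMr // ltr_pMr // ltr1n.
have h0 : 0 < ep / 2 by rewrite divr_gt0.
have fcl i : i \in S -> closure (face i) b.
  move=> iS N /gbox[d d0 dN].
  pose d' := Num.min (d / 2) (ep / 2).
  have d'0 : 0 < d' by rewrite lt_min divr_gt0.
  have d'd : d' < d by rewrite gt_min ltr_pdivrMr // ltr_pMr // ltr1n.
  have d'e : d' < ep by rewrite gt_min half_ep orbT.
  exists (g (p i d')); split; last by apply: dN; [exact: po|exact: pb].
  by apply: gface; [exact: po|exact: pz|exact: pb].
have fcon i : i \in S -> connected (face i).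
  move=> iS.
  pose seg k := (fun t : R => (1 - t) *: p i (ep / 2) + t *: k) @` `[0, 1]%classic.
  pose K := [set k | [/\ orthant k, zeros k = [set i]%SET &
    forall j, `|be ord0 j - k ord0 j| < ep]].
  have segK k : K k -> seg k `<=` K.
    move=> [ok zk bk] _ [t /= /[!in_itv]/= /andP[t0 t1] <-].
    have t1' : 0 <= 1 - t by rewrite subr_ge0.
    have ki : k ord0 i = 0.
      by have := set11 i; rewrite -zk inE => /eqP.
    have kj j : j != i -> 0 < k ord0 j.
      move=> ji; rewrite lt0r ok andbT; have : j \notin [set i]%SET by rewrite finset.in_set1.
      by rewrite -zk inE.
    have vE j : ((1 - t) *: p i (ep / 2) + t *: k) ord0 j =
        (1 - t) * p i (ep / 2) ord0 j + t * k ord0 j by rewrite !mxE.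
    split.
    - move=> j; rewrite vE addr_ge0 // mulr_ge0 //; exact: po.
    - apply/setP => j; rewrite [in LHS]inE vE inE mxE; have [->|ji] := eqVneq j i.
        by rewrite ki !mulr0 addr0 eqxx.
      apply/negbTE; rewrite gt_eqF //.
      have pj : 0 < be ord0 j + ep / 2 by rewrite ltr_wpDl.
      have kj' := kj j ji.
      case: (ltgtP t 0) t0 => // [tp|->] _.
        by rewrite ltr_wpDl // ?mulr_gt0 // mulr_ge0 // ltW.
      by rewrite subr0 mul1r mul0r addr0.
    - move=> j; rewrite vE.
      have -> : be ord0 j - ((1 - t) * p i (ep / 2) ord0 j + t * k ord0 j) =
         (1 - t) * (be ord0 j - p i (ep / 2) ord0 j) + t * (be ord0 j - k ord0 j) by ring.
      apply: le_lt_trans (ler_normD _ _) _; rewrite !normrM (ger0_norm t1') (ger0_norm t0).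
      have a1 := pb i _ _ iS h0 half_ep j; have a2 := bk j.
      move: a1 a2; set a1 := `|_|; set a2 := `|_| => a1e a2e.
      case: (ltgtP t 0) t0 => // [tp|->] _; last by rewrite subr0 mul1r mul0r addr0.
      have := ler_wpM2l t1' (ltW a1e); have := ltr_pM2l tp a2 ep; rewrite a2e; lra.
  have -> : face i = g @` K.
    apply/seteqP; split => x; first by move=> /faceE[k Kk ->]; exists k.
    by move=> [k [ok zk bk] <-]; exact: gface.
  have Kp : K (p i (ep / 2)) by split; [exact: po|exact: pz|exact: pb].
  apply: connected_continuous_connected; last first.
    apply: continuous_subspaceW gc; rewrite cO => k [ok zk bk]; split=> //.
    by have [] := he2 _ (fun i => ep2 _ (bk i)).
  have -> : K = \bigcup_(k in K) seg k.
    apply/seteqP; split => k; last by move=> [k' Kk' /(segK _ Kk')].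
    move=> Kk; exists k => //; exists 1; first by rewrite /= in_itv /= ler01 lexx.
    by rewrite subrr scale0r add0r scale1r.
  apply: bigcup_connected; last by move=> k _; exact: segment_connected.
  exists (p i (ep / 2)) => k Kk; exists 0; first by rewrite /= in_itv /= ler01 lexx.
  by rewrite subr0 scale1r scale0r addr0.
have faceS i x : face i x -> i \in S.
  by move=> [/Uz] /[swap] ->; rewrite finset.sub1set.
have facets_face x : (U `&` facets A) x <-> exists i, face i x.
  split=> [[Ux]|[i [Ux zx]]].
    have [_ dx] := UV _ Ux.
    by move=> /(facetsP Ac dx)[i zi]; exists i.
  split=> //; have [_ dx] := UV _ Ux.
  by apply/(facetsP Ac dx); exists i.
have faceC i x : face i x -> connected_component (U `&` facets A) x = face i.
  move=> fx; apply/seteqP; split; last first.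
    apply: connected_component_max => //; first by move=> y fy; apply/facets_face; exists i.
    exact: fcon (faceS _ _ fx).
  move=> y xy.
  have sub : connected_component (U `&` facets A) x `<=` U `&` facets A.
    exact: connected_component_sub.
  have [Uy _] := sub _ xy; split=> //; case: (fx) => _ <-; symmetry.
  apply: (connected_locally_constant (@component_connected _ (U `&` facets A) x)
    (f := fun z => zeros (coord c z))) => //; last first.
    by apply: connected_component_refl; apply/facets_face; exists i.
  move=> z /sub /facets_face[j [Uz' zz]].
  have dz : dom c z by case: Uz'.
  have := near_zeros_sub (cc z dz).
  apply: filterS => w wz /sub /facets_face[m [_ zw]].
  by move: wz; rewrite zw zz finset.sub1set inE => /eqP ->.
have cS : #|S| = (n - nonzeros be)%N by exact: card_zeros.
pose e (l : 'I_(n - nonzeros be)) : 'I_n := enum_val (cast_ord (esym cS) l).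
have eS l : e l \in S by exact: enum_valP.
have einj : injective e by move=> l m /enum_val_inj /cast_ord_inj.
have esurj i : i \in S -> exists l, e l = i.
  move=> iS; exists (cast_ord cS (enum_rank_in iS i)).
  by rewrite /e cast_ordK enum_rankK_in.
have fne i : i \in S -> face i !=set0.
  by move=> /fcl /(_ setT filterT)[x [fx _]]; exists x.
exists U, (fun l => face (e l)), e; split=> //; split=> //.
- move=> l m lm; have [x fx] := fne _ (eS l).
  have : face (e m) x by rewrite -lm.
  case: fx => _ zl [_ zm]; apply: einj; apply: finset.set1_inj.
  by rewrite -zl -zm.
- apply/seteqP; split => X.
    move=> [l _ <-]; have [x fx] := fne _ (eS l).
    by exists x; [apply/facets_face; exists (e l)|exact: faceC].
  move=> [x /facets_face[i fx] <-]; rewrite (faceC _ _ fx).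
  by have [l <-] := esurj _ (faceS _ _ fx); exists l.
- by move=> l; exact: fcl.
Qed.

(** The group [Zsub A L b] only depends on the germ of [L] at [b]; no connected
    component enters in this description, so that it can be transported along
    homeomorphisms. *)
Lemma Zsub_germ b V : open V -> V b ->
  exists U, [/\ open U, U b, U `<=` V & Zsub A L b = Zgen L U].
Proof.
move=> oV Vb; have [/(_ b)[c Ac cb] _ _] := cA.
have [U [F [e [lf UV _ _ _]]]] := box_chart Ac cb oV Vb.
have [oU Ub _ _ _] := lf; exists U; split=> // [x /UV[]//|].
apply/seteqP; split; first exact: Zsub_sub.
by apply: Zgen_sub lf; apply/(stratumP _ Ac cb).
Qed.

(** A chart together with an automorphism that straightens the subtori: [rho]
    carries [Zsub A L b] to the stabilizer of the points of C^n with square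
    norms [xi b]. All that follows about the canonical model depends on the
    pair only through such charts; orbit spaces and characteristic pairs both
    have them. *)
Definition nfchart (U : set B) (xi : B -> 'rV[R]_n) (rho : torus R n -> torus R n) :=
  [/\ open U, homeo_on U (xi @` U) xi,
      exists2 Q, open Q & xi @` U = @orthant R n `&` Q, torus_aut rho &
      forall b, U b -> Zsub A L b = rho @^-1` coord_torus (~: zeros (xi b)) /\
        stratum A (nonzeros (xi b)) b].

(** The circles over the facets adherent to [b] generate [Zsub A L b], and the
    axis circles generate the coordinate subtorus: it is enough to compare the
    circles. *)
Lemma nf_from c rho U : A c -> open U -> U `<=` dom c -> torus_aut rho ->
  (forall x i, U x -> zeros (coord c x) = [set i]%SET ->
    [set u | exists v t, L (x, v) /\ u = one_param v t] =
      rho @^-1` coord_torus (~: [set i]%SET)) ->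
  forall b, U b -> Zsub A L b = rho @^-1` coord_torus (~: zeros (coord c b)).
Proof.
move=> Ac oU Uc ra UL b Ub; have cb := Uc _ Ub.
have [W [F [e [lf WU Wz FE [einj eS esurj]]]]] := box_chart Ac cb oU Ub.
have [oW Wb _ _ Fcl] := lf.
have [sig [sa rs sr]] := torus_aut_inv ra.
have sb : stratum A (nonzeros (coord c b)) b by apply/(stratumP _ Ac cb).
have ZE : Zsub A L b = Zgen L W.
  by apply/seteqP; split; [exact: Zsub_sub|exact: Zgen_sub sb lf].
rewrite ZE; apply/seteqP; split.
  apply: generated_min.
    exact: subgroup_aut_preim ra (subgroup_coord_torus _).
  move=> _ [x [v [t [Wx Lxv ->]]]].
  have [Ux cx] := WU _ Wx; have [L1 _ _] := rL.
  have [i zx] := (facetsP Ac cx).1 (L1 _ _ Lxv).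
  have : (rho @^-1` coord_torus (~: [set i]%SET)) (one_param v t).
    by rewrite -(UL x i Ux zx); exists v, t.
  move=> h j; rewrite finset.in_setC => jb; apply: h; rewrite finset.in_setC.
  by apply: contra jb; have := Wz _ Wx; rewrite zx => /fintype.subsetP; exact.
move=> u hu; rewrite -(rs u).
have sG : subgroup (sig @^-1` Zgen L W).
  by apply: subgroup_aut_preim sa _; exact: generated_subgroup.
apply: (coord_torus_gen sG _ hu) => i t; rewrite finset.in_setC negbK => iS.
have [l li] := esurj _ iS.
have [x [Fx _]] := Fcl l setT filterT.
have [Wx zx] := (FE l x).1 Fx; have [Ux _] := WU _ Wx.
have : (rho @^-1` coord_torus (~: [set i]%SET)) (sig (one_param (axis i) t)).
  move=> j; rewrite !inE => ji; rewrite sr axis_coord.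
  by rewrite (negbTE ji).
rewrite -li -(UL x _ Ux zx) => -[v [s [Lxv vs]]].
by apply: sub_generated; exists x, v, s; rewrite /= li in vs *; split.
Qed.

Lemma nfchart_sub U U' xi rho : nfchart U xi rho -> open U' -> U' `<=` U ->
  nfchart U' xi rho.
Proof.
move=> [oU hU im ra UZ] oU' U'U.
have [hU' im'] := homeo_on_sub oU hU im oU' U'U.
by split=> // b /U'U; exact: UZ.
Qed.

Definition good := forall b, exists U xi rho, nfchart U xi rho /\ U b.

(** The strata can be read off the subtori alone, since the rank is intrinsic. *)
Lemma stratum_srank b k : good -> stratum A k b <-> srank (Zsub A L b) k.
Proof.
move=> /(_ b)[U [xi [rho [[_ _ _ ra /(_ b) UZ] /UZ[ZE sb]]]]].
have r : srank (Zsub A L b) (nonzeros (xi b)).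
  by exists rho, (~: zeros (xi b)); rewrite card_nonzeros.
split=> [sk|sk]; last by rewrite (srank_uniq sk r).
have [/(_ b)[c Ac cb] _ _] := cA; move: sb sk.
move=> /(stratumP _ Ac cb) e1 /(stratumP _ Ac cb) e2.
by move: r; rewrite -e1 e2.
Qed.

Lemma nf_continuous U xi rho b : nfchart U xi rho -> U b -> {for b, continuous xi}.
Proof. by move=> [oU hU _ _ _] Ub; exact: (homeo_on_cvg oU hU). Qed.

(** The coordinates that do not vanish at [b] do not vanish nearby. *)
Lemma Zsub_usc b : good -> \forall b' \near b, Zsub A L b' `<=` Zsub A L b.
Proof.
move=> /(_ b)[U [xi [rho [nf Ub]]]]; have [oU _ _ _ UZ] := nf.
have h1 : \forall b' \near b, U b' by apply: open_nbhs_nbhs.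
have := near_zeros_sub (nf_continuous nf Ub).
apply: filterS2 h1 => b' Ub' zs; rewrite (UZ _ Ub).1 (UZ _ Ub').1.
move=> u hu i iz; apply: hu; move: iz; rewrite !finset.in_setC; apply: contra.
by move/fintype.subsetP: zs; exact.
Qed.

End Germs.

Section TorusClosed.
Context {R : realType} {n : nat}.

Lemma closed_coord_torus (rho : torus R n -> torus R n) S : torus_aut rho ->
  closed (rho @^-1` coord_torus S).
Proof.
move=> [_ [rc _]]; rewrite -[X in closed X]setCK; apply: open_closedC.
apply: near_open => u /existsNP[i /not_implyP[iS ui]].
have ne0 : 0 < `|tcoord (rho u) i - 1|.
  by rewrite normr_gt0 subr_eq0; apply/eqP.
have h : (fun v => tcoord (rho v) i) @ u --> tcoord (rho u) i.
  exact: cvg_tcoord (rc u).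
have : \forall v \near u, `|tcoord (rho u) i - tcoord (rho v) i| < `|tcoord (rho u) i - 1|.
  exact: h _ (near_norm_lt _ ne0).
apply: filterS => v vu /(_ i iS) e; move: vu; rewrite e ltxx.
by [].
Qed.

Lemma compact_coord_torus (rho : torus R n -> torus R n) S : torus_aut rho ->
  compact (rho @^-1` coord_torus S).
Proof.
move=> ra; apply: (@subclosed_compact _ _ setT) => //; last exact: compact_torus.
exact: closed_coord_torus.
Qed.
End TorusClosed.

(** * The topology of the canonical model *)

(** Identities of the abelian group [torus R n], checked coordinatewise. *)
Ltac tgroup :=
  apply: torus_ext => ?; rewrite ?(tcoordM, tcoordV, tcoord1);
  field; rewrite ?tcoord_neq0 //.

Section ModelAlgebra.
Context {R : realType} {n : nat} {B : topologicalType}.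
Context {A : set (chart R n B)} {L : set (B * 'rV[int]_n)}.
Local Notation T := (torus R n).
Local Notation M := (model A L).
Local Notation cls := (@mclass R n B A L).

Lemma Zsub1 b : Zsub A L b 1%g.
Proof. by case: (generated_subgroup _ : subgroup (Zsub A L b)). Qed.

Lemma ZsubM b u v : Zsub A L b u -> Zsub A L b v -> Zsub A L b (u * v)%g.
Proof. by case: (generated_subgroup _ : subgroup (Zsub A L b)) => _ h _; exact: h. Qed.

Lemma ZsubV b u : Zsub A L b u -> Zsub A L b (u^-1)%g.
Proof. by case: (generated_subgroup _ : subgroup (Zsub A L b)) => _ _ h; exact: h. Qed.

Lemma mclassP b u c v :
  cls b u = cls c v <-> b = c /\ Zsub A L b (v * u^-1)%g.
Proof.
rewrite /mclass; split=> [h|h].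
  have : (b, u) = (c, v) %[mod {eq_quot (@model_equiv R n B A L)}] by exact: h.
  by move=> /eqmodP /= /asboolP.
have : (b, u) = (c, v) %[mod {eq_quot (@model_equiv R n B A L)}].
  by apply/eqmodP/asboolP.
exact.
Qed.

Lemma mclassZ b u z : Zsub A L b z -> cls b (u * z)%g = cls b u.
Proof.
move=> Zz; apply/mclassP; split=> //.
by rewrite (_ : _ * _ = z^-1)%g; [exact: ZsubV|tgroup].
Qed.

Lemma mclass_repr (q : M) : cls (mproj q) (repr q).2 = q.
Proof. by rewrite /mclass /mproj -surjective_pairing reprK. Qed.

Lemma mclassE (q : M) : exists u, q = cls (mproj q) u.
Proof. by exists (repr q).2; rewrite mclass_repr. Qed.

Lemma mproj_class b u : mproj (cls b u) = b.
Proof. by have := mclass_repr (cls b u); move=> /mclassP[]. Qed.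

Lemma mact_class u b v : mact u (cls b v) = cls b (u * v)%g.
Proof.
rewrite /mact mproj_class; apply/mclassP; split=> //.
have := mclass_repr (cls b v); rewrite mproj_class => /mclassP[_ h].
by move: h; congr (Zsub _ _ _ _); tgroup.
Qed.

Lemma mmul_class b u v : mmul (cls b u) (cls b v) = cls b (u * v)%g.
Proof.
rewrite /mmul mact_class; apply/mclassP; split=> //.
have := mclass_repr (cls b u); rewrite mproj_class => /mclassP[_ h].
by move: h; congr (Zsub _ _ _ _); tgroup.
Qed.

Definition minv (p : M) : M := cls (mproj p) ((repr p).2^-1)%g.

Lemma minv_class b u : minv (cls b u) = cls b (u^-1)%g.
Proof.
rewrite /minv mproj_class; apply/mclassP; split=> //.
have := mclass_repr (cls b u); rewrite mproj_class => /mclassP[_ h].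
by move: h => /ZsubV; congr (Zsub _ _ _ _); tgroup.
Qed.

Lemma mproj_mmul (p q : M) : mproj p = mproj q -> mproj (mmul p q) = mproj q.
Proof. by rewrite /mmul /mact mproj_class. Qed.

Lemma mproj_minv (p : M) : mproj (minv p) = mproj p.
Proof. exact: mproj_class. Qed.

Lemma mproj_mact u (p : M) : mproj (mact u p) = mproj p.
Proof. exact: mproj_class. Qed.

Lemma mclass_continuous : continuous (fun p : B * T => cls p.1 p.2).
Proof.
have -> : (fun p : B * T => cls p.1 p.2) = \pi_M by apply/funext => -[].
exact: (@pi_continuous _ {eq_quot (@model_equiv R n B A L)}).
Qed.

Lemma cvg_mclass (I : Type) (F : set_system I) (f : I -> B) (g : I -> T) b u :
  Filter F -> f @ F --> b -> g @ F --> u -> (fun x => cls (f x) (g x)) @ F --> cls b u.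
Proof.
move=> FF fb gu.
exact: (cvg_comp (fun x => (f x, g x)) _ (cvg_pair fb gu) (@mclass_continuous (b, u))).
Qed.

Lemma model_continuous (Y : topologicalType) (f : M -> Y) :
  continuous (fun p : B * T => f (cls p.1 p.2)) -> continuous f.
Proof.
move=> fc; apply/(@quotient_continuous _ {eq_quot (@model_equiv R n B A L)}).
have -> : f \o \pi_({eq_quot (@model_equiv R n B A L)}) = fun p : B * T => f (cls p.1 p.2).
  by apply/funext => -[].
exact: fc.
Qed.

Lemma mproj_continuous : continuous (@mproj R n B A L).
Proof.
apply: model_continuous.
have -> : (fun p : B * T => mproj (cls p.1 p.2)) = fst.
  by apply/funext => p; rewrite mproj_class.
by move=> p; exact: cvg_fst.
Qed.
End ModelAlgebra.

Lemma compact_tube (S X : topologicalType) (K : set S) (x0 : X) (P : X -> S -> Prop) :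
  compact K -> (forall s, K s -> \forall p \near (x0, s), P p.1 p.2) ->
  \forall x \near x0, forall s, K s -> P x s.
Proof.
move=> /compact_near_coveringP cov KP; apply: cov => s /KP[[Q W] /= [nQ nW] QW].
by exists (W, Q) => //= -[s' x'] /= [Ws' Qx']; exact: (QW (x', s')).
Qed.

Section ModelTopology.
Context {R : realType} {n : nat} {B : topologicalType}.
Context {A : set (chart R n B)} {L : set (B * 'rV[int]_n)} (gd : good A L).
Local Notation T := (torus R n).
Local Notation M := (model A L).
Local Notation cls := (@mclass R n B A L).

Lemma compact_Zsub b : compact (Zsub A L b).
Proof.
have [U [xi [rho [[_ _ _ ra UZ] Ub]]]] := gd b.
by rewrite (UZ b Ub).1; exact: compact_coord_torus.
Qed.

(** As [Zsub A L b] can only shrink when [b] moves, the sets of all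
    [mclass b (w * u0 * z)] with [b] near [b0], [w] near [1] and
    [z] in [Zsub A L b0] are saturated: they form a basis of neighborhoods of
    [mclass b0 u0]. *)
Lemma model_cvgP (I : Type) (F : set_system I) (h : I -> M) b0 u0 : Filter F ->
  h @ F --> cls b0 u0 <->
  ((fun x => mproj (h x)) @ F --> b0 /\
   forall W : set T, nbhs (1%g : T) W -> \forall x \near F, exists w z,
     [/\ W w, Zsub A L b0 z & h x = cls (mproj (h x)) (w * u0 * z)%g]).
Proof.
move=> FF; split=> [hF|[hb hW]].
  have hb : (fun x => mproj (h x)) @ F --> b0.
    rewrite -(mproj_class (A := A) (L := L) b0 u0).
    exact: (cvg_comp _ _ hF (@mproj_continuous R n B A L _)).
  split=> // W W1.
  pose N := interior [set b | Zsub A L b `<=` Zsub A L b0].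
  pose V := [set q : M | N (mproj q) /\ exists w z,
     [/\ interior W w, Zsub A L b0 z & q = cls (mproj q) (w * u0 * z)%g]].
  have VE b u : V (cls b u) -> exists w z,
      [/\ interior W w, Zsub A L b0 z & u = (w * u0 * z)%g].
    rewrite /V /= mproj_class => -[Nb [w [z [Ww Zz /mclassP[_ h']]]]].
    exists w, (z * (w * u0 * z * u^-1)^-1)%g; split=> //; last by tgroup.
    by apply: ZsubM => //; apply: ZsubV; apply: (interior_subset Nb).
  have oV : open V.
    suff : open [set p : B * T | V (cls p.1 p.2)].
      have -> : (fun p : B * T => V (cls p.1 p.2)) =
          (\pi_({eq_quot (@model_equiv R n B A L)}) : B * T -> M) @^-1` V.
        by apply/funext => -[].
      by [].
    apply: near_open => -[b u] /= Vbu; have [w [z [Ww Zz uE]]] := VE _ _ Vbu.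
    have [Nb _] := Vbu; rewrite mproj_class in Nb.
    have h1 : \forall p \near (b, u), N p.1.
      have nN : nbhs b N by apply: open_nbhs_nbhs; split=> //; exact: open_interior.
      exact: (@cvg_fst _ _ (nbhs b) (nbhs u) _ _ nN).
    have h2 : \forall p \near (b, u), interior W (p.2 * (u0 * z)^-1)%g.
      have nW : nbhs (u * (u0 * z)^-1)%g (interior W).
        rewrite (_ : _ * _ = w)%g; last by rewrite uE; tgroup.
        by apply: open_nbhs_nbhs; split=> //; exact: open_interior.
      have c2 : (fun p : B * T => p.2 * (u0 * z)^-1)%g @ (b, u) --> (u * (u0 * z)^-1)%g.
        by apply: cvg_tmul; [exact: cvg_snd|exact: cvg_cst].
      exact: c2 _ nW.
    apply: filterS2 h1 h2 => -[b' u'] /= Nb' Wu'.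
    rewrite /V /= mproj_class; split=> //.
    by exists (u' * (u0 * z)^-1)%g, z; split=> //; congr mclass; tgroup.
  have Vq : V (cls b0 u0).
    rewrite /V /= mproj_class; split; last first.
      by exists 1%g, 1%g; rewrite mulg1 mul1g; split=> //; exact: Zsub1.
    exact: Zsub_usc gd.
  have nV : nbhs (cls b0 u0) V by apply: open_nbhs_nbhs.
  have : \forall x \near F, V (h x) by exact: hF _ nV.
  by apply: filterS => x [_ [w [z [/interior_subset ? ? ?]]]]; exists w, z.
move=> V nV.
have tube : \forall p \near (b0, 1%g : T), forall z, Zsub A L b0 z ->
    V (cls p.1 (p.2 * u0 * z)%g).
  apply: (@compact_tube T (B * T)%type _ (b0, 1%g)
    (fun p z => V (cls p.1 (p.2 * u0 * z)%g)) (@compact_Zsub b0)) => z Zz.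
  have c : (fun r : (B * T) * T => cls r.1.1 (r.1.2 * u0 * r.2)%g) @
      nbhs ((b0, 1%g : T), z) --> cls b0 u0.
    rewrite -(mclassZ u0 Zz) -[in X in _ --> X](mul1g u0).
    have c1 : (fun r : (B * T) * T => r.1) @ ((b0, 1%g : T), z) --> (b0, 1%g : T).
      exact: cvg_fst.
    apply: cvg_mclass; first exact: (cvg_comp _ _ c1 cvg_fst).
    apply: cvg_tmul; last exact: cvg_snd.
    by apply: cvg_tmul; [exact: (cvg_comp _ _ c1 cvg_snd)|exact: cvg_cst].
  exact: c _ nV.
have [[P Q] /= [nP nQ] PQ] := tube.
have h1 : \forall x \near F, P (mproj (h x)) by exact: hb _ nP.
have h2 := hW _ nQ.
have : \forall x \near F, V (h x); last exact.
apply: filterS2 h1 h2 => x Px [w [z [Qw Zz ->]]] /=.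
exact: (PQ (_, w) (conj Px Qw) z Zz).
Qed.

(** By [model_cvgP], each factor is near its limit up to an element of the
    subtorus at the limit; as the torus is commutative, these elements can be
    collected. *)
Lemma cvg_mmul (I : Type) (F : set_system I) (f g : I -> M) p q : Filter F ->
  (\forall x \near F, mproj (f x) = mproj (g x)) -> mproj p = mproj q ->
  f @ F --> p -> g @ F --> q -> (fun x => mmul (f x) (g x)) @ F --> mmul p q.
Proof.
move=> FF fg pq; have [u pE] := mclassE p; have [v qE] := mclassE q.
rewrite pE qE pq mmul_class => /model_cvgP[fb fW] /model_cvgP[gb gW].
apply/model_cvgP; split=> [|W W1].
  have h : \forall x \near F, mproj (g x) = mproj (mmul (f x) (g x)).
    by apply: filterS fg => x /mproj_mmul.
  by apply: cvg_trans gb; apply: near_eq_cvg; apply: filterS h => x ->.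
have c : (fun r : T * T => r.1 * r.2)%g @ (1%g : T, 1%g : T) --> ((1 * 1)%g : T).
  by apply: cvg_tmul; [exact: cvg_fst|exact: cvg_snd].
rewrite mulg1 in c; have [[P Q] /= [nP nQ] PQ] := c _ W1.
have fP := fW _ nP; have gQ := gW _ nQ; move: fg fP gQ; apply: filterS3 => x fgx.
move=> [w [z [Pw Zz fE]]] [w' [z' [Qw Zz' gE]]].
exists (w * w')%g, (z * z')%g; split; first exact: (PQ (w, w')).
  exact: ZsubM.
by rewrite mproj_mmul // {1}fE {1}gE fgx mmul_class; congr mclass; tgroup.
Qed.

Lemma cvg_minv (I : Type) (F : set_system I) (f : I -> M) p : Filter F ->
  f @ F --> p -> (fun x => minv (f x)) @ F --> minv p.
Proof.
move=> FF; have [u ->] := mclassE p.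
rewrite minv_class => /model_cvgP[fb fW]; apply/model_cvgP; split=> [|W W1].
  by under eq_fun do rewrite mproj_minv.
have := @cvg_tinv R n T (nbhs (1%g : T)) id 1%g (nbhs_filter _) (@cvg_id T _).
rewrite invg1 => c; have := fW _ (c W W1); apply: filterS => x [w [z [Ww Zz fE]]].
exists (w^-1)%g, (z^-1)%g; split=> //; first exact: ZsubV.
by rewrite mproj_minv {1}fE minv_class; congr mclass; tgroup.
Qed.

Lemma cvg_mact (I : Type) (F : set_system I) (g : I -> T) (f : I -> M) u p :
  Filter F -> g @ F --> u -> f @ F --> p ->
  (fun x => mact (g x) (f x)) @ F --> mact u p.
Proof.
move=> FF gu fp.
have E v (q : M) : mact v q = mmul (cls (mproj q) v) q.
  by have [w ->] := mclassE q; rewrite mact_class !mproj_class mmul_class.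
rewrite E; under eq_fun do rewrite E.
apply: cvg_mmul => //; first by apply: nearW => x; rewrite mproj_class.
  by rewrite mproj_class.
by apply: cvg_mclass => //; exact: (cvg_comp _ _ fp (@mproj_continuous R n B A L p)).
Qed.

Lemma mmulA (p q r : M) : mproj p = mproj q -> mproj q = mproj r ->
  mmul p (mmul q r) = mmul (mmul p q) r.
Proof.
have [u ->] := mclassE p; have [v ->] := mclassE q; have [w ->] := mclassE r.
by rewrite !mproj_class => -> ->; rewrite !mmul_class mulgA.
Qed.

Lemma mmulC (p q : M) : mproj p = mproj q -> mmul p q = mmul q p.
Proof.
have [u ->] := mclassE p; have [v ->] := mclassE q.
by rewrite !mproj_class => ->; rewrite !mmul_class tgC.
Qed.

Lemma mmul1 b (p : M) : mproj p = b -> mmul (cls b 1%g) p = p.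
Proof.
by move=> <-; have [u ->] := mclassE p; rewrite !mproj_class mmul_class mul1g.
Qed.

Lemma mmulV (p : M) : mmul (minv p) p = cls (mproj p) 1%g.
Proof.
by have [u ->] := mclassE p; rewrite !mproj_class minv_class mmul_class mulVg.
Qed.

Lemma mmul_inj (p q r : M) : mproj p = mproj q -> mproj p = mproj r ->
  mmul p q = mmul p r -> q = r.
Proof.
move=> pq pr h; have := congr1 (mmul (minv p)) h.
by rewrite !mmulA ?mproj_minv // mmulV !mmul1.
Qed.

Lemma mactM u v (q : M) : mact u (mact v q) = mact (u * v)%g q.
Proof. by have [w ->] := mclassE q; rewrite !mact_class mulgA. Qed.

Lemma mact1 (q : M) : mact 1%g q = q.
Proof. by have [w ->] := mclassE q; rewrite mact_class mul1g. Qed.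

Lemma mact_mmul u (p q : M) : mproj p = mproj q ->
  mact u (mmul p q) = mmul p (mact u q).
Proof.
have [v ->] := mclassE p; have [w ->] := mclassE q; rewrite !mproj_class => ->.
by rewrite mact_class !mmul_class mact_class; congr mclass; tgroup.
Qed.

Lemma mact_transitive (p q : M) : mproj p = mproj q -> exists u, q = mact u p.
Proof.
have [v ->] := mclassE p; have [w ->] := mclassE q; rewrite !mproj_class => ->.
by exists (w * v^-1)%g; rewrite mact_class mulgVK.
Qed.

Lemma mact_stab u (p : M) : mact u p = p <-> Zsub A L (mproj p) u.
Proof.
have [v ->] := mclassE p; rewrite mact_class mproj_class; split=> [/mclassP[_ h]|h].
  have -> : u = ((v * (u * v)^-1)^-1)%g by tgroup.
  exact: ZsubV.
by rewrite tgC mclassZ.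
Qed.

(** * Continuous sections *)

Lemma is_sectionP U (s : B -> M) : open U ->
  is_section U s <-> forall b, U b -> mproj (s b) = b /\ s @ b --> s b.
Proof.
move=> oU; rewrite /is_section continuous_open_subspace //; split.
  by move=> [sb sc] b Ub; split; [exact: sb|apply: sc; rewrite inE].
move=> h; split=> [b /h[]//|b]; by rewrite inE => /h[].
Qed.

Lemma section_cvg U (s : B -> M) b : open U -> is_section U s -> U b -> s @ b --> s b.
Proof. by move=> oU /(is_sectionP _ oU) h /h[]. Qed.

Lemma section_near U (s : B -> M) b : open U -> is_section U s -> U b ->
  \forall x \near b, mproj (s x) = x.
Proof.
move=> oU [sU _] Ub; have : nbhs b U by exact: open_nbhs_nbhs.
by apply: filterS.
Qed.

Lemma one_section U : is_section U (fun b => cls b 1%g).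
Proof.
split=> [b _|]; first exact: mproj_class.
apply: continuous_subspaceT => b; apply: cvg_mclass; [exact: cvg_id|exact: cvg_cst].
Qed.

Lemma mmul_section U (s t : B -> M) : open U -> is_section U s -> is_section U t ->
  is_section U (fun b => mmul (s b) (t b)).
Proof.
move=> oU hs ht; have [hs1 _] := hs; have [ht1 _] := ht.
apply/(is_sectionP _ oU) => b Ub; have e : mproj (s b) = mproj (t b).
  by rewrite hs1 // ht1.
split; first by rewrite mproj_mmul // ht1.
apply: cvg_mmul => //; [|exact: section_cvg hs Ub|exact: section_cvg ht Ub].
have := section_near oU hs Ub; apply: filterS2 (section_near oU ht Ub).
by move=> x -> ->.
Qed.

Lemma minv_section U (s : B -> M) : open U -> is_section U s ->
  is_section U (fun b => minv (s b)).
Proof.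
move=> oU hs; have [hs1 _] := hs; apply/(is_sectionP _ oU) => b Ub.
by split; [rewrite mproj_minv hs1|apply: cvg_minv; exact: section_cvg hs Ub].
Qed.

Lemma section_sub U V (s : B -> M) : V `<=` U -> is_section U s -> is_section V s.
Proof.
move=> VU [s1 s2]; split=> [b /VU|]; first exact: s1.
exact: continuous_subspaceW s2.
Qed.

Lemma eq_section U (s t : B -> M) : open U -> (forall b, U b -> s b = t b) ->
  is_section U s -> is_section U t.
Proof.
move=> oU st /(is_sectionP _ oU) hs; apply/(is_sectionP _ oU) => b Ub.
rewrite -st //; have [h1 h2] := hs b Ub; split=> //.
apply: cvg_trans h2; apply: near_eq_cvg.
have : nbhs b U by exact: open_nbhs_nbhs.
by apply: filterS => x /st ->.
Qed.

End ModelTopology.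

(** * Isomorphisms of pairs and cohomology classes *)

Lemma homeo_onI (S T : topologicalType) (U : set S) (V : set T) (f : S -> T)
    (g : T -> S) : open U -> open V ->
  (forall x, U x -> [/\ V (f x), g (f x) = x & {for x, continuous f}]) ->
  (forall y, V y -> [/\ U (g y), f (g y) = y & {for y, continuous g}]) ->
  homeo_on U V f.
Proof.
move=> oU oV fP gP; split.
- split.
  + by move=> x /fP[].
  + move=> x y /set_mem Ux /set_mem Uy fxy.
    by have [_ <- _] := fP x Ux; have [_ <- _] := fP y Uy; rewrite fxy.
  + by move=> y /gP[Ug gy _]; exists (g y).
- by rewrite continuous_open_subspace // => x /set_mem /fP[].
- exists g; first by rewrite continuous_open_subspace // => x /set_mem /gP[].
  by move=> x /set_mem /fP[].
Qed.

Lemma homeo_onE (S T : topologicalType) (U : set S) (V : set T) (f : S -> T) :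
  open U -> open V -> homeo_on U V f ->
  exists g : T -> S,
    (forall x, U x -> [/\ V (f x), g (f x) = x & {for x, continuous f}]) /\
    (forall y, V y -> [/\ U (g y), f (g y) = y & {for y, continuous g}]).
Proof.
move=> oU oV [[fB fI fS] fc [g gc fK]]; exists g; split=> [x Ux|y Vy].
  split; [exact: fB|by rewrite fK ?inE|].
  by move: fc; rewrite continuous_open_subspace //; apply; rewrite inE.
have [x Ux <-] := fS y Vy; rewrite fK ?inE //; split=> //.
by move: gc; rewrite continuous_open_subspace //; apply; rewrite inE; exact: fB.
Qed.

Section PairMaps.
Context {R : realType} {n : nat} {B1 B2 : topologicalType}.
Context {A1 : set (chart R n B1)} {L1 : set (B1 * 'rV[int]_n)}.
Context {A2 : set (chart R n B2)} {L2 : set (B2 * 'rV[int]_n)}.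
Local Notation T := (torus R n).
Local Notation cls1 := (@mclass R n B1 A1 L1).
Local Notation cls2 := (@mclass R n B2 A2 L2).

(** The map of canonical models covering [f]; it makes sense as soon as [f]
    sends [Zsub A1 L1 b] into [Zsub A2 L2 (f b)]. *)
Definition mmap (f : B1 -> B2) (q : model A1 L1) : model A2 L2 :=
  cls2 (f (mproj q)) (repr q).2.

Context (f : B1 -> B2) (fZ : forall b, Zsub A1 L1 b `<=` Zsub A2 L2 (f b)).

Lemma mmap_class b u : mmap f (cls1 b u) = cls2 (f b) u.
Proof.
rewrite /mmap mproj_class; apply/mclassP; split=> //; apply: fZ.
by have := mclass_repr (cls1 b u); rewrite mproj_class => /mclassP[].
Qed.

Lemma mproj_mmap q : mproj (mmap f q) = f (mproj q).
Proof. exact: mproj_class. Qed.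

Lemma mmap_continuous : continuous f -> continuous (mmap f).
Proof.
move=> fc; apply: model_continuous.
have -> : (fun p : B1 * T => mmap f (cls1 p.1 p.2)) = fun p => cls2 (f p.1) p.2.
  by apply/funext => p; rewrite mmap_class.
move=> [b u]; apply: cvg_mclass; last exact: cvg_snd.
exact: (cvg_comp _ _ (@cvg_fst _ _ (nbhs b) (nbhs u) _) (fc b)).
Qed.

Lemma mmap_mact u q : mmap f (mact u q) = mact u (mmap f q).
Proof. by have [v ->] := mclassE q; rewrite mact_class !mmap_class mact_class. Qed.

Lemma mmap_mmul p q : mproj p = mproj q -> mmap f (mmul p q) = mmul (mmap f p) (mmap f q).
Proof.
have [v ->] := mclassE p; have [w ->] := mclassE q; rewrite !mproj_class => ->.
by rewrite mmul_class !mmap_class mmul_class.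
Qed.
End PairMaps.

(** Homeomorphisms that match the subtori; by [pair_isoP] the maps that match
    the bundles are of this kind. *)
Definition pair_iso (R : realType) (n : nat) (B1 B2 : topologicalType)
    (A1 : set (chart R n B1)) (L1 : set (B1 * 'rV[int]_n))
    (A2 : set (chart R n B2)) (L2 : set (B2 * 'rV[int]_n))
    (f : B1 -> B2) (g : B2 -> B1) : Prop :=
  [/\ continuous f, continuous g, cancel f g, cancel g f &
    forall b, Zsub A1 L1 b = Zsub A2 L2 (f b)].

(** The circles that generate [Zsub A1 L1 b] are visible in any neighborhood
    of [b], in particular in the preimage of a neighborhood of [f b] over
    which the circles generate [Zsub A2 L2 (f b)]. *)
Lemma Zsub_le (R : realType) (n : nat) (B1 B2 : topologicalType)
    (A1 : set (chart R n B1)) (L1 : set (B1 * 'rV[int]_n))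
    (A2 : set (chart R n B2)) (L2 : set (B2 * 'rV[int]_n))
    (f : B1 -> B2) (b : B1) :
  corner_charts A2 -> rank_one_subbundle A1 L1 -> rank_one_subbundle A2 L2 ->
  continuous f ->
  (forall x v, L1 (x, v) -> L2 (f x, v)) -> Zsub A1 L1 b `<=` Zsub A2 L2 (f b).
Proof.
move=> c2 r1 r2 fc fL.
have [U [oU Ub _ ->]] := Zsub_germ c2 r2 openT (I : setT (f b)).
have oV : open (f @^-1` U) by move/continuousP : fc; exact.
apply: subset_trans (Zsub_sub r1 oV Ub) _.
apply: generated_min; first exact: generated_subgroup.
move=> _ [x [v [t [Ux Lxv ->]]]]; apply: sub_generated.
by exists (f x), v, t; split=> //; exact: fL.
Qed.

Lemma pair_isoP (R : realType) (n : nat) (B1 B2 : topologicalType)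
    (A1 : set (chart R n B1)) (L1 : set (B1 * 'rV[int]_n))
    (A2 : set (chart R n B2)) (L2 : set (B2 * 'rV[int]_n)) (f : B1 -> B2) :
  corner_charts A1 -> rank_one_subbundle A1 L1 ->
  corner_charts A2 -> rank_one_subbundle A2 L2 ->
  homeo f -> bundle_image f L1 = L2 -> exists g, pair_iso A1 L1 A2 L2 f g.
Proof.
move=> c1 r1 c2 r2 [fc [g [gc fg gf]]] fL; exists g; split=> // b.
apply/seteqP; split.
  by apply: Zsub_le => // x v Lxv; rewrite -fL; exists (x, v).
rewrite -{2}(fg b); apply: Zsub_le => // y v.
by rewrite -fL => -[[x w] Lxw [<- <-]]; rewrite fg.
Qed.

Section Cohomology.
Context {R : realType} {n : nat} {B : topologicalType}.
Context {A : set (chart R n B)} {L : set (B * 'rV[int]_n)} (gd : good A L).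
Local Notation T := (torus R n).
Local Notation M := (model A L).
Local Notation cls := (@mclass R n B A L).

Lemma mclass_at (q : M) b : mproj q = b -> exists u, q = cls b u.
Proof. by move=> <-; exact: mclassE. Qed.

Lemma cocycle_proj (c : cech A L) i j b : cocycle c ->
  cech_cover c i b -> cech_cover c j b -> mproj (cech_val c i j b) = b.
Proof. by move=> [_ _ /(_ i j)[h _] _] Ui Uj; apply: h. Qed.

Lemma cocycle_open (c : cech A L) i : cocycle c -> open (cech_cover c i).
Proof. by case. Qed.

Lemma cocycle_one (c : cech A L) i b : cocycle c -> cech_cover c i b ->
  cech_val c i i b = cls b 1%g.
Proof.
move=> hc Ui; have [_ _ _ h] := hc.
have p := cocycle_proj hc Ui Ui.
apply: (@mmul_inj _ _ _ _ _ (cech_val c i i b)); rewrite ?p ?mproj_class //.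
by rewrite h // mmulC ?mproj_class // mmul1.
Qed.

Lemma cohomologous_refl (c : cech A L) : cocycle c -> cohomologous c c.
Proof.
move=> hc; have [oc cc _ _] := hc.
exists (cech_idx c), (cech_cover c), id, id, (fun _ b => cls b 1%g); split=> //.
- by move=> k; exact: one_section.
- move=> k l b Wk Wl; rewrite mmulC ?mproj_class; last exact: cocycle_proj.
  by [].
Qed.

Lemma cohomologous_sym (c d : cech A L) : cocycle c -> cocycle d ->
  cohomologous c d -> cohomologous d c.
Proof.
move=> hc hd [K [W [r [s [tau [oW cW Wsub sW E]]]]]].
exists K, W, s, r, (fun k b => minv (tau k b)); split=> //.
- by move=> k b /Wsub[].
- by move=> k; exact: minv_section.
move=> k l b Wk Wl; have := E k l b Wk Wl.
have [ck dk] := Wsub _ _ Wk; have [cl dl] := Wsub _ _ Wl.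
have [u ->] := mclass_at (cocycle_proj hc ck cl).
have [v ->] := mclass_at (cocycle_proj hd dk dl).
have [w ->] := mclass_at ((sW k).1 b Wk); have [z ->] := mclass_at ((sW l).1 b Wl).
rewrite !minv_class !mmul_class => /mclassP[_ h]; apply/mclassP; split=> //.
by move: h => /ZsubV; congr (Zsub _ _ _ _); tgroup.
Qed.

(** On the intersection of the two refinements, the cochains are multiplied,
    with a value of the middle cocycle [d] between them that compares the two
    indices chosen for [d]. *)
Lemma cohomologous_trans (c d e : cech A L) : cocycle c -> cocycle d -> cocycle e ->
  cohomologous c d -> cohomologous d e -> cohomologous c e.
Proof.
move=> hc hd he [K [W [r [s [tau [oW cW Wsub sW E]]]]]].
move=> [K' [W' [r' [s' [tau' [oW' cW' Wsub' sW' E']]]]]].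
have [_ _ sd cd] := hd.
exists (K * K')%type, (fun k => W k.1 `&` W' k.2), (fun k => r k.1), (fun k => s' k.2),
  (fun k b => mmul (mmul (tau k.1 b) (cech_val d (s k.1) (r' k.2) b)) (tau' k.2 b)).
split.
- by move=> k; exact: openI.
- by move=> b; have [k Wk] := cW b; have [k' Wk'] := cW' b; exists (k, k').
- by move=> k b [/Wsub[? _] /Wsub'[_ ?]].
- move=> [k k'] /=; have oo : open (W k `&` W' k') by exact: openI.
  apply: mmul_section => //; last by apply: section_sub (sW' k') => b [].
  apply: mmul_section => //; first by apply: section_sub (sW k) => b [].
  by apply: section_sub (sd (s k) (r' k')) => b [/Wsub[_ ?] /Wsub'[? _]].
move=> [k k'] [l l'] b /= [Wk Wk'] [Wl Wl'].
have [ck dk] := Wsub _ _ Wk; have [cl dl] := Wsub _ _ Wl.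
have [dk' ek] := Wsub' _ _ Wk'; have [dl' el] := Wsub' _ _ Wl'.
have := E k l b Wk Wl; have := E' k' l' b Wk' Wl'.
have := cd _ _ _ b dk dk' dl'; have := cd _ _ _ b dk dl dl'.
have [u1 ->] := mclass_at (cocycle_proj hc ck cl).
have [u2 ->] := mclass_at (cocycle_proj hd dk dl).
have [u3 ->] := mclass_at (cocycle_proj hd dk dk').
have [u4 ->] := mclass_at (cocycle_proj hd dl dl').
have [u5 ->] := mclass_at (cocycle_proj hd dk dl').
have [u6 ->] := mclass_at (cocycle_proj hd dk' dl').
have [u7 ->] := mclass_at (cocycle_proj he ek el).
have [t1 ->] := mclass_at ((sW k).1 b Wk); have [t2 ->] := mclass_at ((sW l).1 b Wl).
have [t3 ->] := mclass_at ((sW' k').1 b Wk'); have [t4 ->] := mclass_at ((sW' l').1 b Wl').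
rewrite !mmul_class => /mclassP[_ h1] /mclassP[_ h2] /mclassP[_ h3] /mclassP[_ h4].
apply/mclassP; split=> //.
have := ZsubM (ZsubM (ZsubM (ZsubV h2) h1) h3) h4.
by congr (Zsub _ _ _ _); tgroup.
Qed.

Lemma cech_class_eq (c d : cech A L) : cocycle c -> cocycle d ->
  cohomologous c d -> cech_class c = cech_class d.
Proof.
move=> hc hd cd; apply/seteqP; split => e [he h]; split=> //.
  by apply: cohomologous_trans h => //; exact: cohomologous_sym.
exact: cohomologous_trans h.
Qed.

Lemma cech_class_id (c : cech A L) : cocycle c -> cech_class c c.
Proof. by move=> hc; split=> //; exact: cohomologous_refl. Qed.
End Cohomology.

Section Pull.
Context {R : realType} {n : nat} {B1 B2 : topologicalType}.
Context {A1 : set (chart R n B1)} {L1 : set (B1 * 'rV[int]_n)}.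
Context {A2 : set (chart R n B2)} {L2 : set (B2 * 'rV[int]_n)}.
Context (gd1 : good A1 L1).
Context (f : B1 -> B2) (g : B2 -> B1) (fg : pair_iso A1 L1 A2 L2 f g).
Local Notation cls1 := (@mclass R n B1 A1 L1).
Local Notation cls2 := (@mclass R n B2 A2 L2).
Local Notation pull := (@pull_section R n B1 B2 A1 L1 A2 L2 f).
Local Notation back := (@mmap R n B2 B1 A2 L2 A1 L1 g).

Lemma iso_back b : Zsub A2 L2 b `<=` Zsub A1 L1 (g b).
Proof. by have [_ _ _ gf ->] := fg; rewrite gf. Qed.

Lemma iso_forth b : Zsub A1 L1 b `<=` Zsub A2 L2 (f b).
Proof. by have [_ _ _ _ ->] := fg. Qed.

Lemma iso_K : cancel (@mmap R n B1 B2 A1 L1 A2 L2 f) back.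
Proof.
move=> q; have [u ->] := mclassE q; have [_ _ fK _ _] := fg.
by rewrite (mmap_class iso_forth) (mmap_class iso_back) fK.
Qed.

Lemma iso_backK : cancel back (@mmap R n B1 B2 A1 L1 A2 L2 f).
Proof.
move=> q; have [u ->] := mclassE q; have [_ _ _ gK _] := fg.
by rewrite (mmap_class iso_back) (mmap_class iso_forth) gK.
Qed.

(** On a section, [pull_section] is composition with the inverse isomorphism
    of models, which is continuous. *)
Lemma pull_back s b : mproj (s (f b)) = f b -> pull s b = back (s (f b)).
Proof. by move=> e; have [_ _ fK _ _] := fg; rewrite /pull_section /mmap e fK. Qed.

Lemma pull_is_section U s : open U -> is_section U s -> is_section (f @^-1` U) (pull s).
Proof.
move=> oU hs; have [fc gc fK gK _] := fg.
have oV : open (f @^-1` U) by move/continuousP : fc; exact.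
apply: (@eq_section _ _ _ _ _ _ (back \o s \o f)) => //.
  by move=> b Ub /=; rewrite pull_back //; exact: hs.1.
apply/(is_sectionP _ oV) => b Ub; split.
  by rewrite /= mproj_mmap hs.1 // fK.
apply: (cvg_comp f (back \o s) (fc b)).
apply: (cvg_comp s back (section_cvg oU hs Ub)).
exact: (mmap_continuous iso_back gc).
Qed.

Lemma pull_mmul s t b : mproj (s (f b)) = f b -> mproj (t (f b)) = f b ->
  mmul (pull s b) (pull t b) = back (mmul (s (f b)) (t (f b))).
Proof.
by move=> es et; rewrite !pull_back // (mmap_mmul iso_back) // es et.
Qed.

Lemma pull_cocycle (c : cech A2 L2) : cocycle c -> cocycle (pull_cech A1 L1 f c).
Proof.
move=> hc; have [oc cc sc Ec] := hc; have [fc gc fK gK _] := fg.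
split=> /=.
- by move=> i; move/continuousP : fc; exact.
- by move=> b; exact: cc.
- by move=> i j; apply: (pull_is_section (openI (oc i) (oc j))).
- move=> i j k b Ui Uj Uk; rewrite pull_mmul; try exact: cocycle_proj.
  by rewrite Ec // pull_back //; exact: cocycle_proj.
Qed.

Lemma pull_cohomologous (c d : cech A2 L2) : cocycle c -> cocycle d ->
  cohomologous c d -> cohomologous (pull_cech A1 L1 f c) (pull_cech A1 L1 f d).
Proof.
move=> hc hd [K [W [r [s [tau [oW cW Wsub sW E]]]]]]; have [fc gc fK gK _] := fg.
exists K, (fun k => f @^-1` W k), r, s, (fun k => pull (tau k)); split=> /=.
- by move=> k; move/continuousP : fc; exact.
- by move=> b; exact: cW.
- by move=> k b /Wsub.
- by move=> k; exact: pull_is_section.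
- move=> k l b Wk Wl.
  have [ck dk] := Wsub _ _ Wk; have [cl dl] := Wsub _ _ Wl.
  rewrite !pull_mmul ?(sW _).1 //; try exact: cocycle_proj.
  by rewrite E.
Qed.

Lemma pull_cech_class (c : cech A2 L2) : cocycle c ->
  pull_class f (cech_class c) = cech_class (pull_cech A1 L1 f c).
Proof.
move=> hc; rewrite /pull_class; apply/seteqP; split => [e [d [hd cd] de]|e he].
  by rewrite (cech_class_eq gd1 (pull_cocycle hc) (pull_cocycle hd)) //; exact: pull_cohomologous.
by exists c => //; exact: cech_class_id.
Qed.
End Pull.

(** * Local trivializations and cocycles *)

(** The finite subcover property for spaces that may be empty: the sequences
    that contain a given finite set of points form a filter base. *)
Lemma compact_finite_cover (T : topologicalType) (V : T -> set T) :
  compact [set: T] -> (forall x, nbhs x (V x)) ->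
  exists s : seq T, forall y, exists2 x, x \in s & V x y.
Proof.
move=> /compact_near_coveringP cT nV.
pose F : set_system (seq T) := [set P : set (seq T) |
  exists s0 : seq T, forall s : seq T, {subset s0 <= s} -> P s].
have FF : Filter F.
  split; first by exists [::].
    move=> P Q [s0 Ps] [s1 Qs]; exists (s0 ++ s1) => s ss; split.
      by apply: Ps => x xs; apply: ss; rewrite mem_cat xs.
    by apply: Qs => x xs; apply: ss; rewrite mem_cat xs orbT.
  by move=> P Q PQ [s0 Ps]; exists s0 => s /Ps /PQ.
have [x _|s0 hs] := cT _ F (fun s y => exists2 x, x \in s & V x y) FF.
  exists (V x, [set s : seq T | x \in s]) => /=.
    by split=> //; exists [:: x] => s /(_ x); apply; rewrite inE.
  by move=> [y s] [/= Vy xs]; exists x.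
by exists s0 => y; exact: (hs s0).
Qed.

(** [p] presents the orbit space of the action [a] as the space [B]; for
    [p = orbit_map a] this is the situation of [trivialization], but it is
    convenient to let the base vary. *)
Definition orbit_projection (R : realType) (n : nat) (X B : topologicalType)
    (a : torus_action R n X) (p : X -> B) : Prop :=
  [/\ continuous p, forall b, exists x, p x = b,
      forall u x, p (a u x) = p x &
      forall x y, p x = p y -> exists u, y = a u x].

(** The notion [trivialization] over an arbitrary presentation of the orbit
    space. *)
Definition triv_over (R : realType) (n : nat) (X B : topologicalType)
    (a : torus_action R n X) (A : set (chart R n B)) (L : set (B * 'rV[int]_n))
    (p : X -> B) (U : set B) (h : X -> model A L) : Prop :=
  [/\ homeo_on (p @^-1` U) [set q | U (mproj q)] h,
      forall x, U (p x) -> mproj (h x) = p x &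
      forall u x, U (p x) -> h (a u x) = mact u (h x)].

(** The relation of an action to its Euler cocycles in [euler_cocycle], over
    an arbitrary presentation of the orbit space. *)
Definition realizes (R : realType) (n : nat) (X B : topologicalType)
    (a : torus_action R n X) (A : set (chart R n B)) (L : set (B * 'rV[int]_n))
    (p : X -> B) (c : cech A L) (h : cech_idx c -> X -> model A L) : Prop :=
  [/\ cocycle c, forall i, triv_over a p (cech_cover c i) (h i) &
      forall i j x, cech_cover c i (p x) -> cech_cover c j (p x) ->
        h i x = mmul (cech_val c i j (p x)) (h j x)].

Section Trivializations.
Context {R : realType} {n : nat} {X B : topologicalType}.
Context {a : torus_action R n X}.
Context {A : set (chart R n B)} {L : set (B * 'rV[int]_n)}.
Context {p : X -> B} (pP : orbit_projection a p).
Local Notation M := (model A L).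
Local Notation cls := (@mclass R n B A L).

Lemma open_over_base U : open U -> open (p @^-1` U).
Proof. by have [/continuousP pc _ _ _] := pP; exact: pc. Qed.

Lemma open_over_model U : open U -> open [set q : M | U (mproj q)].
Proof. by move/continuousP: (@mproj_continuous R n B A L); exact. Qed.

Lemma triv_inv U (h : X -> M) : open U -> triv_over a p U h -> exists g : M -> X,
  (forall x, U (p x) -> g (h x) = x /\ {for x, continuous h}) /\
  (forall q, U (mproj q) -> [/\ p (g q) = mproj q, h (g q) = q & {for q, continuous g}]).
Proof.
move=> oU [hh hp _].
have [g [g1 g2]] := homeo_onE (open_over_base oU) (open_over_model oU) hh.
exists g; split=> [x Ux|q Uq]; first by have [] := g1 x Ux.
by have [Ug hg gc] := g2 q Uq; split=> //; rewrite -hp // hg.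
Qed.

Lemma triv_inj U (h : X -> M) x y : open U -> triv_over a p U h ->
  U (p x) -> U (p y) -> h x = h y -> x = y.
Proof.
move=> oU tr Ux Uy e; have [g [g1 _]] := triv_inv oU tr.
by have [<- _] := g1 x Ux; have [<- _] := g1 y Uy; rewrite e.
Qed.

Lemma triv_stab U (h : X -> M) u x : open U -> triv_over a p U h -> U (p x) ->
  a u x = x <-> Zsub A L (p x) u.
Proof.
move=> oU tr Ux; have [_ hp ha] := tr; have [_ _ pa _] := pP.
rewrite -hp // -mact_stab -ha //; split=> [->//|e].
by apply: triv_inj tr _ _ e; rewrite ?pa.
Qed.

Lemma point_over_subproof b : exists x, p x = b.
Proof. by have [_ h _ _] := pP. Qed.

Definition point_over b : X := projT1 (cid (point_over_subproof b)).

Lemma point_overK b : p (point_over b) = b.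
Proof. exact: (projT2 (cid (point_over_subproof b))). Qed.

(** The transition section between two local trivializations; by equivariance
    the choice of [point_over b] does not affect the value. *)
Definition trans (h h' : X -> M) (b : B) : M :=
  mmul (h (point_over b)) (minv (h' (point_over b))).

Lemma transE U V h h' x : triv_over a p U h -> triv_over a p V h' ->
  U (p x) -> V (p x) -> trans h h' (p x) = mmul (h x) (minv (h' x)).
Proof.
move=> [_ hp ha] [_ hp' ha'] Ux Vx; have [_ _ _ po] := pP.
have [u xE] := po (point_over (p x)) x (point_overK _).
have Ux' : U (p (point_over (p x))) by rewrite point_overK.
have Vx' : V (p (point_over (p x))) by rewrite point_overK.
rewrite [in RHS]xE ha // ha' // /trans.
have [v ->] := mclass_at (hp _ Ux'); have [w ->] := mclass_at (hp' _ Vx').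
rewrite !mact_class !minv_class !mmul_class; congr mclass; tgroup.
Qed.

(** The trivialization [h'] provides a continuous local section [g' (cls b 1)]
    of [p], at which [trans h h'] is [h]. *)
Lemma trans_section U V h h' : open U -> open V -> triv_over a p U h ->
  triv_over a p V h' -> is_section (U `&` V) (trans h h').
Proof.
move=> oU oV tr tr'; have [_ hp _] := tr; have [_ hp' _] := tr'.
have [gg [gg1 _]] := triv_inv oU tr; have [g' [_ g1']] := triv_inv oV tr'.
have oUV : open (U `&` V) by exact: openI.
have g'E b : V b -> [/\ p (g' (cls b 1%g)) = b, h' (g' (cls b 1%g)) = cls b 1%g &
    {for cls b 1%g, continuous g'}].
  by move=> Vb; have := g1' (cls b 1%g); rewrite mproj_class; exact.
apply: (@eq_section _ _ _ _ _ _ (fun b => h (g' (cls b 1%g)))) => //.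
  move=> b [Ub Vb]; have [e1 e2 _] := g'E b Vb.
  rewrite -[in RHS]e1 (transE tr tr') ?e1 // e2.
  have hb : mproj (h (g' (cls b 1%g))) = b by rewrite hp e1.
  by rewrite minv_class invg1 mmulC ?mproj_class // mmul1.
apply/(is_sectionP _ oUV) => b [Ub Vb]; have [e1 e2 e3] := g'E b Vb.
split; first by rewrite hp e1.
have c1 : (fun b => g' (cls b 1%g)) @ b --> g' (cls b 1%g).
  apply: (cvg_comp (fun b => cls b 1%g) g' _ e3).
  by apply: cvg_mclass; [exact: cvg_id|exact: cvg_cst].
apply: (cvg_comp _ h c1).
by have [] := gg1 (g' (cls b 1%g)); rewrite ?e1.
Qed.

(** The transition sections between the trivializations of the two families
    form the required cochain. *)
Lemma realizes_cohomologous (c d : cech A L) h h' :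
  realizes a p (c := c) h -> realizes a p (c := d) h' -> cohomologous c d.
Proof.
move=> [hc tc Ec] [hd td Ed].
have [oc cc _ _] := hc; have [od cd _ _] := hd.
exists (cech_idx c * cech_idx d)%type, (fun k => cech_cover c k.1 `&` cech_cover d k.2),
  fst, snd, (fun k => trans (h k.1) (h' k.2)); split.
- by move=> k; exact: openI.
- by move=> b; have [i Ui] := cc b; have [j Vj] := cd b; exists (i, j).
- by move=> k b.
- by move=> k; exact: trans_section.
move=> [i j] [k l] b /= [Ui Vj] [Uk Vl].
rewrite -(point_overK b) in Ui Vj Uk Vl *; set x := point_over b in Ui Vj Uk Vl *.
rewrite (transE (tc k) (td l)) // (transE (tc i) (td j)) //.
rewrite (Ec i k) // (Ed j l) //.
have [_ pk _] := tc k; have [_ pl _] := td l.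
have [u ->] := mclass_at (pk x Uk); have [v ->] := mclass_at (pl x Vl).
have [w ->] := mclass_at (cocycle_proj hc Ui Uk).
have [z ->] := mclass_at (cocycle_proj hd Vj Vl).
rewrite !mmul_class !minv_class !mmul_class; congr mclass; tgroup.
Qed.

Lemma realizes_exists : compact [set: B] ->
  (forall b, exists U (h : X -> M), [/\ open U, U b & triv_over a p U h]) ->
  exists (c : cech A L) h, realizes a p (c := c) h.
Proof.
move=> cB loc; have [V VP] := choice loc; have [k kP] := choice VP.
have nV b : nbhs b (V b) by apply: open_nbhs_nbhs; case: (kP b).
have [sq sqP] := compact_finite_cover cB nV; pose s := in_tuple sq.
(* The ordinal type lives in too large a universe to index a cochain. *)
pose J := {i : nat | (i < size sq)%N}.
pose pt (j : J) := tnth s (Ordinal (proj2_sig j)).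
pose U j := V (pt j); pose h j := k (pt j).
have tr i : triv_over a p (U i) (h i) by case: (kP (pt i)).
have oU i : open (U i) by case: (kP (pt i)).
exists (Cech U (fun i j => trans (h i) (h j))), h; split=> //=.
  split=> //=.
  - move=> b; have [b' b's Vb] := sqP b; have /tnthP[i bE] : b' \in s by [].
    exists (exist _ (nat_of_ord i) (ltn_ord i)); rewrite /U /pt.
    by rewrite (_ : Ordinal _ = i) -?bE //; apply: val_inj.
  - by move=> i j; exact: trans_section.
  - move=> i j l b; rewrite -(point_overK b); set x := point_over b => Ui Uj Ul.
    rewrite !(transE (tr _) (tr _)) //.
    have [_ pi _] := tr i; have [_ pj _] := tr j; have [_ pl _] := tr l.
    have [u ->] := mclass_at (pi x Ui); have [v ->] := mclass_at (pj x Uj).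
    have [w ->] := mclass_at (pl x Ul).
    rewrite !minv_class !mmul_class; congr mclass; tgroup.
move=> i j x Ui Uj; rewrite (transE (tr _) (tr _)) //.
have [_ pi _] := tr i; have [_ pj _] := tr j.
have [u ->] := mclass_at (pi x Ui); have [v ->] := mclass_at (pj x Uj).
by rewrite !minv_class !mmul_class mulgVK.
Qed.
End Trivializations.

(** Two realizations of cohomologous cocycles: in the trivializations, the
    cochain whose coboundary is the difference of the cocycles turns the
    identity of the canonical model into a globally defined map. *)
Lemma realizes_map (R : realType) (n : nat) (X1 X2 B : topologicalType)
    (a1 : torus_action R n X1) (a2 : torus_action R n X2)
    (A : set (chart R n B)) (L : set (B * 'rV[int]_n)) (p1 : X1 -> B) (p2 : X2 -> B)
    (c1 c2 : cech A L) h1 h2 : good A L ->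
  orbit_projection a1 p1 -> orbit_projection a2 p2 ->
  realizes a1 p1 (c := c1) h1 -> realizes a2 p2 (c := c2) h2 -> cohomologous c1 c2 ->
  exists f : X1 -> X2, [/\ continuous f, bijective f,
    forall x, p2 (f x) = p1 x & forall u x, f (a1 u x) = a2 u (f x)].
Proof.
move=> gd P1 P2 [hc1 t1 E1] [hc2 t2 E2] [K [W [r [s [tau [oW cW Wsub sW E]]]]]].
have [p1c p1s p1a p1o] := P1; have [p2c p2s p2a p2o] := P2.
have [oc1 _ _ _] := hc1; have [oc2 _ _ _] := hc2.
have [g2 g2P] := choice (fun i => triv_inv P2 (oc2 i) (t2 i)).
have [ka kaP] := choice cW.
pose G k x := mmul (minv (tau k (p1 x))) (h1 (r k) x).
pose F k x := g2 (s k) (G k x).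
have Gp k x : W k (p1 x) -> mproj (G k x) = p1 x.
  move=> Wk; have [rk _] := Wsub _ _ Wk; have [_ hp _] := t1 (r k).
  by rewrite /G mproj_mmul ?mproj_minv ?(sW k).1 ?hp.
have Fp k x : W k (p1 x) -> p2 (F k x) = p1 x /\ h2 (s k) (F k x) = G k x.
  move=> Wk; have [_ sk] := Wsub _ _ Wk; have [_ /(_ (G k x))] := g2P (s k).
  by rewrite Gp // => /(_ sk)[].
have FE k l x : W k (p1 x) -> W l (p1 x) -> F k x = F l x.
  move=> Wk Wl; have [rk sk] := Wsub _ _ Wk; have [rl sl] := Wsub _ _ Wl.
  have [pk gk] := Fp k x Wk; have [pl gl] := Fp l x Wl.
  apply: (triv_inj P2 (oc2 (s l)) (t2 (s l))); rewrite ?pk ?pl // gl.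
  have := E2 (s k) (s l) (F k x); rewrite pk gk => /(_ sk sl).
  have [_ hpk _] := t2 (s l).
  have [u ->] : exists u, h2 (s l) (F k x) = mclass A L (p1 x) u.
    by apply: mclass_at; rewrite hpk pk.
  have := E k l _ Wk Wl.
  rewrite /G (E1 (r k) (r l)) //.
  have [_ hpl _] := t1 (r l).
  have [v ->] := mclass_at (hpl x rl).
  have [w1 ->] := mclass_at (cocycle_proj hc1 rk rl).
  have [w2 ->] := mclass_at (cocycle_proj hc2 sk sl).
  have [y1 ->] := mclass_at ((sW k).1 _ Wk); have [y2 ->] := mclass_at ((sW l).1 _ Wl).
  rewrite !minv_class !mmul_class => /mclassP[_ e1] /mclassP[_ e2].
  apply/mclassP; split=> //; have := ZsubM e1 (ZsubV e2).
  by congr (Zsub _ _ _ _); tgroup.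
pose f x := F (ka (p1 x)) x.
have Wka x : W (ka (p1 x)) (p1 x) by exact: kaP.
have fE k x : W k (p1 x) -> f x = F k x by move=> Wk; exact: FE.
have fp x : p2 (f x) = p1 x by have [] := Fp _ _ (Wka x).
have fa u x : f (a1 u x) = a2 u (f x).
  rewrite (fE (ka (p1 x))) ?p1a //; set k := ka (p1 x).
  have [rk sk] := Wsub _ _ (Wka x); have [pk gk] := Fp _ _ (Wka x).
  have Wk' : W k (p1 (a1 u x)) by rewrite p1a; exact: Wka.
  have [pk' gk'] := Fp _ _ Wk'; have [_ hpk hak] := t2 (s k).
  apply: (triv_inj P2 (oc2 (s k)) (t2 (s k))); rewrite ?pk' ?p1a ?p2a ?fp //.
  rewrite gk' hak ?fp // gk /G p1a; have [_ hp1 ha1] := t1 (r k).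
  have Wk : W k (p1 x) := Wka x.
  by rewrite -/k ha1 // mact_mmul // mproj_minv (sW k).1 // hp1.
have stab u x : a1 u x = x <-> a2 u (f x) = f x.
  have [rk sk] := Wsub _ _ (Wka x).
  have s1 := triv_stab P1 u (oc1 _) (t1 _) rk.
  have sk' : cech_cover c2 (s (ka (p1 x))) (p2 (f x)) by rewrite fp.
  have s2 := triv_stab P2 u (oc2 _) (t2 _) sk'; rewrite fp in s2.
  by split=> [/s1/s2|/s2/s1].
exists f; split=> //; first last.
  have finj : injective f.
    move=> x y fxy; have : p1 x = p1 y by rewrite -!fp fxy.
    move=> /p1o[u yE]; rewrite yE; apply/esym/stab.
    by rewrite -fa -yE fxy.
  have fsurj y : exists x, f x = y.
    have [x xE] := p1s (p2 y); have : p2 (f x) = p2 y by rewrite fp.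
    by move=> /p2o[u ->]; exists (a1 u x).
  have [g gK] := choice fsurj; exists g => // x; apply: finj.
  by rewrite gK.
move=> x; set k := ka (p1 x); have Wk : W k (p1 x) := Wka x.
have [rk sk] := Wsub _ _ Wk; have [_ hp1 _] := t1 (r k).
have nW : \forall y \near x, W k (p1 y).
  by apply: p1c; exact: open_nbhs_nbhs.
have Gc : G k @ x --> G k x.
  apply: (cvg_mmul gd).
  - by apply: filterS nW => y Wy; rewrite mproj_minv (sW k).1 // hp1 //; case: (Wsub _ _ Wy).
  - by rewrite mproj_minv (sW k).1 // hp1.
  - apply: (cvg_minv gd); apply: (cvg_comp p1 (tau k) (p1c x)).
    exact: section_cvg (sW k) Wk.
  - by have [? [/(_ x rk)[]]] := triv_inv P1 (oc1 _) (t1 (r k)).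
have Fc : F k @ x --> F k x.
  apply: (cvg_comp (G k) (g2 (s k)) Gc).
  by have [_ /(_ (G k x))] := g2P (s k); rewrite Gp // => /(_ sk)[].
rewrite /continuous_at (fE k) //; apply: cvg_trans Fc; apply: near_eq_cvg.
by apply: filterS nW => y Wy; rewrite (fE k).
Qed.

(** * The Euler class of a realization *)

Section RealizesPull.
Context {R : realType} {n : nat} {X B1 B2 : topologicalType}.
Context {a : torus_action R n X}.
Context {A1 : set (chart R n B1)} {L1 : set (B1 * 'rV[int]_n)}.
Context {A2 : set (chart R n B2)} {L2 : set (B2 * 'rV[int]_n)}.
Context (f : B1 -> B2) (g : B2 -> B1) (fg : pair_iso A1 L1 A2 L2 f g).
Context (p : X -> B1) (pP : orbit_projection a p).
Local Notation back := (@mmap R n B2 B1 A2 L2 A1 L1 g).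
Local Notation forth := (@mmap R n B1 B2 A1 L1 A2 L2 f).

Lemma orbit_projection_comp : orbit_projection a (f \o p).
Proof.
have [pc ps pa po] := pP; have [fc gc fK gK _] := fg; split=> [x|b|u x|x y] /=.
- exact: (cvg_comp p f (pc x) (fc _)).
- by have [x xE] := ps (g b); exists x; rewrite xE gK.
- by rewrite pa.
- by move=> /(can_inj fK) /po.
Qed.

Lemma triv_pull U h : open U -> triv_over a (f \o p) U h ->
  triv_over a p (f @^-1` U) (back \o h).
Proof.
move=> oU tr; have [fc gc fK gK _] := fg; have P2 := orbit_projection_comp.
have [hh hp ha] := tr; have [k [k1 k2]] := triv_inv P2 oU tr.
have oV : open (f @^-1` U) by move/continuousP : fc; exact.
split.
- apply: (@homeo_onI _ _ _ _ _ (k \o forth)).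
  + by have [/continuousP pc _ _ _] := pP; exact: pc.
  + exact: open_over_model.
  + move=> x Ux /=; have [kx hc] := k1 x Ux; split.
    * by rewrite mproj_mmap hp //= fK.
    * by rewrite (iso_backK fg).
    * apply: (cvg_comp h back hc); apply: (mmap_continuous (iso_back fg) gc).
  + move=> q Uq /=; have Uq' : U (mproj (forth q)) by rewrite mproj_mmap.
    have [kp hk kc] := k2 _ Uq'; split.
    * by have -> : f (p (k (forth q))) = mproj (forth q) by exact: kp; exact: Uq'.
    * by rewrite hk (iso_K fg).
    * apply: (cvg_comp forth k) kc; apply: (mmap_continuous (iso_forth fg) fc).
- by move=> x Ux; rewrite /= mproj_mmap hp //= fK.
- by move=> u x Ux; rewrite /= ha // (mmap_mact (iso_back fg)).
Qed.

Lemma realizes_pull (c : cech A2 L2) h : realizes a (f \o p) h ->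
  realizes a p (c := pull_cech A1 L1 f c) (fun i => back \o h i).
Proof.
move=> [hc tr E]; split=> [|i|i j x Ui Uj] /=.
- exact: (pull_cocycle fg hc).
- by apply: triv_pull => //; exact: cocycle_open.
have [_ hpi _] := tr i; have [_ hpj _] := tr j.
have pc := cocycle_proj hc Ui Uj.
rewrite (E i j) // (mmap_mmul (iso_back fg)) ?pc ?hpj //=.
by rewrite (pull_back fg).
Qed.
End RealizesPull.

Section Orbits.
Context {R : realType} {n : nat} {X : topologicalType} (a : torus_action R n X).
Local Notation mu := (orbit_map a).

Lemma orbit_mapP x y : mu x = mu y <-> exists u, y = a u x.
Proof.
split=> [h|h].
  have : x = y %[mod {eq_quot (@orbit_equiv R n X a)}] by exact: h.
  by move=> /eqmodP /= /asboolP.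
have : x = y %[mod {eq_quot (@orbit_equiv R n X a)}] by apply/eqmodP/asboolP.
exact.
Qed.

Lemma orbit_map_continuous : continuous mu.
Proof. exact: (@pi_continuous _ {eq_quot (@orbit_equiv R n X a)}). Qed.

Lemma orbit_map_act u x : mu (a u x) = mu x.
Proof. by apply/esym/orbit_mapP; exists u. Qed.

Lemma orbit_map_projection : orbit_projection a mu.
Proof.
split; first exact: orbit_map_continuous.
- by move=> o; exists (repr o); exact: reprK.
- exact: orbit_map_act.
- by move=> x y /orbit_mapP.
Qed.

Lemma orbit_continuous (Y : topologicalType) (f : orbit_space a -> Y) :
  continuous (f \o mu) -> continuous f.
Proof. by move=> fc; apply/(@quotient_continuous _ {eq_quot (@orbit_equiv R n X a)}). Qed.

Lemma euler_cocycleP c : euler_cocycle a c <-> exists h, realizes a mu (c := c) h.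
Proof.
by split=> [[hc [h [tr E]]]|[h [hc tr E]]]; [exists h|split=> //; exists h].
Qed.

Lemma euler_class_eq c h : good (orbit_atlas a) (char_bundle a) ->
  realizes a mu (c := c) h -> euler_class a = cech_class c.
Proof.
move=> gd hr; have [hc _ _] := hr; apply/seteqP; split=> [d [c' /euler_cocycleP[h' hr']]|d cd].
  have [hc' _ _] := hr'.
  rewrite (cech_class_eq gd hc' hc) //.
  exact: (realizes_cohomologous orbit_map_projection hr' hr).
by exists c => //; apply/euler_cocycleP; exists h.
Qed.

(** The Euler class can be computed from trivializations over any space that
    is identified with the orbit space by an isomorphism of pairs. *)
Lemma euler_pull (B : topologicalType) (A : set (chart R n B)) (L : set (B * 'rV[int]_n))
    (g : orbit_space a -> B) k (c : cech A L) h :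
  good (orbit_atlas a) (char_bundle a) ->
  pair_iso (orbit_atlas a) (char_bundle a) A L g k ->
  realizes a (g \o mu) (c := c) h -> pull_class g (cech_class c) = euler_class a.
Proof.
move=> gd1 gk hr; have [hc _ _] := hr.
rewrite (pull_cech_class gd1 gk hc); apply/esym.
exact: (euler_class_eq gd1 (realizes_pull gk orbit_map_projection hr)).
Qed.
End Orbits.

(** * The canonical model as an open subset of C^n *)

Lemma continuous_near_eq (S T : topologicalType) (f g : S -> T) (x : S) :
  (\forall y \near x, f y = g y) -> {for x, continuous f} -> {for x, continuous g}.
Proof.
move=> fg fc; rewrite /prop_for /continuous_at -(nbhs_singleton fg).
by apply: cvg_trans fc; apply: near_eq_cvg.
Qed.

Section ComplexSpace.
Context {R : realType} {n : nat}.
Local Notation C := R[i].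
Local Notation Cn := 'rV[C]_n.
Local Notation T := (torus R n).

Lemma hausdorff_rVC : hausdorff_space Cn.
Proof.
move=> z w zw; apply/rowP => i; apply: contrapT => /eqP ne.
have e0 : 0 < `|z ord0 i - w ord0 i| / 2.
  by rewrite divr_gt0 // normr_gt0 subr_eq0.
have N (x : Cn) : nbhs x [set y : Cn | `|x ord0 i - y ord0 i| < `|z ord0 i - w ord0 i| / 2].
  exact: (@rV_coord_continuous C n i x) _ (near_norm_lt _ e0).
have [x [/= zx wx]] := zw _ _ (N z) (N w).
have : `|z ord0 i - w ord0 i| < `|z ord0 i - w ord0 i|.
  rewrite {2}[`|_|]splitr; apply: le_lt_trans (ltrD zx wx).
  by rewrite (distrC (w ord0 i)); exact: ler_distD.
by rewrite ltxx.
Qed.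

Definition sqnorm (z : C) : R := complex.Re z ^+ 2 + complex.Im z ^+ 2.

Lemma sqnormE (z : C) : ((sqnorm z)%:C)%C = `|z| ^+ 2.
Proof. exact: add_Re2_Im2. Qed.

Lemma sqnorm_eq0 (z : C) : (sqnorm z == 0) = (z == 0).
Proof.
by rewrite -(inj_eq (@complexI R)) sqnormE expf_eq0 /= normr_eq0.
Qed.

Lemma sqnorms_coord (z : Cn) i : sqnorms z ord0 i = sqnorm (z ord0 i).
Proof. by rewrite mxE. Qed.

Lemma sqnorms_ge0 (z : Cn) : orthant (sqnorms z).
Proof. by move=> i; rewrite sqnorms_coord addr_ge0 // sqr_ge0. Qed.

Lemma mem_zeros_sqnorms (z : Cn) i : (i \in zeros (sqnorms z)) = (z ord0 i == 0).
Proof. by rewrite inE sqnorms_coord sqnorm_eq0. Qed.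

Lemma sqnorms_continuous : continuous (@sqnorms R n).
Proof.
move=> z; apply: (cvg_rV (F := nbhs z)) => i; rewrite sqnorms_coord.
under eq_fun do rewrite sqnorms_coord.
have c : (fun w : Cn => w ord0 i) @ z --> z ord0 i by exact: rV_coord_continuous.
by apply: cvgD; rewrite expr2; under eq_fun do rewrite expr2; apply: cvgM;
  (exact: (cvg_comp _ _ c (@Re_continuous R _)) || exact: (cvg_comp _ _ c (@Im_continuous R _))).
Qed.

Definition rsqrt (xi : 'rV[R]_n) : Cn := \row_i ((Num.sqrt (xi ord0 i))%:C)%C.

Lemma rsqrtK (xi : 'rV[R]_n) : orthant xi -> sqnorms (rsqrt xi) = xi.
Proof.
move=> xi0; apply/rowP => i.
by rewrite sqnorms_coord mxE /sqnorm /= expr0n addr0 sqr_sqrtr.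
Qed.

Lemma rsqrt_continuous : continuous rsqrt.
Proof.
move=> xi; apply: (cvg_rV (F := nbhs xi)) => i; rewrite mxE; under eq_fun do rewrite mxE.
apply: cvg_complex; last exact: cvg_cst.
apply: (cvg_comp (fun x : 'rV[R]_n => x ord0 i) Num.sqrt); first exact: rV_coord_continuous.
exact: sqrt_continuous.
Qed.

Lemma std_act_coord (u : T) (z : Cn) i : std_act u z ord0 i = tcoord u i * z ord0 i.
Proof. by rewrite mxE. Qed.

Lemma sqnorms_act (u : T) (z : Cn) : sqnorms (std_act u z) = sqnorms z.
Proof.
apply/rowP => i; rewrite !sqnorms_coord; apply: (@complexI R).
by rewrite !sqnormE std_act_coord normrM tcoord_norm mul1r.
Qed.

Lemma std_actM (u v : T) (z : Cn) : std_act (u * v)%g z = std_act u (std_act v z).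
Proof. by apply/rowP => i; rewrite !std_act_coord tcoordM mulrA. Qed.

Lemma std_act1 (z : Cn) : std_act (1%g : T) z = z.
Proof. by apply/rowP => i; rewrite std_act_coord tcoord1 mul1r. Qed.

Lemma cvg_std_act (I : Type) (F : set_system I) (f : I -> T) (g : I -> Cn) u z :
  Filter F -> f @ F --> u -> g @ F --> z -> (fun x => std_act (f x) (g x)) @ F --> std_act u z.
Proof.
move=> FF fu gz; apply: cvg_rV => i; rewrite std_act_coord.
under eq_fun do rewrite std_act_coord.
apply: cvgCM; first exact: cvg_tcoord.
exact: (cvg_comp _ _ gz (@rV_coord_continuous C n i z)).
Qed.

Lemma std_act_stab (u : T) (z : Cn) :
  std_act u z = z <-> coord_torus (~: zeros (sqnorms z)) u.
Proof.
split=> [h i|h].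
  rewrite finset.in_setC mem_zeros_sqnorms => zi.
  have := congr1 (fun w : Cn => w ord0 i) h; rewrite std_act_coord.
  by rewrite -[RHS]mul1r => /(mulIf zi).
apply/rowP => i; rewrite std_act_coord; have [->|zi] := eqVneq (z ord0 i) 0.
  by rewrite mulr0.
by rewrite h ?mul1r // finset.in_setC mem_zeros_sqnorms.
Qed.

(** The quotients of nonzero coordinates form the required element; the
    remaining coordinates are set to 1. *)
Lemma polar (z w : Cn) : sqnorms z = sqnorms w -> exists u : T, z = std_act u w.
Proof.
move=> zw; have nE i : `|z ord0 i| = `|w ord0 i|.
  apply/eqP; rewrite -(eqrXn2 (n := 2)) //; apply/eqP.
  by rewrite -!sqnormE -!sqnorms_coord zw.
pose c i := if w ord0 i == 0 then 1 else z ord0 i / w ord0 i.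
have c1 i : `|c i| = 1.
  rewrite /c; case: eqP => [_|/eqP wi]; first by rewrite normr1.
  by rewrite normrM normfV nE divff // normr_eq0.
exists (torus_of c1); apply/rowP => i; rewrite std_act_coord tcoord_of /c.
case: eqP => [wi|/eqP wi]; last by rewrite divfK.
by rewrite wi mulr0; apply/eqP; rewrite -normr_eq0 nE wi normr0.
Qed.
End ComplexSpace.

(** Inverting a family of maps [G d] parametrized by a compact space: if
    [y = G (p y, s)] determines [h y = q (p y, s)], then [h] is continuous,
    whatever the choice of [s]. *)
Lemma compact_inverse_continuous (S D Y Q : topologicalType) (p : Y -> D)
    (G : D * S -> Y) (q : D * S -> Q) (h : Y -> Q) (y0 : Y) :
  compact [set: S] -> hausdorff_space Y -> {for y0, continuous p} ->
  (forall s, {for (p y0, s), continuous G}) ->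
  (forall s, {for (p y0, s), continuous q}) ->
  (forall s, G (p y0, s) = y0 -> q (p y0, s) = h y0) ->
  (\forall y \near y0, exists s, G (p y, s) = y /\ q (p y, s) = h y) ->
  {for y0, continuous h}.
Proof.
move=> cS; rewrite open_hausdorff => hY pc Gc qc Gq hE V nV.
have H : \forall y \near y0, forall s, setT s -> G (p y, s) = y -> V (q (p y, s)).
  apply: compact_tube => // s _.
  have pc' : (fun r : Y * S => (p r.1, r.2)) @ (y0, s) --> (p y0, s).
    apply: cvg_pair; last exact: cvg_snd.
    exact: (cvg_comp _ p (@cvg_fst _ _ (nbhs y0) (nbhs s) _) pc).
  have [e|/eqP ne] := pselect (G (p y0, s) = y0).
    have c : (fun r : Y * S => q (p r.1, r.2)) @ (y0, s) --> q (p y0, s).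
      exact: (cvg_comp _ q pc' (qc s)).
    have nV' : nbhs (q (p y0, s)) V by rewrite Gq.
    have : \forall r \near (y0, s), V (q (p r.1, r.2)) by exact: c _ nV'.
    by apply: filterS => r Vr _.
  have [[U W] /= [/set_mem Uy /set_mem Wy] [oU oW UW]] := hY _ _ ne.
  have c : (fun r : Y * S => G (p r.1, r.2)) @ (y0, s) --> G (p y0, s).
    exact: (cvg_comp _ G pc' (Gc s)).
  have h1 : \forall r \near (y0, s), U (G (p r.1, r.2)).
    by apply: c; exact: open_nbhs_nbhs.
  have h2 : \forall r \near (y0, s), W r.1.
    by apply: (@cvg_fst _ _ (nbhs y0) (nbhs s) _); exact: open_nbhs_nbhs.
  apply: filterS2 h1 h2 => r Ur Wr e; exfalso.
  have : (U `&` W) r.1 by split=> //; rewrite -e.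
  by move/eqP: UW => ->.
have : \forall y \near y0, V (h y); last exact.
by move: hE H; apply: filterS2 => y [s [e <-]] /(_ s I); exact.
Qed.

Section NormalForm.
Context {R : realType} {n : nat} {B : topologicalType}.
Context {A : set (chart R n B)} {L : set (B * 'rV[int]_n)} (gd : good A L).
Local Notation T := (torus R n).
Local Notation M := (model A L).
Local Notation cls := (@mclass R n B A L).
Local Notation Cn := 'rV[R[i]]_n.

(** The quotient topology of the model restricts to the quotient topology over
    open subsets of the base. *)
Lemma model_continuous_on (Y : topologicalType) (U : set B) (f : M -> Y) : open U ->
  (forall b u, U b -> {for (b, u), continuous (fun p : B * T => f (cls p.1 p.2))}) ->
  forall q, U (mproj q) -> {for q, continuous f}.
Proof.
move=> oU fc q Uq V nV.
pose S := [set q' : M | U (mproj q') /\ interior V (f q')].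
suff oS : open S.
  have : nbhs q S.
    by apply: open_nbhs_nbhs; split.
  by apply: filterS => q' [_ /interior_subset].
suff : open [set p : B * T | S (cls p.1 p.2)].
  have -> : (fun p : B * T => S (cls p.1 p.2)) =
      (\pi_({eq_quot (@model_equiv R n B A L)}) : B * T -> M) @^-1` S.
    by apply/funext => -[].
  by [].
apply: near_open => -[b u] /= [Ub Vb]; rewrite mproj_class in Ub.
have h1 : \forall p \near (b, u), U p.1.
  by apply: (@cvg_fst _ _ (nbhs b) (nbhs u) _); exact: open_nbhs_nbhs.
have h2 : \forall p \near (b, u), interior V (f (cls p.1 p.2)).
  have nV' : nbhs (f (cls b u)) (interior V).
    by apply: open_nbhs_nbhs; split=> //; exact: open_interior.
  exact: (fc b u Ub _ nV').
by apply: filterS2 h1 h2 => p Up Vp; split; rewrite ?mproj_class.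
Qed.

Context (U : set B) (xi : B -> 'rV[R]_n) (rho : T -> T) (nf : nfchart A L U xi rho).

(** On classes this is [b, u] |-> rho(u) . sqrt(xi(b)), see [nfmap_class]. *)
Definition nfmap (q : M) : Cn := std_act (rho (repr q).2) (rsqrt (xi (mproj q))).

Definition nfrange : set Cn := [set z | (xi @` U) (sqnorms z)].

Lemma nf_orthant b : U b -> orthant (xi b).
Proof.
move=> Ub; have [_ _ [Q _ xU] _ _] := nf.
by have : (xi @` U) (xi b) by [exists b]; rewrite xU => -[].
Qed.

Lemma nfmap_class b u : U b -> nfmap (cls b u) = std_act (rho u) (rsqrt (xi b)).
Proof.
move=> Ub; rewrite /nfmap mproj_class.
have := mclass_repr (cls b u); rewrite mproj_class => /mclassP[_].
have [_ _ _ ra UZ] := nf; rewrite (UZ b Ub).1 /=.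
set v := (repr _).2; have [rM _] := ra; rewrite rM torus_autV // => h.
have -> : (rho u = rho v * (rho u * (rho v)^-1))%g by tgroup.
rewrite std_actM; congr std_act; apply/esym/std_act_stab.
by rewrite rsqrtK //; exact: nf_orthant.
Qed.

Lemma sqnorms_nfmap q : U (mproj q) -> sqnorms (nfmap q) = xi (mproj q).
Proof. by move=> Uq; rewrite sqnorms_act rsqrtK //; exact: nf_orthant. Qed.

Lemma nfmap_mact u q : U (mproj q) -> nfmap (mact u q) = std_act (rho u) (nfmap q).
Proof.
move=> Uq; have [v qE] := mclassE q; move: qE Uq; move: (mproj q) => b -> Ub.
rewrite mact_class (nfmap_class (u * v)%g Ub) (nfmap_class v Ub).
by have [_ _ _ [rM _] _] := nf; rewrite (rM u v) std_actM.
Qed.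

Lemma open_nfrange : open nfrange.
Proof.
have [_ _ [Q oQ xU] _ _] := nf.
have -> : nfrange = @sqnorms R n @^-1` Q.
  apply/seteqP; split=> z.
    move=> zr; have : (@orthant R n `&` Q) (sqnorms z) by rewrite -xU.
    by case.
  move=> Qz; have : (@orthant R n `&` Q) (sqnorms z) by split=> //; exact: sqnorms_ge0.
  by rewrite -xU.
by move/continuousP: (@sqnorms_continuous R n); exact.
Qed.

Lemma nfrange_invariant : invariant (@std_act R n) nfrange.
Proof. by move=> u z; rewrite /nfrange /= sqnorms_act. Qed.

Lemma nf_local_continuous b u : U b ->
  {for (b, u), continuous (fun p : B * T => std_act (rho p.2) (rsqrt (xi p.1)))}.
Proof.
move=> Ub; have [_ _ _ [_ [rc _]] _] := nf.
apply: cvg_std_act.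
  exact: (cvg_comp snd rho (@cvg_snd _ _ (nbhs b) (nbhs u) _) (rc u)).
apply: (cvg_comp _ rsqrt _ (@rsqrt_continuous R n (xi b))).
exact: (cvg_comp fst xi (@cvg_fst _ _ (nbhs b) (nbhs u) _) (nf_continuous nf Ub)).
Qed.

Lemma nfmap_continuous q : U (mproj q) -> {for q, continuous nfmap}.
Proof.
have [oU _ _ _ _] := nf; apply: (@model_continuous_on Cn U nfmap oU) => b u Ub.
apply: (@continuous_near_eq (B * T)%type Cn
  (fun p => std_act (rho p.2) (rsqrt (xi p.1))) (fun p => nfmap (cls p.1 p.2)) (b, u)).
  have : \forall p \near (b, u), U p.1.
    by apply: (@cvg_fst _ _ (nbhs b) (nbhs u) _); exact: open_nbhs_nbhs.
  by apply: filterS => p Up; rewrite nfmap_class.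
exact: nf_local_continuous.
Qed.

(** The part of the canonical model over [U] is the open set [nfrange] of C^n:
    the subtorus collapsed over [b] matches the stabilizer of the points with
    square norms [xi b]. The inverse involves a choice of arguments of the
    coordinates, which cannot be continuous; its continuity comes from the
    compactness of the torus. *)
Lemma nfmap_homeo : homeo_on [set q | U (mproj q)] nfrange nfmap.
Proof.
have [oU hU _ ra UZ] := nf; have [_ xc [g gc gK]] := hU.
have [sig [sa rs sr]] := torus_aut_inv ra.
have gP z : nfrange z -> U (g (sqnorms z)) /\ xi (g (sqnorms z)) = sqnorms z.
  by move=> [b Ub e]; rewrite -e gK ?inE.
have uP z : exists u, nfrange z -> z = std_act (rho u) (rsqrt (sqnorms z)).
  have [zr|nz] := pselect (nfrange z); last by exists 1%g.
  have [v vE] := polar (z := z) (w := rsqrt (sqnorms z)) (esym (rsqrtK (sqnorms_ge0 z))).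
  by exists (sig v); rewrite sr.
have [w wP] := choice uP.
pose h z := cls (g (sqnorms z)) (w z).
have mh z : mproj (h z) = g (sqnorms z) by exact: mproj_class.
have fh z : nfrange z -> nfmap (h z) = z.
  by move=> zr; have [Ug xg] := gP z zr; rewrite /h nfmap_class // xg -wP.
have hq z b u : nfrange z -> U b -> std_act (rho u) (rsqrt (xi b)) = z -> cls b u = h z.
  move=> zr Ub e; have e' : xi b = sqnorms z by rewrite -e sqnorms_act rsqrtK //; exact: nf_orthant.
  have gb : g (sqnorms z) = b by rewrite -e' gK ?inE.
  rewrite /h gb; apply/mclassP; split=> //; rewrite (UZ b Ub).1 /=.
  have := wP z zr; rewrite -e' -{1}e => e2.
  have [rM _] := ra; rewrite rM torus_autV //.
  rewrite -[xi b](rsqrtK (nf_orthant Ub)); apply/std_act_stab.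
  by rewrite tgC std_actM -e2 -std_actM mulVg std_act1.
apply: (@homeo_onI _ _ _ _ _ h) => //.
- exact: open_over_model.
- exact: open_nfrange.
- move=> q Uq; have nq : nfrange (nfmap q).
    by rewrite /nfrange /= sqnorms_nfmap //; exists (mproj q).
  split=> //.
    have [u qE] := mclassE q; rewrite [RHS]qE; apply/esym/hq => //.
    by rewrite {2}qE nfmap_class.
  exact: nfmap_continuous.
move=> z zr; split; [by rewrite /= mh; case: (gP z zr)|exact: fh|].
have nr : \forall y \near z, nfrange y.
  by apply: open_nbhs_nbhs; split=> //; exact: open_nfrange.
have [Ug xg] := gP z zr.
apply: (@compact_inverse_continuous T B _ _ (fun y => g (sqnorms y))
  (fun p => std_act (rho p.2) (rsqrt (xi p.1))) (fun p => cls p.1 p.2)).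
- exact: compact_torus.
- exact: hausdorff_rVC.
- move=> V nV; have := (withinP _ _).1 gc (sqnorms z) zr V nV => H.
  have : \forall y \near z, (xi @` U) (sqnorms y) -> V (g (sqnorms y)).
    exact: (@sqnorms_continuous R n z _ H).
  by apply: filterS2 nr => y zy; exact.
- by move=> u; exact: nf_local_continuous.
- by move=> u; exact: mclass_continuous.
- by move=> u e; exact: hq.
- by apply: filterS nr => y yr; exists (w y); rewrite (gP y yr).2 -wP.
Qed.

(** The chart [phi] of the space and the chart [nfmap] of the model have the same
    range and intertwine the actions with the same automorphism [rho]: the
    trivialization is [phi] followed by the inverse of [nfmap]. *)
Lemma triv_of_chart (X : topologicalType) (a : torus_action R n X) (p : X -> B)
    (phi : X -> Cn) : orbit_projection a p ->
  homeo_on (p @^-1` U) nfrange phi ->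
  (forall x, U (p x) -> sqnorms (phi x) = xi (p x)) ->
  (forall u x, U (p x) -> phi (a u x) = std_act (rho u) (phi x)) ->
  exists h : X -> M, triv_over a p U h.
Proof.
move=> P hphi sphi aphi; have [oU hU _ ra UZ] := nf; have [_ _ [g gc gK]] := hU.
have [pc ps pa po] := P.
have oX : open (p @^-1` U) by move/continuousP: pc; exact.
have oM : open [set q : M | U (mproj q)] by exact: open_over_model.
have [k [k1 k2]] := homeo_onE oM open_nfrange nfmap_homeo.
have [l [l1 l2]] := homeo_onE oX open_nfrange hphi.
have xi_inj b b' : U b -> U b' -> xi b = xi b' -> b = b'.
  by move=> Ub Ub' e; rewrite -[b]gK ?inE // e gK ?inE.
have kp x : U (p x) -> mproj (k (phi x)) = p x.
  move=> Ux; have [zr _ _] := l1 x Ux; have [Uk kE _] := k2 _ zr.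
  by apply: xi_inj => //; rewrite -sqnorms_nfmap // kE sphi.
exists (k \o phi); split=> [|x Ux|u x Ux] /=.
- apply: (@homeo_onI _ _ _ _ _ (l \o nfmap)) => // [x Ux|q Uq].
    have [zr lx pc'] := l1 x Ux; have [Uk kE kc] := k2 _ zr.
    split=> //=; first by rewrite kE.
    exact: (cvg_comp phi k pc' kc).
  have [zr kq nc] := k1 q Uq; have [Ul lE lc] := l2 _ zr.
  by split=> //=; [rewrite lE|exact: (cvg_comp nfmap l nc lc)].
- exact: kp.
- have [zr _ _] := l1 x Ux; have [Uk kE _] := k2 _ zr.
  have Um : [set q : M | U (mproj q)] (mact u (k (phi x))) by rewrite /= mproj_mact.
  by have [_ e _] := k1 _ Um; rewrite aphi // -e nfmap_mact // kE.
Qed.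
End NormalForm.

(** * Primitive vectors and circles *)

Section Primitive.
Context {R : realType} {n : nat}.
Local Notation T := (torus R n).
Local Notation Lambda := 'rV[int]_n.

Definition primitive_vec (v : Lambda) : Prop :=
  forall t : R, one_param v t = 1%g -> exists z : int, t = z%:~R.

Lemma half_not_int (z : int) : (2^-1 : R) <> z%:~R.
Proof.
move=> h; have : (1 : R) = (z * 2)%:~R by rewrite intrM -h mulVf // pnatr_eq0.
by rewrite -[1]/(1%:~R) => /intr_inj; lia.
Qed.

Lemma primitive_neq0 v : primitive_vec v -> v != 0.
Proof.
move=> pv; apply/eqP => v0; have [|z] := pv 2^-1; last exact: half_not_int.
by apply: torus_ext => i; rewrite one_param_coord v0 mxE mulr0 mulr0 cis0 tcoord1.
Qed.

Lemma cis_eq_int (s t : R) : cis (2 * pi * s) = cis (2 * pi * t) ->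
  exists k : int, s = t + k%:~R.
Proof.
move=> h; have : cis (2 * pi * (s - t)) = 1.
  by rewrite mulrBr cisD cisN h mulfV // -normr_eq0 norm_cis oner_eq0.
move=> /cis_eq1[k kE]; exists k.
have p0 : (2 * pi : R) != 0 by rewrite mulf_neq0 ?pnatr_eq0 // gt_eqF // pi_gt0.
by move: kE => /(mulfI p0) <-; rewrite addrC subrK.
Qed.

(** If the circle of [w] lies in that of [v], the minors [w i * v j - w j * v i]
    vanish, since all real multiples of them are integers. *)
Lemma one_param_sub v w : primitive_vec v ->
  range (@one_param R n w) `<=` range (one_param v) -> exists z : int, w = z *: v.
Proof.
move=> pv wv.
have minor i j : w ord0 i * v ord0 j = w ord0 j * v ord0 i.
  apply/eqP; rewrite -subr_eq0; apply/negPn/negP => d0.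
  set d := _ - _ in d0.
  have d0' : (d%:~R : R) != 0 by rewrite intr_eq0.
  pose t : R := (2 * d%:~R)^-1.
  have [s _ sE] := wv _ (ex_intro2 _ _ t I erefl).
  have H l : exists k : int, s * (v ord0 l)%:~R = t * (w ord0 l)%:~R + k%:~R.
    by apply: cis_eq_int; rewrite -!one_param_coord sE.
  have [ki kiE] := H i; have [kj kjE] := H j.
  apply: (@half_not_int (kj * v ord0 i - ki * v ord0 j)).
  rewrite intrB !intrM.
  have -> : (kj%:~R : R) = s * (v ord0 j)%:~R - t * (w ord0 j)%:~R by rewrite kjE addrC addKr.
  have -> : (ki%:~R : R) = s * (v ord0 i)%:~R - t * (w ord0 i)%:~R by rewrite kiE addrC addKr.
  have -> : (2^-1 : R) = t * d%:~R by rewrite /t invfM mulrAC -mulrA divff // mulr1.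
  by rewrite /d intrB !intrM; ring.
have [j vj] : exists j, v ord0 j != 0.
  apply: contrapT => /forallNP h; have := primitive_neq0 pv; apply/negP/negPn.
  by apply/eqP/rowP => j; rewrite mxE; apply/eqP/negPn/negP/h.
have vj' : ((v ord0 j)%:~R : R) != 0 by rewrite intr_eq0.
pose r : R := (w ord0 j)%:~R / (v ord0 j)%:~R.
have wE i : ((w ord0 i)%:~R : R) = r * (v ord0 i)%:~R.
  by rewrite /r mulrAC -intrM -minor intrM mulfK.
have [|z zE] := pv r.
  apply: torus_ext => i; rewrite one_param_coord -wE tcoord1.
  by rewrite cis2pi_int.
exists z; apply/rowP => i; rewrite mxE; apply: (@intr_inj R).
by rewrite wE zE intrM.
Qed.

Lemma primitive_line v w : primitive_vec v -> primitive_vec w ->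
  range (@one_param R n v) = range (one_param w) -> line v = line w.
Proof.
have sub v' w' : primitive_vec w' -> range (@one_param R n v') = range (one_param w') ->
    line v' `<=` line w'.
  move=> pw e; have [|z ->] := @one_param_sub w' v' pw; first by rewrite e.
  by move=> _ [k _ <-]; exists (k * z) => //; rewrite scalerA.
by move=> pv pw e; apply/seteqP; split; apply: sub.
Qed.

Lemma axis_circle i : coord_torus (~: [set i]%SET) = range (@one_param R n (axis i)).
Proof.
apply/seteqP; split=> [u hu|_ [t _ <-] j]; last first.
  by rewrite !inE axis_coord => /negbTE ->.
have [t _ tE] := texp_surj u; exists (t ord0 i) => //.
apply: torus_ext => j; rewrite axis_coord.
case: eqP => [->|/eqP ji]; first by rewrite tE texp_coord.
by rewrite hu // !inE.
Qed.

(** The circle of [v] is the preimage of the axis circle, on which the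
    parameter is determined up to integers. *)
Lemma aut_axis_primitive (rho : T -> T) i v : torus_aut rho ->
  (forall t : R, rho (one_param v t) = one_param (axis i) t) ->
  rho @^-1` coord_torus (~: [set i]%SET) = range (@one_param R n v) /\ primitive_vec v.
Proof.
move=> ra vE; have [sig [sa rs sr]] := torus_aut_inv ra; split.
  rewrite axis_circle; apply/seteqP; split=> [u [t _ e]|_ [t _ <-]]; last by exists t.
  by exists t => //; apply: (can_inj rs); rewrite vE e.
move=> t t1; have : one_param (axis i) t = 1%g :> T by rewrite -vE t1 torus_aut1.
move/(congr1 (fun u : T => tcoord u i)); rewrite axis_coord eqxx tcoord1.
rewrite -{1}cis0 -(mulr0 (2 * pi)) => /esym/cis_eq_int[k].
by move=> e; exists (- k); apply/eqP; rewrite intrN -addr_eq0 -e.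
Qed.

Lemma aut_axis_exists (rho : T -> T) i : torus_aut rho ->
  exists v, forall t : R, rho (one_param v t) = one_param (axis i) t.
Proof.
move=> ra; have [sig [sa rs sr]] := torus_aut_inv ra.
by have [v vE] := torus_aut_axis i sa; exists v => t; rewrite -vE sr.
Qed.
End Primitive.

(** * The orbit space of a locally standard action *)

Section OrbitSpace.
Context {R : realType} {n : nat} {X : topologicalType}.
Context (a : torus_action R n X) (lsa : locally_standard a).
Local Notation T := (torus R n).
Local Notation mu := (orbit_map a).
Local Notation Atl := (orbit_atlas a).
Local Notation Ch := (char_bundle a).
Local Notation Cn := 'rV[R[i]]_n.

Definition stab (x : X) : set T := [set u | a u x = x].

Lemma stab_act u x : stab (a u x) = stab x.
Proof.
apply/seteqP; split=> v; rewrite /stab /=.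
  move=> /(congr1 (a u^-1%g)); rewrite -!actM => h.
  by move: h; rewrite (_ : _ * _ = v)%g ?mulVg ?act1 //; tgroup.
by move=> h; rewrite -actM tgC actM h.
Qed.

Lemma stab_orbit x y : mu x = mu y -> stab x = stab y.
Proof. by move=> /orbit_mapP[u ->]; rewrite stab_act. Qed.

Lemma invariant_orbit (U : set X) x : invariant a U -> (mu @` U) (mu x) -> U x.
Proof. by move=> iU [y Uy /orbit_mapP[u ->]]; exact: iU. Qed.

Lemma preimage_orbit (U : set X) : invariant a U -> mu @^-1` (mu @` U) = U.
Proof.
move=> iU; apply/seteqP; split=> x; first exact: invariant_orbit.
by move=> Ux; exists x.
Qed.

Lemma open_orbit (U : set X) : open U -> invariant a U -> open (mu @` U).
Proof.
move=> oU iU; suff : open (mu @^-1` (mu @` U)) by [].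
by rewrite preimage_orbit.
Qed.

Lemma orbit_continuous_on (Y : topologicalType) (U : set X) (f : orbit_space a -> Y) :
  open U -> invariant a U -> (forall x, U x -> {for x, continuous (f \o mu)}) ->
  forall x, U x -> {for mu x, continuous f}.
Proof.
move=> oU iU fc x Ux V nV.
pose S := [set y | U y /\ interior V (f (mu y))].
have oS : open S.
  apply: near_open => y [Uy Vy].
  have h1 : \forall z \near y, U z by exact: open_nbhs_nbhs.
  have h2 : \forall z \near y, interior V (f (mu z)).
    by apply: (fc y Uy); apply: open_nbhs_nbhs; split=> //; exact: open_interior.
  by apply: filterS2 h1 h2.
have iS : invariant a S.
  by move=> u y [Uy Vy]; split; [exact: iU|rewrite orbit_map_act].
have : nbhs (mu x) (mu @` S).
  by apply: open_nbhs_nbhs; split; [exact: open_orbit|exists x].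
by apply: filterS => _ [y [_ /interior_subset h] <-].
Qed.

Definition orbit_chart (U : set X) (phi : X -> Cn) : chart R n (orbit_space a) :=
  Chart (mu @` U) (fun o => sqnorms (phi (repr o))).

Section OneChart.
Context (U : set X) (rho : T -> T) (phi : X -> Cn) (sc : standard_chart a U rho phi).

Lemma chart_sqnorms x u : U x -> sqnorms (phi (a u x)) = sqnorms (phi x).
Proof. by have [_ _ _ _ e] := sc; move=> Ux; rewrite e // sqnorms_act. Qed.

Lemma orbit_chart_coord x : U x -> coord (orbit_chart U phi) (mu x) = sqnorms (phi x).
Proof.
move=> Ux /=; have /orbit_mapP[u ->] : mu x = mu (repr (mu x)).
  by rewrite /orbit_map reprK.
exact: chart_sqnorms.
Qed.

Lemma orbit_chart_atlas : Atl (orbit_chart U phi).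
Proof. by exists U, rho, phi; split=> // x; exact: orbit_chart_coord. Qed.

Lemma chart_stab x : U x -> stab x = rho @^-1` coord_torus (~: zeros (sqnorms (phi x))).
Proof.
move=> Ux; have [[oU iU] _ _ [[_ inj _] _ _] e] := sc.
apply/seteqP; split=> u; rewrite /stab /=.
  by move=> h; apply/std_act_stab; rewrite -e // h.
move=> /std_act_stab h; apply: inj; rewrite ?inE //; first exact: iU.
by rewrite e.
Qed.

Lemma chart_srank x : U x -> srank (stab x) (nonzeros (sqnorms (phi x))).
Proof.
move=> Ux; exists rho, (~: zeros (sqnorms (phi x))).
by have [_ _ ra _ _] := sc; split=> //; [exact: chart_stab|rewrite card_nonzeros].
Qed.

(** The continuous section [rsqrt] of [sqnorms] induces the inverse of the
    chart. *)
Lemma orbit_chart_homeo c : dom c = mu @` U ->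
  (forall x, U x -> coord c (mu x) = sqnorms (phi x)) ->
  homeo_on (dom c) (coord c @` dom c) (coord c) /\
  exists2 Q, open Q & coord c @` dom c = @orthant R n `&` Q.
Proof.
move=> dE cE; have [[oU iU] [oV iV] ra hphi e] := sc.
have [sig [sa rs sr]] := torus_aut_inv ra.
have [l [l1 l2]] := homeo_onE oU oV hphi.
have imE : coord c @` dom c = @orthant R n `&` @rsqrt R n @^-1` (phi @` U).
  rewrite dE; apply/seteqP; split=> [_ [_ [x Ux <-] <-]|xi [xi0 [x Ux xE]]].
    rewrite cE //; split; first exact: sqnorms_ge0.
    have [u uE] := polar (z := rsqrt (sqnorms (phi x))) (w := phi x) (rsqrtK (sqnorms_ge0 _)).
    by rewrite /= uE; apply: iV; exists x.
  exists (mu x); first by exists x.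
  by rewrite cE // xE rsqrtK.
split; last first.
  exists (@rsqrt R n @^-1` (phi @` U)) => //.
  by move/continuousP: (@rsqrt_continuous R n); exact.
have gE x : U x -> mu (l (rsqrt (sqnorms (phi x)))) = mu x.
  move=> Ux; have [u uE] := polar (z := rsqrt (sqnorms (phi x))) (w := phi x)
    (rsqrtK (sqnorms_ge0 _)).
  have Ux' : U (a (sig u) x) by exact: iU.
  rewrite uE -(sr u) -e //; have [_ -> _] := l1 _ Ux'.
  by rewrite orbit_map_act.
split.
- split.
  + by move=> o do_; exists o.
  + move=> o o'; rewrite !inE dE => -[x Ux <-] [y Uy <-]; rewrite !cE // => h.
    by rewrite -gE // h gE.
  + by [].
- rewrite continuous_open_subspace; last by rewrite dE; exact: open_orbit.
  move=> o; rewrite inE dE => -[x Ux <-].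
  apply: (orbit_continuous_on (f := coord c) oU iU) Ux => y Uy.
  apply: (@continuous_near_eq X _ (@sqnorms R n \o phi)).
    have : \forall z \near y, U z by exact: open_nbhs_nbhs.
    by apply: filterS => z Uz; rewrite /= cE.
  have [_ _ pc] := l1 _ Uy.
  exact: (cvg_comp phi (@sqnorms R n) pc (@sqnorms_continuous R n _)).
- exists (mu \o l \o @rsqrt R n); last first.
    by move=> o; rewrite inE dE => -[x Ux <-]; rewrite cE //=; exact: gE.
  apply/withinP => xi; rewrite imE => -[xi0 Vxi] N nN.
  have [_ _ lc] := l2 _ Vxi.
  have c1 : {for xi, continuous (mu \o l \o @rsqrt R n)}.
    apply: (cvg_comp (@rsqrt R n) (mu \o l) (@rsqrt_continuous R n xi)).
    exact: (cvg_comp l mu lc (@orbit_map_continuous R n X a _)).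
  have : \forall y \near xi, N ((mu \o l \o @rsqrt R n) y) by exact: c1 _ nN.
  by apply: filterS.
Qed.
End OneChart.

(** The number of nonzero coordinates of an orbit in a chart is the rank of
    its stabilizer, whatever the chart. *)
Lemma orbit_corner_charts : corner_charts Atl.
Proof.
split=> [ |c [U [rho [phi [sc dE cE]]]]|c d o].
- move=> o; have [U [rho [phi [sc Ux]]]] := lsa (repr o).
  exists (orbit_chart U phi); first exact: orbit_chart_atlas sc.
  by exists (repr o) => //; exact: reprK.
- have [h1 h2] := orbit_chart_homeo sc dE cE; split=> //.
  by have [[oU iU] _ _ _ _] := sc; rewrite dE; exact: open_orbit.
move=> [U [rho [phi [sc dE cE]]]] [V [sig [psi [sd eE fE]]]].
rewrite dE eE => -[x Ux xo] [y Vy yo].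
have r1 := chart_srank sc Ux; have r2 := chart_srank sd Vy.
rewrite -(cE x Ux) xo in r1; rewrite -(fE y Vy) yo in r2.
apply: srank_uniq r1 _; rewrite (stab_orbit (x := x) (y := y)) //.
by rewrite xo yo.
Qed.

Lemma orbit_stratumP x k : stratum Atl k (mu x) <-> srank (stab x) k.
Proof.
have [U [rho [phi [sc Ux]]]] := lsa x; have r := chart_srank sc Ux.
have dx : dom (orbit_chart U phi) (mu x) by exists x.
have := stratumP orbit_corner_charts k (orbit_chart_atlas sc) dx.
rewrite (orbit_chart_coord sc Ux) => H; split=> [/H <-//|rk]; apply/H.
exact: srank_uniq r rk.
Qed.

Lemma facet_chart x U rho phi : standard_chart a U rho phi -> U x -> facets Atl (mu x) ->
  exists i, zeros (sqnorms (phi x)) = [set i]%SET /\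
    stab x = rho @^-1` coord_torus (~: [set i]%SET).
Proof.
move=> sc Ux; have dx : dom (orbit_chart U phi) (mu x) by exists x.
move=> fx; have [i zi] := (facetsP orbit_corner_charts (orbit_chart_atlas sc) dx).1 fx.
rewrite (orbit_chart_coord sc) // in zi; exists i; split=> //.
by rewrite (chart_stab sc) // zi.
Qed.

(** In a standard chart an orbit in a facet has exactly one zero coordinate,
    which remains the same for nearby orbits in facets. *)
Lemma stab_locally_constant x : facets Atl (mu x) ->
  \forall o \near mu x, forall y, mu y = o -> facets Atl o -> stab y = stab x.
Proof.
move=> fx; have [U [rho [phi [sc Ux]]]] := lsa x.
have [i [zi ->]] := facet_chart sc Ux fx.
have [oU hc _] := (let: And3 _ h _ := orbit_corner_charts in h) _ (orbit_chart_atlas sc).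
have dx : dom (orbit_chart U phi) (mu x) by exists x.
have h1 : \forall o \near mu x, dom (orbit_chart U phi) o by exact: open_nbhs_nbhs.
have := near_zeros_sub (homeo_on_cvg oU hc dx).
rewrite (orbit_chart_coord sc) // zi; apply: filterS2 h1 => o [z Uz zo] + y yo fo.
have [[_ iU] _ _ _ _] := sc.
have Uy : U y by apply: (invariant_orbit iU); rewrite yo -zo; exists z.
rewrite -yo (orbit_chart_coord sc) //; rewrite -yo in fo.
have [j [-> ->]] := facet_chart sc Uy fo.
by rewrite finset.sub1set inE => /eqP ->.
Qed.

(** The stabilizer is constant along the components of the facets, so that
    [circle_generator] can be tested at a single point. *)
Lemma component_stab x : facets Atl (mu x) ->
  [set u | forall y, connected_component (facets Atl) (mu x) (mu y) -> a u y = y] = stab x.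
Proof.
move=> fx; apply/seteqP; split=> u /=.
  by apply; exact: connected_component_refl.
move=> ux y xy; have sub := @connected_component_sub _ (facets Atl) (mu x).
have e : stab (repr (mu x)) = stab (repr (mu y)).
  apply: (connected_locally_constant (C := connected_component (facets Atl) (mu x))
    (f := fun o => stab (repr o))) => //.
  - exact: component_connected.
  - move=> o Co; have fo : facets Atl (mu (repr o)) by rewrite /orbit_map reprK; exact: sub.
    have := stab_locally_constant fo; rewrite {1}/orbit_map reprK.
    by apply: filterS => o' h Co'; apply: h; [exact: reprK|exact: sub].
  - exact: connected_component_refl.
have rE z : stab (repr (mu z)) = stab z by apply: stab_orbit; exact: reprK.
by move: ux; rewrite -/(stab x u) -rE e rE.
Qed.

Lemma char_bundleP x v : Ch (mu x, v) <->
  facets Atl (mu x) /\ exists w, [/\ primitive_vec (R := R) w,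
    stab x = range (@one_param R n w) & line w v].
Proof.
split=> [[/= fx [w [ew pw] wv]]|[fx [w [pw ew wv]]]].
  by split=> //; exists w; split=> //; rewrite -ew component_stab.
by split=> //; exists w => //; split=> //; rewrite component_stab.
Qed.

Lemma facet_vector x : facets Atl (mu x) -> exists w, primitive_vec (R := R) w /\
  stab x = range (@one_param R n w).
Proof.
move=> fx; have [U [rho [phi [sc Ux]]]] := lsa x.
have [_ _ ra _ _] := sc; have [i [zi ->]] := facet_chart sc Ux fx.
have [v vE] := aut_axis_exists i ra.
by have [-> pv] := aut_axis_primitive ra vE; exists v.
Qed.

Lemma char_fiber x w : facets Atl (mu x) -> primitive_vec (R := R) w ->
  stab x = range (@one_param R n w) -> fiber Ch (mu x) = line w.
Proof.
move=> fx pw ew; apply/seteqP; split=> v; rewrite /fiber /=.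
  move=> /char_bundleP[_ [w' [pw' ew' wv]]].
  by rewrite (@primitive_line R n w w') // -ew -ew'.
by move=> wv; apply/char_bundleP; split=> //; exists w.
Qed.

Lemma char_rank_one : rank_one_subbundle Atl Ch.
Proof.
have rp (o : orbit_space a) : mu (repr o) = o by exact: reprK.
split=> [ |o|o]; first by move=> o v [].
  rewrite -(rp o) => fo; have [w [pw ew]] := facet_vector fo.
  by exists w; [exact: primitive_neq0 pw|exact: char_fiber].
rewrite -(rp o) => fo.
exists (interior [set o' | forall y, mu y = o' -> facets Atl o' -> stab y = stab (repr o)]).
split; [exact: open_interior|exact: stab_locally_constant|].
move=> o' /interior_subset /= h fo'; have [w [pw ew]] := facet_vector fo.
rewrite -(rp o') in fo'; rewrite -(rp o') (char_fiber fo pw ew) (@char_fiber _ w) //.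
by rewrite -ew; apply: h; rewrite ?rp // -(rp o').
Qed.

Lemma orbit_Zgen_facet x : facets Atl (mu x) ->
  [set u | exists v t, Ch (mu x, v) /\ u = one_param v t] = stab x.
Proof.
move=> fx; have [w [pw ew]] := facet_vector fx.
by rewrite ew (fiber_circle (char_fiber fx pw ew)).
Qed.

(** Over the facets the circles of the characteristic bundle are the
    stabilizers, and these are straightened by the automorphism of the
    standard chart. *)
Lemma orbit_nfchart U rho phi : standard_chart a U rho phi ->
  nfchart Atl Ch (mu @` U) (coord (orbit_chart U phi)) rho.
Proof.
move=> sc; have [_ cA2 _] := orbit_corner_charts.
have Ac := orbit_chart_atlas sc; have [od hc im] := cA2 _ Ac.
have [_ _ ra _ _] := sc; split=> // o Uo; split; last first.
  by apply/(stratumP orbit_corner_charts _ Ac).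
apply: (nf_from orbit_corner_charts char_rank_one Ac od _ ra) => // _ i [x Ux <-] zi.
have fx : facets Atl (mu x).
  by apply/(facetsP orbit_corner_charts Ac); [exists x|exists i].
rewrite orbit_Zgen_facet // (chart_stab sc) //.
by rewrite -(orbit_chart_coord sc) // zi.
Qed.

Lemma orbit_good : good Atl Ch.
Proof.
move=> o; have [U [rho [phi [sc Ux]]]] := lsa (repr o).
exists (mu @` U), (coord (orbit_chart U phi)), rho; split; first exact: orbit_nfchart.
by exists (repr o) => //; exact: reprK.
Qed.

Lemma orbit_triv o : exists V (h : X -> model Atl Ch),
  [/\ open V, V o & triv_over a mu V h].
Proof.
have [U [rho [phi [sc Ux]]]] := lsa (repr o).
have nf := orbit_nfchart sc; have [[oU iU] [oV iV] ra hphi e] := sc.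
have [h hP] : exists h : X -> model Atl Ch, triv_over a mu (mu @` U) h.
  apply: (triv_of_chart nf (orbit_map_projection a) (phi := phi)).
  - have -> : nfrange (mu @` U) (coord (orbit_chart U phi)) = phi @` U.
      apply/seteqP; split=> [z [_ [x Ux' <-]]|_ [x Ux' <-]].
        rewrite (orbit_chart_coord sc) // => /esym/polar[u ->].
        by apply: iV; exists x.
      by exists (mu x); [exists x|exact: (orbit_chart_coord sc Ux')].
    by rewrite preimage_orbit.
  - by move=> x /(invariant_orbit iU) Ux'; rewrite (orbit_chart_coord sc).
  - by move=> u x /(invariant_orbit iU) Ux'; exact: e.
exists (mu @` U), h; split=> //; first exact: open_orbit.
by exists (repr o) => //; exact: reprK.
Qed.

Lemma orbit_realizes : compact [set: X] ->
  exists (c : cech Atl Ch) h, realizes a mu (c := c) h.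
Proof.
move=> cX; apply: (realizes_exists (orbit_map_projection a) _ orbit_triv).
have -> : [set: orbit_space a] = mu @` setT.
  by apply/seteqP; split=> // o _; exists (repr o) => //; exact: reprK.
apply: continuous_compact => //.
exact/continuous_subspaceT/orbit_map_continuous.
Qed.
End OrbitSpace.

(** * The classification *)

Lemma compact_hausdorff_homeo (S T : topologicalType) (f : S -> T) :
  compact [set: S] -> hausdorff_space T -> continuous f -> bijective f -> homeo f.
Proof.
move=> cS hT fc [g fg gf]; split=> //; exists g; split=> //.
apply/continuous_closedP => C cC.
have -> : g @^-1` C = f @` C.
  apply/seteqP; split=> [y Cy|_ [x Cx <-]]; last by rewrite /= fg.
  by exists (g y) => //; rewrite gf.
apply: compact_closed => //; apply: continuous_compact.
  exact: continuous_subspaceT.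
exact: (subclosed_compact cC cS).
Qed.

(** An equivariant homeomorphism over the base transports trivializations,
    with the same cocycle. *)
Lemma realizes_comp (R : realType) (n : nat) (X1 X2 B : topologicalType)
    (a1 : torus_action R n X1) (a2 : torus_action R n X2)
    (A : set (chart R n B)) (L : set (B * 'rV[int]_n)) (p1 : X1 -> B) (p2 : X2 -> B)
    (c : cech A L) h (f : X1 -> X2) :
  orbit_projection a1 p1 -> orbit_projection a2 p2 ->
  homeo f -> (forall u x, f (a1 u x) = a2 u (f x)) -> (forall x, p2 (f x) = p1 x) ->
  realizes a2 p2 (c := c) h -> realizes a1 p1 (c := c) (fun i => h i \o f).
Proof.
move=> P1 P2 [fc [g [gc fg gf]]] fa fp [hc tr E]; split=> // [i|i j x Ui Uj]; last first.
  by rewrite /= (E i j) ?fp.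
have oU := cocycle_open i hc; have [hh hp ha] := tr i.
have [k [k1 k2]] := triv_inv P2 oU (tr i).
split=> [|x Ux|u x Ux] /=.
- apply: (@homeo_onI _ _ _ _ _ (g \o k)).
  + exact: (open_over_base P1).
  + exact: open_over_model.
  + move=> x Ux /=; have Ux' : cech_cover c i (p2 (f x)) by rewrite fp.
    have [kx hcx] := k1 _ Ux'; split; [by rewrite hp|by rewrite kx fg|].
    exact: (cvg_comp f (h i) (fc x) hcx).
  + move=> q Uq; have [kp hk kc] := k2 _ Uq; split.
    * by rewrite /= -fp gf kp.
    * by rewrite /= gf hk.
    * exact: (cvg_comp k g kc (gc _)).
- by rewrite hp ?fp.
- by rewrite fa ha ?fp.
Qed.

Lemma orbit_facetsP (R : realType) (n : nat) (X : topologicalType)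
    (a : torus_action R n X) (x : X) : locally_standard a ->
  facets (orbit_atlas a) (orbit_map a x) <-> exists2 k, k.+1 = n & srank (stab a x) k.
Proof. by move=> lsa; split=> -[k kn h]; exists k => //; apply/(orbit_stratumP lsa). Qed.

(** The strata of the orbit space are described by the ranks of the
    stabilizers, and a bijection can be tested on ranks. *)
Lemma orbit_stratified (R : realType) (n : nat) (X B : topologicalType)
    (a : torus_action R n X) (A : set (chart R n B)) (g : orbit_space a -> B) :
  locally_standard a -> homeo g ->
  (forall x k, stratum A k (g (orbit_map a x)) <-> srank (stab a x) k) ->
  stratified_homeo (orbit_atlas a) A g.
Proof.
move=> lsa hg H; split=> // k; have [_ [h [_ gh hg']]] := hg.
have rp o : orbit_map a (repr o) = o by exact: reprK.
apply/seteqP; split=> [_ [y + <-]|b].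
  by rewrite -(rp y) => /(orbit_stratumP lsa) r; apply/H.
rewrite -{1}(hg' b) -(rp (h b)) => /H r; exists (h b) => //.
by rewrite -(rp (h b)); apply/(orbit_stratumP lsa).
Qed.

Section Classification.
Context {R : realType} {n : nat} {X1 X2 : topologicalType}.
Context (a1 : torus_action R n X1) (a2 : torus_action R n X2).
Context (ls1 : locally_standard a1) (ls2 : locally_standard a2).
Context (cX1 : compact [set: X1]) (cX2 : compact [set: X2]) (hX2 : hausdorff_space X2).
Local Notation mu1 := (orbit_map a1).
Local Notation mu2 := (orbit_map a2).

Lemma equivariant_pair (f : X1 -> X2) : homeo f ->
  (forall u x, f (a1 u x) = a2 u (f x)) ->
  exists fB : orbit_space a1 -> orbit_space a2,
    [/\ stratified_homeo (orbit_atlas a1) (orbit_atlas a2) fB,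
        bundle_image fB (char_bundle a1) = char_bundle a2 &
        forall x, fB (mu1 x) = mu2 (f x)].
Proof.
move=> hf fa; have [fc [g [gc fg gf]]] := hf.
have ga u y : g (a2 u y) = a1 u (g y) by rewrite -{1}(gf y) -fa fg.
pose fB (o : orbit_space a1) := mu2 (f (repr o)).
pose gB (o : orbit_space a2) := mu1 (g (repr o)).
have r1 (o : orbit_space a1) : mu1 (repr o) = o by exact: reprK.
have r2 (o : orbit_space a2) : mu2 (repr o) = o by exact: reprK.
have fE x : fB (mu1 x) = mu2 (f x).
  have /orbit_mapP[u uE] := r1 (mu1 x).
  by rewrite /fB [in RHS]uE fa orbit_map_act.
have gE y : gB (mu2 y) = mu1 (g y).
  have /orbit_mapP[u uE] := r2 (mu2 y).
  by rewrite /gB [in RHS]uE ga orbit_map_act.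
have st x : stab a2 (f x) = stab a1 x.
  apply/seteqP; split=> u; rewrite /stab /= -fa; last by move=> ->.
  by move/(can_inj fg).
have hB : homeo fB.
  split.
    apply: orbit_continuous => x; rewrite (_ : fB \o mu1 = mu2 \o f); last exact/funext.
    exact: (cvg_comp f mu2 (fc x) (@orbit_map_continuous R n X2 a2 _)).
  exists gB; split.
  - apply: orbit_continuous => y; rewrite (_ : gB \o mu2 = mu1 \o g); last exact/funext.
    exact: (cvg_comp g mu1 (gc y) (@orbit_map_continuous R n X1 a1 _)).
  - by move=> o; rewrite -(r1 o) fE gE fg.
  - by move=> o; rewrite -(r2 o) gE fE gf.
exists fB; split=> //.
  apply: orbit_stratified => // x k; rewrite fE.
  by rewrite -st; exact: (orbit_stratumP ls2).
have ch x v : char_bundle a1 (mu1 x, v) <-> char_bundle a2 (mu2 (f x), v).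
  have h1 := char_bundleP ls1 x v; have h2 := char_bundleP ls2 (f x) v.
  have f1 := orbit_facetsP x ls1; have f2 := orbit_facetsP (f x) ls2.
  rewrite st in h2 f2; split=> [/h1[/f1 fx w]|/h2[/f2 fx w]].
    by apply/h2; split=> //; apply/f2.
  by apply/h1; split=> //; apply/f1.
apply/seteqP; split=> [_ [[y v] + <-]|[y v]] /=.
  by rewrite -(r1 y) fE => /ch.
move=> h; exists (mu1 (g (repr y)), v) => /=; last by rewrite fE gf r2.
by apply/ch; rewrite gf r2.
Qed.

Lemma pair_iso_sym (B1 B2 : topologicalType)
    (A1 : set (chart R n B1)) (L1 : set (B1 * 'rV[int]_n))
    (A2 : set (chart R n B2)) (L2 : set (B2 * 'rV[int]_n)) f g :
  pair_iso A1 L1 A2 L2 f g -> pair_iso A2 L2 A1 L1 g f.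
Proof. by move=> [fc gc fg gf Z]; split=> // b; rewrite Z gf. Qed.

(** A homeomorphism makes [X1] realize the cocycles of [X2] over the orbit
    space of [X2]. Conversely, when [X2] is viewed over the orbit space of
    [X1], equal Euler classes make the cocycles cohomologous, and
    [realizes_map] gives an equivariant continuous bijection, which is a
    homeomorphism by compactness. *)
Lemma classification :
  (exists f : X1 -> X2, homeo f /\ forall u x, f (a1 u x) = a2 u (f x)) <->
  exists fB : orbit_space a1 -> orbit_space a2,
    [/\ stratified_homeo (orbit_atlas a1) (orbit_atlas a2) fB,
        bundle_image fB (char_bundle a1) = char_bundle a2 &
        pull_class fB (euler_class a2) = euler_class a1].
Proof.
have gd1 := orbit_good ls1; have gd2 := orbit_good ls2.
have P1 := orbit_map_projection a1; have P2 := orbit_map_projection a2.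
have [c2 [h2 hr2]] := orbit_realizes ls2 cX2.
have iso fB : stratified_homeo (orbit_atlas a1) (orbit_atlas a2) fB ->
    bundle_image fB (char_bundle a1) = char_bundle a2 -> exists gB,
    pair_iso (orbit_atlas a1) (char_bundle a1) (orbit_atlas a2) (char_bundle a2) fB gB.
  move=> [hB _]; exact: (pair_isoP (orbit_corner_charts ls1) (char_rank_one ls1)
    (orbit_corner_charts ls2) (char_rank_one ls2) hB).
rewrite (euler_class_eq gd2 hr2); split=> [[f [hf fa]]|[fB [sB LB eB]]].
  have [fB [sB LB fE]] := equivariant_pair hf fa; have [gB iB] := iso _ sB LB.
  exists fB; split=> //; apply: (euler_pull gd1 iB (h := fun i => h2 i \o f)).
  apply: (realizes_comp (orbit_projection_comp iB P1) P2 hf fa _ hr2) => x /=.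
  by rewrite fE.
have [gB iB] := iso _ sB LB; have [_ _ fg gf _] := iB.
have [hc2 _ _] := hr2.
have [c1 [h1 hr1]] := orbit_realizes ls1 cX1; have [hc1 _ _] := hr1.
have P2' := orbit_projection_comp (pair_iso_sym iB) P2.
have hr2' : realizes a2 (fB \o (gB \o mu2)) (c := c2) h2.
  by rewrite (_ : fB \o (gB \o mu2) = mu2) //; apply/funext => y /=; rewrite gf.
have hr3 := realizes_pull iB P2' hr2'.
have [hc3 _ _] := hr3.
have coh : cohomologous c1 (pull_cech (orbit_atlas a1) (char_bundle a1) fB c2).
  apply: (cohomologous_sym gd1) => //.
  have : euler_class a1 c1 by rewrite (euler_class_eq gd1 hr1); exact: cech_class_id.
  by rewrite -eB (pull_cech_class gd1 iB hc2) => -[].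
have [f [fc fb _ fa]] := realizes_map gd1 P1 P2' hr1 hr3 coh.
by exists f; split=> //; exact: compact_hausdorff_homeo.
Qed.
End Classification.

(** * Normal forms of characteristic pairs *)

Section Lattice.

(** The right inverse forces the elementary divisors in the Smith normal form
    to be units, so that they can be absorbed into an invertible factor. *)
Lemma unimodular_completion (m k : nat) (V : 'M[int]_(m, m + k)) (Q : 'M[int]_(m + k, m)) :
  V *m Q = 1%:M -> exists2 H : 'M[int]_(m + k), H \in unitmx & V = row_mx 1%:M 0 *m H.
Proof.
have [L Lu [Rm Ru [d _ VE]]] := int_Smith_normal_form V.
pose D : 'M[int]_m := diag_mx (\row_i d`_i).
have dE : (\matrix_(i < m, j < m + k) (d`_i *+ (i == j :> nat))) = D *m row_mx 1%:M 0.
  rewrite mul_mx_row mulmx1 mulmx0; apply/matrixP => i j.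
  rewrite -[j]splitK; case: (fintype.split j) => l /=.
    by rewrite row_mxEl !mxE /=.
  rewrite row_mxEr !mxE /=; case: eqP => // il.
  by have := ltn_ord i; rewrite il ltnNge leq_addr.
move=> VQ; have Lu' : L *m D \in unitmx.
  have : (L *m D) *m (row_mx 1%:M 0 *m Rm *m Q) = 1%:M.
    by rewrite -[RHS]VQ VE dE !mulmxA.
  by move=> /mulmx1_unit[].
exists (block_mx (L *m D) 0 0 1%:M *m Rm).
  rewrite unitmx_mul Ru andbT unitmxE det_ublock det1 mulr1.
  by rewrite -unitmxE.
rewrite mulmxA mul_row_block !mul1mx !mul0mx !addr0 VE dE.
by rewrite -!mulmxA (mulmxA _ (row_mx _ _) Rm) mul_mx_row !mulmxA mul_mx_row mulmx1 !mulmx0.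
Qed.

Lemma basis_change (m n : nat) (V W : 'M[int]_(m, n)) (Q P : 'M[int]_(n, m)) :
  (m <= n)%N -> V *m Q = 1%:M -> W *m P = 1%:M ->
  exists2 G : 'M[int]_n, G \in unitmx & V *m G = W.
Proof.
move=> mn; have [k kE] : exists k, n = (m + k)%N by exists (n - m)%N; rewrite subnKC.
subst n => /unimodular_completion[H Hu ->] /unimodular_completion[K Ku ->].
exists (invmx H *m K); first by rewrite unitmx_mul unitmx_inv Hu.
by rewrite mulmxA mulmxK.
Qed.

Context {n : nat}.
Local Notation Lambda := 'rV[int]_n.

Lemma lattice_sum_lineP (m : nat) (v : 'I_m -> Lambda) w :
  lattice_sum (fun i => line (v i)) w <->
  exists z : 'rV[int]_m, w = z *m \matrix_i v i.
Proof.
have mE (z : 'rV[int]_m) : z *m (\matrix_i v i) = \sum_i z 0 i *: v i.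
  by rewrite mulmx_sum_row; apply: eq_bigr => i _; rewrite rowK.
split=> [[w' w'P <-]|[z ->]].
  have [z zP] := choice (fun i =>
    let: ex_intro2 z _ e := w'P i in ex_intro (fun z => z *: v i = w' i) z e).
  by exists (\row_i z i); rewrite mE; apply: eq_bigr => i _; rewrite mxE zP.
by exists (fun i => z 0 i *: v i); [move=> i; exists (z 0 i)|rewrite mE].
Qed.

(** The coordinates, in the basis [v], of the projection onto the summand
    along its complement; a generating family of as many vectors as the rank
    is a basis. *)
Lemma summand_right_inverse (m : nat) (v : 'I_m -> Lambda) :
  has_rank m (lattice_sum (fun i => line (v i))) ->
  direct_summand (lattice_sum (fun i => line (v i))) ->
  exists Q : 'M[int]_(n, m), (\matrix_i v i) *m Q = 1%:M.
Proof.
set M := lattice_sum _; set V := \matrix_i v i => -[e [ME eI]] [N [N0 NB NM]].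
have MP w : M w <-> exists z : 'rV[int]_m, w = z *m V by exact: lattice_sum_lineP.
pose E := \matrix_i e i.
have MP' w : M w <-> exists z : 'rV[int]_m, w = z *m E.
  by rewrite ME; exact: lattice_sum_lineP.
have EI (z : 'rV[int]_m) : z *m E = 0 -> z = 0.
  move=> zE; apply/rowP => i; rewrite mxE; apply: eI i.
  by rewrite -[RHS]zE mulmx_sum_row; apply: eq_bigr => i _; rewrite rowK.
have EI' (p : nat) (Z : 'M[int]_(p, m)) : Z *m E = 0 -> Z = 0.
  move=> ZE; apply/row_matrixP => i; rewrite row0; apply: EI.
  by rewrite -row_mul ZE row0.
have lift (p : nat) (W : 'M[int]_(p, n)) (Y : 'M[int]_(m, n)) :
    (forall i, exists z : 'rV[int]_m, row i W = z *m Y) -> exists Z : 'M[int]_(p, m), W = Z *m Y.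
  move=> H; have [z zP] := choice H; exists (\matrix_i z i).
  by apply/row_matrixP => i; rewrite row_mul rowK zP.
have [C CE] : exists C : 'M[int]_m, E = C *m V.
  apply: lift => i; apply/MP/MP'; exists (delta_mx 0 i); exact: rowE.
have [C' C'E] : exists C : 'M[int]_m, V = C *m E.
  apply: lift => i; apply/MP'/MP; exists (delta_mx 0 i); exact: rowE.
have CC' : C *m C' = 1%:M.
  by apply/eqP; rewrite -subr_eq0; apply/eqP/EI'; rewrite mulmxBl mul1mx -mulmxA -C'E -CE subrr.
have VI (p : nat) (Z : 'M[int]_(p, m)) : Z *m V = 0 -> Z = 0.
  rewrite C'E mulmxA => /EI' h.
  by rewrite -[Z]mulmx1 -(mulmx1C CC') mulmxA h mul0mx.
(* the projection onto M along N *)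
have [pr prP] := choice (fun w => let: ex_intro p (conj h _) := NM w in
   ex_intro (fun p : Lambda * Lambda => [/\ M p.1, N p.2 & w = p.1 + p.2]) p h).
have pr_uniq w x y : M x -> N y -> w = x + y -> (pr w).1 = x.
  move=> Mx Ny wE; have [p [_ pu]] := NM w.
  by rewrite -(pu _ (prP w)) (pu (x, y)).
have MD x y : M x -> M y -> M (x + y).
  by move=> /MP[z ->] /MP[z' ->]; apply/MP; exists (z + z'); rewrite mulmxDl.
have MZ (k : int) x : M x -> M (k *: x).
  by move=> /MP[z ->]; apply/MP; exists (k *: z); rewrite scalemxAl.
have NN x : N x -> N (- x) by move=> Nx; rewrite -sub0r; exact: NB.
have ND x y : N x -> N y -> N (x + y).
  by move=> Nx Ny; rewrite -[y]opprK; apply: NB => //; exact: NN.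
have NMn (k : nat) x : N x -> N (x *+ k).
  by move=> Nx; elim: k => [|k IH]; rewrite ?mulr0n // mulrS; exact: ND.
have NZ (k : int) x : N x -> N (k *: x).
  move=> Nx; rewrite -[k]intz scaler_int; case: k => k; first exact: NMn.
  by rewrite NegzE mulrNz; apply/NN/NMn.
have [Q QE] : exists Q : 'M[int]_(n, m), \matrix_j (pr (delta_mx 0 j)).1 = Q *m V.
  by apply: lift => j; rewrite rowK; apply/MP; case: (prP (delta_mx 0 j)).
exists Q; apply/eqP; rewrite -subr_eq0; apply/eqP/VI.
rewrite mulmxBl mul1mx -mulmxA -QE; apply/row_matrixP => i.
rewrite row0 linearB /= row_mul rowK; set x := v i.
pose pm := \matrix_j (pr (delta_mx 0 j)).1.
pose pn := \matrix_j (pr (delta_mx 0 j)).2.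
have xE : x = x *m pm + x *m pn.
  rewrite -mulmxDr -[LHS]mulmx1; congr (_ *m _); apply/row_matrixP => j.
  rewrite linearD /= !rowK row1; by case: (prP (delta_mx 0 j)).
have sumP (P : set Lambda) (Y : 'M[int]_n) : P 0 -> (forall y z, P y -> P z -> P (y + z)) ->
    (forall (k : int) y, P y -> P (k *: y)) -> (forall j, P (row j Y)) -> P (x *m Y).
  move=> P0 PD PZ PY; rewrite mulmx_sum_row; apply: (big_ind P) => // j _.
  exact: PZ.
have Mx : M x by apply/MP; exists (delta_mx 0 i); rewrite -rowE rowK.
have M0 : M 0 by apply/MP; exists 0; rewrite mul0mx.
have Mp : M (x *m pm).
  by apply: sumP => // j; rewrite rowK; case: (prP (delta_mx 0 j)).
have Np : N (x *m pn).
  by apply: sumP => // j; rewrite rowK; case: (prP (delta_mx 0 j)).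
have e1 := pr_uniq _ _ _ Mp Np xE.
have e2 := pr_uniq x x 0 Mx N0 (esym (addr0 x)).
by rewrite -/pm -e1 e2 subrr.
Qed.
End Lattice.

Section MatrixAutomorphism.
Context {R : realType} {n : nat}.
Local Notation C := R[i].
Local Notation T := (torus R n).

Lemma cvgC_exprz (I : Type) (F : set_system I) (f : I -> C) (a : C) (z : int) : Filter F ->
  a != 0 -> f @ F --> a -> (fun x => f x ^ z) @ F --> a ^ z.
Proof.
move=> FF a0 fa.
have H (k : nat) : (fun x => f x ^+ k) @ F --> a ^+ k.
  elim: k => [|k IH]; first by rewrite expr0; under eq_fun do rewrite expr0; exact: cvg_cst.
  by rewrite exprS; under eq_fun do rewrite exprS; exact: cvgCM.
case: z => k; first exact: H.
by rewrite /exprz; apply: cvgCV; [rewrite expf_neq0|exact: H].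
Qed.

Lemma cvgC_prod (I J : Type) (F : set_system I) (s : seq J) (f : J -> I -> C) (a : J -> C) :
  Filter F -> (forall j, f j @ F --> a j) ->
  (fun x => \prod_(j <- s) f j x) @ F --> \prod_(j <- s) a j.
Proof.
move=> FF fa; elim: s => [|j s IH].
  by rewrite big_nil; under eq_fun do rewrite big_nil; exact: cvg_cst.
rewrite (_ : (fun _ => _) = fun x => f j x * \prod_(j <- s) f j x); last first.
  by apply/funext => x; rewrite big_cons.
rewrite big_cons.
have := @cvgCM R I F (f j) (fun x => \prod_(j <- s) f j x) (a j) (\prod_(j <- s) a j) FF (fa j) IH.
exact.
Qed.

Lemma cis_exprz (t : R) (z : int) : cis t ^ z = cis (t * z%:~R).
Proof.
have H (k : nat) : cis t ^+ k = cis (t * k%:R).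
  elim: k => [|k IH]; first by rewrite expr0 mulr0 cis0.
  by rewrite exprSr IH -[k.+1%:R]natr1 mulrDr mulr1 cisD.
case: z => k; first exact: H.
by rewrite NegzE mulrNz mulrN cisN -exprnN H.
Qed.

Lemma cis_sum (J : Type) (s : seq J) (t : J -> R) :
  \prod_(j <- s) cis (t j) = cis (\sum_(j <- s) t j).
Proof.
elim: s => [|j s IH]; first by rewrite !big_nil cis0.
by rewrite !big_cons IH cisD.
Qed.

Lemma tmat_norm (G : 'M[int]_n) (u : T) i : `|\prod_j tcoord u j ^ (G j i)| = 1.
Proof.
have [t _ ->] := texp_surj u.
under eq_bigr do rewrite texp_coord cis_exprz.
by rewrite cis_sum norm_cis.
Qed.

(** The endomorphism of the torus with differential [G]. *)
Definition tmat (G : 'M[int]_n) (u : T) : T := torus_of (tmat_norm G u).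

Lemma tmat_texp G (t : 'rV[R]_n) : tmat G (texp t) = texp (t *m map_mx intr G).
Proof.
apply: torus_ext => i; rewrite tcoord_of texp_coord.
under eq_bigr do rewrite texp_coord cis_exprz.
rewrite cis_sum; congr cis; rewrite !mxE mulr_sumr; apply: eq_bigr => j _.
by rewrite !mxE mulrA.
Qed.

Lemma tmat_continuous G : continuous (tmat G).
Proof.
move=> u; apply: (cvg_torus (F := nbhs u)) => i; rewrite tcoord_of.
under eq_fun do rewrite tcoord_of.
apply: cvgC_prod => j; apply: cvgC_exprz; first exact: tcoord_neq0.
exact: tcoord_continuous.
Qed.

Lemma tmatM G G' u : tmat G' (tmat G u) = tmat (G *m G') u.
Proof. by have [t _ ->] := texp_surj u; rewrite !tmat_texp map_mxM mulmxA. Qed.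

Lemma tmat1 u : tmat 1%:M u = u.
Proof. by have [t _ ->] := texp_surj u; rewrite tmat_texp map_mx1 mulmx1. Qed.

Lemma tmat_aut G : G \in unitmx -> torus_aut (tmat G).
Proof.
move=> Gu; split.
  move=> u v; have [s _ ->] := texp_surj u; have [t _ ->] := texp_surj v.
  by rewrite -texpD !tmat_texp mulmxDl texpD.
split; first exact: tmat_continuous.
exists (tmat (invmx G)); split; first exact: tmat_continuous.
  by move=> u; rewrite tmatM mulmxV // tmat1.
by move=> u; rewrite tmatM mulVmx // tmat1.
Qed.

Lemma tmat_one_param G v (t : R) : tmat G (one_param v t) = one_param (v *m G) t.
Proof. by rewrite /one_param tmat_texp map_mxM scalemxAl. Qed.
End MatrixAutomorphism.

Section CharacteristicPairs.
Context {R : realType} {n : nat} {B : topologicalType}.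
Context {A : set (chart R n B)} (cA : corner_charts A).
Context {L : set (B * 'rV[int]_n)} (cL : characteristic_pair A L).

(** By unimodularity the matrix of generators of the fibers adjacent to [b]
    has a right inverse, as has the matrix of the axis vectors of the
    corresponding facets; a change of basis of the lattice takes one to the
    other. *)
Lemma char_pair_chart b : exists c U rho, [/\ A c, open U /\ U b, U `<=` dom c, torus_aut rho &
  forall x i, U x -> zeros (coord c x) = [set i]%SET ->
    exists w, fiber L x = line w /\ forall t : R, rho (one_param w t) = one_param (axis i) t].
Proof.
have [rL uL] := cL; have [/(_ b)[c Ac cb] _ _] := cA.
have [U [F [e [lf UV Uz FE [einj eS esurj]]]]] := box_chart cA Ac cb openT I.
have [oU Ub _ _ Fcl] := lf.
have sb : stratum A (nonzeros (coord c b)) b by apply/(stratumP cA _ Ac cb).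
have FL l : exists w, forall x, F l x -> fiber L x = line w.
  have [x0 [Fx0 _]] := Fcl l setT filterT.
  have Ff x : F l x -> facets A x by move=> /(local_facets_sub lf)[].
  have [_ L2 _] := rL; have [w _ wE] := L2 _ (Ff _ Fx0); exists w => x Fx.
  have Cl : connected (F l) by exact: local_facets_connected lf.
  by rewrite -wE; exact: (fiber_constant rL Cl Ff).
have [w wP] := choice FL.
have [hr hs] := uL _ _ _ _ (fun l => line (w l)) sb lf wP.
have [Q QE] := summand_right_inverse hr hs.
pose W : 'M[int]_(n - nonzeros (coord c b), n) := \matrix_l axis (e l).
have WP : W *m W^T = 1%:M.
  apply/matrixP => l m; rewrite !mxE (bigD1 (e l)) //= big1 => [|j jl]; rewrite !mxE ?eqxx /=.
    by rewrite addr0 mul1r (inj_eq einj).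
  by rewrite (negbTE jl) mul0r.
have [G Gu GE] := basis_change (leq_subr _ _) QE WP.
exists c, U, (tmat G); split=> //; [by move=> x /UV[]|exact: tmat_aut|].
move=> x i Ux zx; have iS : i \in zeros (coord c b).
  by have := Uz x Ux; rewrite zx finset.sub1set.
have [l li] := esurj i iS; exists (w l); split.
  by apply: wP; apply/FE; rewrite li.
move=> t; rewrite tmat_one_param -li.
by have := congr1 (row l) GE; rewrite row_mul !rowK => ->.
Qed.

Lemma char_pair_good : good A L.
Proof.
move=> b; have [c [U [rho [Ac [oU Ub] Uc ra H]]]] := char_pair_chart b.
have [rL _] := cL; have [_ cA2 _] := cA; have [od hc im] := cA2 _ Ac.
have [hU im'] := homeo_on_sub od hc im oU Uc.
exists U, (coord c), rho; split=> //; split=> // x Ux; split; last first.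
  by apply/(stratumP cA _ Ac (Uc _ Ux)).
apply: (nf_from cA rL Ac oU Uc ra) => // y i Uy zy.
have [w [wE rw]] := H y i Uy zy.
by rewrite (fiber_circle wE) (aut_axis_primitive ra rw).1.
Qed.

Lemma char_pair_facet b : facets A b -> exists w,
  [/\ primitive_vec (R := R) w, fiber L b = line w & Zsub A L b = range (@one_param R n w)].
Proof.
move=> fb; have [c [U [rho [Ac [oU Ub] Uc ra H]]]] := char_pair_chart b.
have [rL _] := cL; have cb := Uc _ Ub.
have [i zi] := (facetsP cA Ac cb).1 fb; have [w [wE rw]] := H b i Ub zi.
have [e pw] := aut_axis_primitive ra rw; exists w; split=> //.
rewrite -e -zi; apply: (nf_from cA rL Ac oU Uc ra) => // y j Uy zy.
have [w' [wE' rw']] := H y j Uy zy.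
by rewrite (fiber_circle wE') (aut_axis_primitive ra rw').1.
Qed.
End CharacteristicPairs.

(** * Spaces that realize a cocycle *)

Section Realification.
Context {R : realType} {n : nat}.
Local Notation Cn := 'rV[R[i]]_n.

Let dimE : (2 * n = n + n)%N := etrans (mul2n n) (esym (addnn n)).

Definition realify (z : Cn) : 'rV[R]_(2 * n) :=
  \row_j match fintype.split (cast_ord dimE j) with
         | inl i => complex.Re (z ord0 i) | inr i => complex.Im (z ord0 i) end.

Definition complexify (w : 'rV[R]_(2 * n)) : Cn :=
  \row_i (w ord0 (cast_ord (esym dimE) (lshift n i)) +i*
          w ord0 (cast_ord (esym dimE) (rshift n i)))%C.

Lemma realifyK : cancel realify complexify.
Proof.
move=> z; apply/rowP => i; rewrite !mxE !cast_ordKV.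
rewrite -[lshift n i]/(fintype.unsplit (inl i)) -[rshift n i]/(fintype.unsplit (inr i)).
by rewrite !unsplitK; case: (z ord0 i).
Qed.

Lemma complexifyK : cancel complexify realify.
Proof.
move=> w; apply/rowP => j; rewrite mxE -[in RHS](cast_ordK dimE j).
rewrite -[in RHS](splitK (cast_ord dimE j)).
by case: (fintype.split _) => i; rewrite mxE.
Qed.

Lemma realify_continuous : continuous realify.
Proof.
move=> z; apply: (cvg_rV (F := nbhs z)) => j; rewrite mxE; under eq_fun do rewrite mxE.
case: (fintype.split _) => i.
  exact: (cvg_comp (fun w : Cn => w ord0 i) (@complex.Re R)
  (@rV_coord_continuous _ n i z) (@Re_continuous R _)).
exact: (cvg_comp (fun w : Cn => w ord0 i) (@complex.Im R)
  (@rV_coord_continuous _ n i z) (@Im_continuous R _)).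
Qed.

Lemma complexify_continuous : continuous complexify.
Proof.
move=> w; apply: (cvg_rV (F := nbhs w)) => i; rewrite mxE; under eq_fun do rewrite mxE.
by apply: cvg_complex; exact: rV_coord_continuous.
Qed.
End Realification.

Section Realizations.
Context {R : realType} {n : nat} {X B : topologicalType}.
Context {A : set (chart R n B)} (cA : corner_charts A).
Context {L : set (B * 'rV[int]_n)} (cL : characteristic_pair A L).
Context (a : torus_action R n X) (p : X -> B) (P : orbit_projection a p).
Context (c : cech A L) (h : cech_idx c -> X -> model A L) (hr : realizes a p (c := c) h).
Local Notation T := (torus R n).
Local Notation mu := (orbit_map a).
Local Notation cls := (@mclass R n B A L).

Let gd : good A L := char_pair_good cA cL.

(** The trivialization [h j] followed by the chart [nfmap] of the model. *)
Lemma realized_chart b : exists V rho phi, [/\ open V, V b & standard_chart a (p @^-1` V) rho phi].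
Proof.
have [hc tr _] := hr; have [oc cc _ _] := hc.
have [j Ujb] := cc b; have [V0 [xi [rho [nf0 V0b]]]] := gd b.
have [oV0 _ _ _ _] := nf0.
pose V := V0 `&` cech_cover c j.
have oV : open V by exact: openI.
have nf : nfchart A L V xi rho by apply: nfchart_sub nf0 oV _ => x [].
have [_ hp ha] := tr j; have [k [k1 k2]] := triv_inv P (oc j) (tr j).
have oU := open_over_base P oV.
have [l [l1 l2]] := homeo_onE (open_over_model oV) (open_nfrange nf) (nfmap_homeo nf).
pose phi x := nfmap xi rho (h j x).
have Vh x : V (p x) -> V (mproj (h j x)) by move=> Vx; rewrite hp //; case: Vx.
have hphi : homeo_on (p @^-1` V) (nfrange V xi) phi.
  apply: (@homeo_onI _ _ _ _ _ (k \o l)) => //; first exact: open_nfrange nf.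
    move=> x Vx; have [zr lh nc] := l1 _ (Vh x Vx); have [kh hcx] := k1 x (Vx.2).
    split=> //; first by rewrite /= lh kh.
    exact: (cvg_comp (h j) (nfmap xi rho) hcx nc).
  move=> z zr; have [Vl lz lc] := l2 z zr; have [pk hk kc] := k2 (l z) Vl.2.
  split; first by rewrite /= pk.
    by rewrite /phi /= hk.
  exact: (cvg_comp l k lc kc).
have imE : phi @` (p @^-1` V) = nfrange V xi.
  have [[fB _ sB] _ _] := hphi.
  by apply/seteqP; split=> [_ [x Vx <-]|]; [exact: fB|exact: sB].
exists V, rho, phi; split=> //; split; rewrite ?imE //.
- by split=> // u x; rewrite /= (let: And4 _ _ h _ := P in h).
- by split; [exact: open_nfrange nf|exact: nfrange_invariant].
- by have [_ _ _ ra _] := nf.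
- move=> u x Vx; rewrite /phi ha; last by case: Vx.
  by apply: (nfmap_mact nf); exact: Vh.
Qed.

Lemma realized_locally_standard : locally_standard a.
Proof.
by move=> x; have [V [rho [phi [oV Vx sc]]]] := realized_chart (p x); exists (p @^-1` V), rho, phi.
Qed.

Lemma realized_hausdorff : hausdorff_space B -> hausdorff_space X.
Proof.
rewrite !open_hausdorff => hB x y xy.
have [e|/eqP ne] := pselect (p x = p y); last first.
  have [[U W] /= [/set_mem Ux /set_mem Wy] [oU oW /eqP UW]] := hB _ _ ne.
  exists (p @^-1` U, p @^-1` W) => /=; first by rewrite !inE.
  split; [exact: (open_over_base P oU)|exact: (open_over_base P oW)|].
  by rewrite -preimage_setI UW preimage_set0.
have [V [rho [phi [oV Vx [[oU _] _ _ hphi _]]]]] := realized_chart (p x).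
have Vy : V (p y) by rewrite -e.
have ne : phi x != phi y.
  apply: contra xy => /eqP h'; apply/eqP; have [[_ inj _] _ _] := hphi.
  by apply: inj; rewrite ?inE.
have := @hausdorff_rVC R n; rewrite open_hausdorff => /(_ _ _ ne).
move=> [[U W] /= [/set_mem Ux /set_mem Wy] [oU' oW' /eqP UW]].
have op D : open D -> open [set z | V (p z) /\ D (phi z)].
  move=> oD; apply: near_open => z [Vz Dz].
  have h1 : \forall w \near z, V (p w) by exact: (open_nbhs_nbhs (conj oU Vz)).
  have h2 : \forall w \near z, D (phi w).
    by apply: (homeo_on_cvg oU hphi Vz); exact: open_nbhs_nbhs.
  by apply: filterS2 h1 h2.
exists ([set z | V (p z) /\ U (phi z)], [set z | V (p z) /\ W (phi z)]) => /=.
  by rewrite !inE.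
split; [exact: op|exact: op|].
apply/eqP/seteqP; split=> // z [[_ Uz] [_ Wz]].
by have : (U `&` W) (phi z) by []; rewrite UW.
Qed.

(** Near a point [b] of the base, the space is the image of the compact torus
    under [u |-> k (cls b' u)], where [k] is the inverse of a trivialization:
    whatever holds near all points over [b] holds over a neighborhood of [b]. *)
Lemma realized_compact : compact [set: B] -> compact [set: X].
Proof.
have [hc tr _] := hr; have [oc cc _ _] := hc.
move=> /compact_near_coveringP cB; apply/compact_near_coveringP => I F Q FF HQ.
suff hB b : [set: B] b -> \forall b' \near b & i \near F, forall x, p x = b' -> Q i x.
  have := cB I F (fun i b => forall x, p x = b -> Q i x) FF hB.
  by apply: filterS => i h' x _; exact: (h' (p x) Logic.I x).
move=> _.
have [j Ujb] := cc b; have [_ hp _] := tr j.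
have [k [k1 k2]] := triv_inv P (oc j) (tr j).
have /compact_near_coveringP cT := @compact_torus R n.
have [u _|[N D] /= [nN FD] ND] :=
    cT (B * I)%type (filter_prod (nbhs b) F) (fun bi u => Q bi.2 (k (cls bi.1 u))) _.
  have [[N D] /= [nN FD] ND] := HQ (k (cls b u)) Logic.I.
  have /k2[_ _ kc] : cech_cover c j (mproj (cls b u)) by rewrite mproj_class.
  have cc' : (fun r : B * T => k (cls r.1 r.2)) @ (b, u) --> k (cls b u).
    exact: (cvg_comp (fun r : B * T => cls r.1 r.2) k (@mclass_continuous R n B A L (b, u)) kc).
  have [[E1 E2] /= [nE1 nE2] E12] := cc' _ nN.
  exists (E2, E1 `*` D) => /=; first by split=> //; exists (E1, D).
  move=> [u' [b' i]] /= [E2u [E1b Di]].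
  exact: (ND (k (cls b' u'), i) (conj (E12 (b', u') (conj E1b E2u)) Di)).
exists (N `&` cech_cover c j, D) => /=.
  by split=> //; apply: filterI => //; exact: open_nbhs_nbhs.
move=> [b' i] /= [[Nb Ujb'] Di] x xb.
have Ujx : cech_cover c j (p x) by rewrite xb.
have [kx _] := k1 x Ujx; have [u uE] := mclass_at (hp x Ujx).
rewrite -kx uE xb; exact: (ND (b', i) (conj Nb Di) u).
Qed.

Lemma realized_manifold : hausdorff_space B -> compact [set: B] ->
  compact_manifold R (2 * n) X.
Proof.
move=> hB cB; split; [exact: realized_hausdorff|exact: realized_compact|move=> x].
have [V [rho [phi [oV Vx [[oU _] [oD _] _ hphi _]]]]] := realized_chart (p x).
set U := p @^-1` V in oU oD hphi *.
have [l [l1 l2]] := homeo_onE oU oD hphi.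
exists U, (realify \o phi).
have imE : (realify \o phi) @` U = @complexify R n @^-1` (phi @` U).
  apply/seteqP; split=> [_ [y Uy <-]|w [y Uy yw]] /=; first by rewrite realifyK; exists y.
  by exists y => //=; rewrite yw complexifyK.
have oI : open ((realify \o phi) @` U).
  by rewrite imE; move/continuousP: (@complexify_continuous R n); exact.
split; [exact: oU|exact: Vx|exact: oI|].
apply: (@homeo_onI _ _ _ _ _ (l \o @complexify R n)); [exact: oU|exact: oI| |].
  move=> y Uy; have [Dy ly pc] := l1 y Uy; split.
  - by exists y.
  - by rewrite /= realifyK ly.
  - exact: (cvg_comp phi (@realify R n) pc (@realify_continuous R n _)).
move=> w; rewrite imE => Dw; have [Ul lE lc] := l2 _ Dw; split; first exact: Ul.
- by rewrite /= lE complexifyK.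
- exact: (cvg_comp (@complexify R n) l (@complexify_continuous R n _) lc).
Qed.

Lemma realized_stab x : stab a x = Zsub A L (p x).
Proof.
have [hc tr _] := hr; have [oc cc _ _] := hc; have [j Uj] := cc (p x).
apply/seteqP; split=> u; first by move/(triv_stab P u (oc j) (tr j) Uj).
by move=> Zu; apply/(triv_stab P u (oc j) (tr j) Uj).
Qed.

Definition realized_base (o : orbit_space a) : B := p (repr o).

Lemma realized_baseE x : realized_base (mu x) = p x.
Proof.
have [_ _ pa _] := P; have : mu (repr (mu x)) = mu x by exact: reprK.
by move=> /esym/orbit_mapP[u uE]; rewrite /realized_base uE pa.
Qed.

Lemma realized_base_homeo : homeo realized_base.
Proof.
have [hc tr _] := hr; have [oc cc _ _] := hc; have [pc _ pa po] := P.
have rp (o : orbit_space a) : mu (repr o) = o by exact: reprK.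
split.
  apply: orbit_continuous => x.
  by rewrite (_ : realized_base \o mu = p); [exact: pc|exact/funext/realized_baseE].
exists (fun b => mu (point_over P b)); split.
- move=> b; have [j Uj] := cc b; have [k [k1 k2]] := triv_inv P (oc j) (tr j).
  apply: (@continuous_near_eq _ _ (fun b => mu (k (cls b 1%g)))).
    have : \forall b' \near b, cech_cover c j b' by exact: open_nbhs_nbhs.
    apply: filterS => b' Uj'; apply/orbit_mapP/po.
    have /k2[-> _ _] : cech_cover c j (mproj (cls b' 1%g)) by rewrite mproj_class.
    by rewrite mproj_class point_overK.
  have Uj' : cech_cover c j (mproj (cls b 1%g)) by rewrite mproj_class.
  have [_ _ kc] := k2 _ Uj'.
  have c1 : (fun b => k (cls b 1%g)) @ b --> k (cls b 1%g).
    apply: (cvg_comp (fun b => cls b 1%g) k _ kc).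
    by apply: cvg_mclass; [exact: cvg_id|exact: cvg_cst].
  exact: (cvg_comp _ mu c1 (@orbit_map_continuous R n X a _)).
- move=> o; rewrite -[RHS]rp; apply/orbit_mapP/po.
  by rewrite point_overK.
- by move=> b; rewrite realized_baseE point_overK.
Qed.

(** Both bundles are determined by the subtori over the facets: the primitive
    vectors of a circle span a single line. *)
Lemma realized_char_bundle : bundle_image realized_base (char_bundle a) = L.
Proof.
have ls := realized_locally_standard; have [rL _] := cL.
have rp (o : orbit_space a) : mu (repr o) = o by exact: reprK.
have fE x : facets (orbit_atlas a) (mu x) <-> facets A (p x).
  have fo := orbit_facetsP x ls.
  split=> [/fo[k kn r]|[k kn s]].
    by exists k => //; apply/(stratum_srank cA _ _ gd); rewrite -realized_stab.
  by apply/fo; exists k => //; rewrite realized_stab; apply/(stratum_srank cA _ _ gd).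
have ch x v : char_bundle a (mu x, v) <-> L (p x, v).
  have cP := char_bundleP ls x v; split=> [/cP[/fE fx [w [pw ew wv]]]|Lv].
    have [w' [pw' fw' ew']] := char_pair_facet cA cL fx.
    have : fiber L (p x) v; last exact.
    by rewrite fw' (@primitive_line R n w' w) // -ew' -ew realized_stab.
  have [L1 _ _] := rL; have fx := L1 _ _ Lv.
  have [w' [pw' fw' ew']] := char_pair_facet cA cL fx.
  apply/cP; split; first exact/fE.
  exists w'; split=> //; first by rewrite realized_stab.
  by have : fiber L (p x) v by []; rewrite fw'.
apply/seteqP; split=> [_ [[y v] + <-]|[b v] Lv] /=.
  by rewrite -(rp y) realized_baseE => /ch.
exists (mu (point_over P b), v); rewrite ?realized_baseE ?point_overK //.
by apply/ch; rewrite point_overK.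
Qed.

Lemma realized_existence : stratified_homeo (orbit_atlas a) A realized_base /\
  pull_class realized_base (cech_class c) = euler_class a.
Proof.
have ls := realized_locally_standard; have [rL _] := cL.
split.
  apply: orbit_stratified => // [|x k]; first exact: realized_base_homeo.
  by rewrite realized_baseE realized_stab; exact: stratum_srank.
have [g iso] := pair_isoP (orbit_corner_charts ls) (char_rank_one ls) cA rL
  realized_base_homeo realized_char_bundle.
apply: (euler_pull (orbit_good ls) iso (h := h)).
by rewrite (_ : realized_base \o mu = p); last exact/funext/realized_baseE.
Qed.
End Realizations.

(** * The space glued from a cocycle *)

Section GluedSpace.
Context {R : realType} {n : nat} {B : topologicalType}.
Context {A : set (chart R n B)} {L : set (B * 'rV[int]_n)}.
Local Notation T := (torus R n).
Local Notation M := (model A L).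
Local Notation cls := (@mclass R n B A L).

Definition from_glued (c : cech A L) (ix : B -> cech_idx c) (j : cech_idx c) (x : M) : M :=
  mmul (cech_val c j (ix (mproj x)) (mproj x)) x.

Definition to_glued (c : cech A L) (ix : B -> cech_idx c) (j : cech_idx c) (q : M) : M :=
  mmul (cech_val c (ix (mproj q)) j (mproj q)) q.

(** The glued space has the fibers of the model: a point over [b] stands for
    its image in the trivialization of index [ix b], where [ix b] is the index
    of a set of the cover that contains [b]. Only the topology has to be
    changed; the trivialization of index [j] is [from_glued ix j], with
    inverse [to_glued ix j] over the [j]-th set. *)
Definition glued (c : cech A L) (ix : B -> cech_idx c) : Type := M.

Section Topology.
Context (c : cech A L) (ix : B -> cech_idx c).

(** The finest topology for which all the maps [to_glued ix j] are continuous
    over the [j]-th set. *)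
Definition glued_open (V : set (glued ix)) : Prop := forall j (q : M),
  cech_cover c j (mproj q) -> V (to_glued ix j q) ->
  \forall q' \near q, V (to_glued ix j q').

Lemma glued_openT : glued_open setT.
Proof. by move=> j q _ _; exact: filterT. Qed.

Lemma glued_openI (V W : set (glued ix)) :
  glued_open V -> glued_open W -> glued_open (V `&` W).
Proof. by move=> oV oW j q Uq [/(oV _ _ Uq) nV /(oW _ _ Uq) nW]; exact: filterI. Qed.

Lemma glued_open_bigU (I : Type) (V : I -> set (glued ix)) :
  (forall i, glued_open (V i)) -> glued_open (\bigcup_i V i).
Proof.
move=> oV j q Uq [i _ /(oV i _ _ Uq)]; apply: filterS => q' Vq'.
by exists i.
Qed.

HB.instance Definition _ := Choice.on (glued ix).
HB.instance Definition _ :=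
  isOpenTopological.Build (glued ix) glued_openT glued_openI glued_open_bigU.
End Topology.

Context (gd : good A L) (c : cech A L) (hc : cocycle c).
Context (ix : B -> cech_idx c) (hix : forall b, cech_cover c (ix b) b).
Local Notation Y := (glued ix).
Local Notation U := (cech_cover c).
Local Notation g := (cech_val c).
Local Notation p := (@mproj R n B A L : Y -> B).
Local Notation from := (from_glued ix : cech_idx c -> Y -> M).
Local Notation to := (to_glued ix : cech_idx c -> M -> Y).

Lemma mproj_to j (q : M) : U j (mproj q) -> p (to j q) = mproj q.
Proof. by move=> Uq; rewrite /to_glued mproj_mmul // (cocycle_proj hc). Qed.

Lemma mproj_from j (x : Y) : U j (p x) -> mproj (from j x) = p x.
Proof. by move=> Ux; rewrite /from_glued mproj_mmul // (cocycle_proj hc). Qed.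

Lemma from_to k j (q : M) : U k (mproj q) -> U j (mproj q) ->
  from k (to j q) = mmul (g k j (mproj q)) q.
Proof.
move=> Uk Uj; have [_ _ _ cE] := hc.
have Ui := hix (mproj q).
rewrite /from_glued mproj_to // /to_glued mmulA ?(cocycle_proj hc) //.
by rewrite cE.
Qed.

Lemma from_toK j (q : M) : U j (mproj q) -> from j (to j q) = q.
Proof. by move=> Uq; rewrite from_to // (cocycle_one hc) // mmul1. Qed.

Lemma to_fromK j (x : Y) : U j (p x) -> to j (from j x) = x.
Proof.
move=> Uj; have [_ _ _ cE] := hc; have Ui := hix (p x).
rewrite /to_glued mproj_from // /from_glued mmulA ?(cocycle_proj hc) //.
by rewrite cE // (cocycle_one hc) // mmul1.
Qed.

Lemma to_continuous j (q : M) : U j (mproj q) -> to j @ q --> to j q.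
Proof.
move=> Uq N; rewrite nbhsE => -[V [oV Vq] VN]; have oV' : glued_open V by exact: oV.
by apply: filterS (oV' j q Uq Vq) => q' /VN.
Qed.

(** In terms of another trivialization, [from_glued ix k] is multiplication by
    the section [c_kj]. *)
Lemma from_continuous k (x : Y) : U k (p x) -> from k @ x --> from k x.
Proof.
move=> Ux N; rewrite nbhsE => -[D [oD Dx] DN].
have oU i : open (U i) by have [] := hc.
pose V := [set y : Y | U k (p y) /\ D (from k y)].
have oV : open V.
  suff : glued_open V by [].
  move=> j q Uj; rewrite /V /= mproj_to // => -[Uk]; rewrite from_to // => Dq.
  have cc : (fun q' : M => mmul (g k j (mproj q')) q') @ q --> mmul (g k j (mproj q)) q.
    have Ukj : (U k `&` U j) (mproj q) by [].
    have s : is_section (U k `&` U j) (g k j) by have [] := hc.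
    have oI : open (U k `&` U j) by exact: openI.
    have mc := @mproj_continuous R n B A L q.
    apply: (@cvg_mmul R n B A L gd M (nbhs q) (fun q' => g k j (mproj q')) id);
      [|by rewrite (cocycle_proj hc)| |exact: cvg_id].
      by have := section_near oI s Ukj => /mc.
    exact: (cvg_comp (@mproj R n B A L) (g k j) mc (section_cvg oI s Ukj)).
  have near_U i : U i (mproj q) -> \forall q' \near q, U i (mproj q').
    by move=> Ui; apply: (@mproj_continuous R n B A L q); exact: open_nbhs_nbhs.
  have hD : \forall q' \near q, D (mmul (g k j (mproj q')) q').
    by apply: cc; exact: open_nbhs_nbhs.
  apply: filterS3 (near_U j Uj) (near_U k Uk) hD => q' Uj' Uk' Dq'.
  by rewrite /V /= mproj_to // from_to.
have : nbhs x V by exact: open_nbhs_nbhs.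
by apply: filterS => y [_ /DN].
Qed.

Lemma glued_proj_continuous : continuous p.
Proof.
move=> x; have E : (fun y : Y => mproj (from (ix (p x)) y)) = p.
  by apply/funext => y; exact: mproj_mact.
have h := cvg_comp (from (ix (p x))) (@mproj R n B A L) (from_continuous (hix (p x)))
  (@mproj_continuous R n B A L _).
by move: h; rewrite [X in X @ _ --> _]E mproj_from.
Qed.

Lemma from_mact j u (x : Y) : U j (p x) -> from j (mact u x : Y) = mact u (from j x).
Proof. by move=> Ux; rewrite /from_glued mproj_mact mact_mmul // (cocycle_proj hc). Qed.

Lemma to_mact j u (q : M) : U j (mproj q) -> to j (mact u q) = mact u (to j q).
Proof. by move=> Uq; rewrite /to_glued mproj_mact mact_mmul // (cocycle_proj hc). Qed.

Definition glued_act (u : T) (x : Y) : Y := mact u x.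

Lemma glued_act_continuous : continuous (fun r : T * Y => glued_act r.1 r.2).
Proof.
move=> [u x]; set j := ix (p x); have Ux : U j (p x) := hix (p x).
apply: (@continuous_near_eq (T * Y)%type Y
  (fun r => to j (mact r.1 (from j r.2))) _ (u, x)).
  have nU : \forall y \near x, U j (p y).
    by apply: glued_proj_continuous; apply: open_nbhs_nbhs; split=> //; exact: (cocycle_open j hc).
  have : \forall r \near (u, x), U j (p r.2).
    exact: (@cvg_snd _ _ (nbhs u) (nbhs x) _ _ nU).
  apply: filterS => -[v y] /= Uy.
  by rewrite to_mact ?mproj_from // to_fromK.
have ac : (fun r : T * Y => mact r.1 (from j r.2)) @ (u, x) --> mact u (from j x).
  apply: (@cvg_mact R n B A L gd (T * Y)%type (nbhs (u, x)) fst (fun r => from j r.2)).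
    exact: (@cvg_fst _ _ (nbhs u) (nbhs x) _).
  exact: (cvg_comp (fun r : T * Y => r.2) (from j)
    (@cvg_snd _ _ (nbhs u) (nbhs x) _) (from_continuous Ux)).
apply: (cvg_comp _ (to j) ac); apply: to_continuous.
by rewrite mproj_mact mproj_from.
Qed.

Definition glued_action : torus_action R n Y :=
  @TorusAction R n Y glued_act (@mact1 R n B A L)
    (fun u v x => esym (mactM u v x)) glued_act_continuous.

Lemma glued_projection : orbit_projection glued_action p.
Proof.
split; [exact: glued_proj_continuous| |exact: mproj_mact|exact: mact_transitive].
by move=> b; exists (cls b 1%g); exact: mproj_class.
Qed.

Lemma glued_realizes : realizes glued_action p (c := c) from.
Proof.
have [_ _ _ cE] := hc.
split=> // [j|i j x Ui Uj]; last by rewrite /from_glued mmulA ?(cocycle_proj hc) ?cE.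
have oU := cocycle_open j hc.
split; [|exact: mproj_from|by move=> u x; exact: from_mact].
apply: (@homeo_onI _ _ _ _ _ (to j)).
- exact: (open_over_base glued_projection).
- exact: open_over_model.
- by move=> x Ux; split; [rewrite /= mproj_from|exact: to_fromK|exact: from_continuous].
- by move=> q Uq; split; [rewrite /= mproj_to|exact: from_toK|exact: to_continuous].
Qed.
End GluedSpace.

Theorem corollary2 (R : realType) (n : nat) :
  (forall (X1 X2 : topologicalType)
      (a1 : torus_action R n X1) (a2 : torus_action R n X2),
    compact_manifold R (2 * n) X1 -> locally_standard a1 ->
    compact_manifold R (2 * n) X2 -> locally_standard a2 ->
    ((exists f : X1 -> X2, homeo f /\ forall u x, f (a1 u x) = a2 u (f x)) <->
     exists fB : orbit_space a1 -> orbit_space a2,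
       [/\ stratified_homeo (orbit_atlas a1) (orbit_atlas a2) fB,
           bundle_image fB (char_bundle a1) = char_bundle a2 &
           pull_class fB (euler_class a2) = euler_class a1])) /\
  (forall (B : topologicalType) (A : set (chart R n B))
      (L : set (B * 'rV[int]_n)) (e : set (cech A L)),
    compact [set: B] -> corner_manifold A -> characteristic_pair A L ->
    H1 A L e ->
    exists (X : topologicalType) (a : torus_action R n X)
        (g : orbit_space a -> B),
      compact_manifold R (2 * n) X /\ locally_standard a /\
      [/\ stratified_homeo (orbit_atlas a) A g,
          bundle_image g (char_bundle a) = L &
          pull_class g e = euler_class a]).
Proof.
split=> [X1 X2 a1 a2 [_ cX1 _] ls1 [hX2 cX2 _] ls2|B A L e cB mB cL [c hc <-]].
  exact: classification.
have [hB cov ch st] := mB; have cA : corner_charts A by split.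
have gd := char_pair_good cA cL; have [_ cc _ _] := hc.
have [ix hix] := choice cc.
pose a := glued_action gd hc hix.
have P := glued_projection gd hc hix; have hr := glued_realizes gd hc hix.
exists (glued ix), a, (realized_base (a := a) (@mproj R n B A L)).
have [hS hE] := realized_existence cA cL P hr.
split; first exact: (realized_manifold cA cL P hr).
split; first exact: (realized_locally_standard cA cL P hr).
by split=> //; exact: (realized_char_bundle cA cL P hr).
Qed.
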